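(* Let $\mathcal{H}$ be a Hilbert space and let $B$ be a unital $C^*$-subalgebra of $B(\mathcal{H})$. The association $E_{\mathcal{A}_B}^B\to\widehat{\chi}_B^{\mathcal{H}}$, $\phi\mapsto g_\phi$, is noninjective if $B$ is not one-dimensional. Furthermore, if $B$ is weakly closed, then the set of Herglotz functions represented by conditional expectations, $\{g_\phi:\phi\in E_{\mathcal{A}_B}^B\}$, is compact in the pointwise weak operator topology.
   Context: Unital $C^*$-algebras and Hilbert spaces are assumed nonzero. Operator-valued states: for a normed unital $*$-algebra $\mathcal{A}$ (not necessarily complete) and a Hilbert space $\mathcal{H}$, an operator-valued state on $\mathcal{A}$ is a linear map $\phi:\mathcal{A}\to B(\mathcal{H})$ with (i) $\phi(1)=1$; (ii) for all $a_1,\dots,a_n\in\mathcal{A}$, the operator matrix $[\phi(a_j^*a_i)]_{1\le i,j\le n}$ is positive, i.e. $\sum_{i,j}\langle\phi(a_j^*a_i)h_i,h_j\rangle\ge 0$ for all $h_1,\dots,h_n\in\mathcal{H}$; (iii) for all $a_1,\dots,a_n,b\in\mathcal{A}$, $[\phi(a_j^*(\|b^*b\|-b^*b)a_i)]_{1\le i,j\le n}$ is positive in the same sense. The set of these is $\Phi_{\mathcal{A}}^{\mathcal{H}}$. The algebra $\mathcal{A}_B$: for a unital $C^*$-algebra $B$, $\mathcal{A}_B$ is the free product, in the category of unital complex $*$-algebras, of $B$ and $\mathbb{C}[\mathbb{Z}]$; that is, the $*$-algebra generated by $B$ and one additional unitary $u$ with no other relations. It embeds densely in the unital $C^*$-algebraic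 (universal) free product $\overline{\mathcal{A}_B}$ of $B$ and $C^*(\mathbb{Z})$ and carries the norm of $\overline{\mathcal{A}_B}$. For $B\subseteq B(\mathcal{H})$ a unital $C^*$-subalgebra, $E_{\mathcal{A}_B}^B\subseteq\Phi_{\mathcal{A}_B}^{\mathcal{H}}$ is the set of operator-valued states $\phi$ on $\mathcal{A}_B$ that are conditional expectations onto $B$: $\phi$ takes values in $B$ and $\phi(b_1mb_2)=b_1\phi(m)b_2$ for all $m\in\mathcal{A}_B$, $b_1,b_2\in B$. GNS-type construction: given $\phi\in\Phi_{\mathcal{A}_B}^{\mathcal{H}}$, equip $\mathcal{A}_B\otimes_{\mathrm{alg}}\mathcal{H}$ with the form $\langle a_1\otimes h_1,a_2\otimes h_2\rangle=\langle\phi(a_2^*a_1)h_1,h_2\rangle_{\mathcal{H}}$. Quotienting by null vectors and completing gives a Hilbert space $\mathcal{H}_\phi$ containing $\mathcal{H}$ via $h\mapsto 1\otimes h$, and a unital representation $\pi_\phi:\mathcal{A}_B\to B(\mathcal{H}_\phi)$, $\pi_\phi(b)(a\otimes h)=ba\otimes h$. Let $R_\phi:B(\mathcal{H}_\phi)\to B(\mathcal{H})$ be the restriction map $R_\phi(T)=P_{\mathcal{H}}T|_{\mathcal{H}}$. Free functions: $\mathrm{Ball}(B)$ is the set of square matrices over $B$ (of all sizes) of norm $<1$, and $\mathrm{RHP}(B(\mathcal{H}))$ is the set of square matrices over $B(\mathcal{H})$ with positive semidefinite real part. A free function $f:\mathrm{Ball}(B)\to\mathrm{RHP}(B(\mathcal{H}))$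 maps $n\times n$ matrices to $n\times n$ matrices and satisfies $\Gamma f(X)=f(Y)\Gamma$ whenever $\Gamma X=Y\Gamma$ for a rectangular scalar matrix $\Gamma$. For $X\in\mathrm{Ball}(B)\cap M_n(B)$ put $$g_\phi(X)=(R_\phi\otimes 1_n)\left[\big(I+(\pi_\phi(u)\otimes I_n)(\pi_\phi\otimes 1_n)(X)\big)\big(I-(\pi_\phi(u)\otimes I_n)(\pi_\phi\otimes 1_n)(X)\big)^{-1}\right],$$ where $1_n$ is the identity map on $M_n(\mathbb{C})$ and $I_n$ the identity matrix. $\widehat{\chi}_B^{\mathcal{H}}$ is the set of representable regular Herglotz functions, i.e. free functions $f:\mathrm{Ball}(B)\to\mathrm{RHP}(B(\mathcal{H}))$ with $f(0)=I$ for which there exist a Hilbert space $\widehat{\mathcal{H}}\supseteq\mathcal{H}$, a unitary $U$ on $\widehat{\mathcal{H}}$, and a unital representation ($*$-homomorphism) $\alpha:B\to B(\widehat{\mathcal{H}})$ such that for all $n$ and $X\in\mathrm{Ball}(B)\cap M_n(B)$, $$f(X)=(R\otimes 1_n)\left[\big(I+(U\otimes I_n)(\alpha\otimes 1_n)(X)\big)\big(I-(U\otimes I_n)(\alpha\otimes 1_n)(X)\big)^{-1}\right],$$ with $R:B(\widehat{\mathcal{H}})\to B(\mathcal{H})$, $R(T)=P_{\mathcal{H}}T|_{\mathcal{H}}$. In the pointwise weak operator topology, a net $f_\lambda\to f$ iff for every $n$ and every $X\in\mathrm{Ball}(B)\cap M_n(B)$, $f_\lambda(X)\to f(X)$ in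 the weak operator topology of $B(\mathcal{H}\otimes\mathbb{C}^n)$. ''Weakly closed'' means closed in the weak operator topology of $B(\mathcal{H})$. *)

(* Defs.v *)
From HB Require Import structures.
From mathcomp Require Import all_boot all_order all_algebra generic_quotient.
From mathcomp Require Import all_classical all_reals all_analysis.
From mathcomp Require Import complex ring lra.

Set Implicit Arguments.
Unset Strict Implicit.
Unset Printing Implicit Defensive.

Import Order.TTheory GRing.Theory Num.Theory numFieldNormedType.Exports.

Local Open Scope classical_set_scope.
Local Open Scope ring_scope.
Local Open Scope quotient_scope.

(* The inner product is linear in its first argument; Hilbert spaces are
   nonzero by convention. *)
HB.mixin Record isHilbert (R : realType) H of CompleteNormedModule R[i] H := {
  inner : H -> H -> R[i];
  innerPl : forall a x y z, inner (a *: x + y) z = a * inner x z + inner y z;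
  innerC : forall x y, inner y x = (inner x y)^*;
  inner_norm : forall x, inner x x = `|x| ^+ 2;
  hilbert_nontrivial : exists x : H, x != 0 }.

#[short(type="hilbertType")]
HB.structure Definition Hilbert (R : realType) :=
  { H of isHilbert R H & CompleteNormedModule R[i] H }.

Section HilbertTheory.
Variables (R : realType) (H : hilbertType R).
Implicit Types (x y z : H) (a : R[i]).

Lemma innerDl x y z : inner (x + y) z = inner x z + inner y z.
Proof. by rewrite -[x]scale1r innerPl mul1r scale1r. Qed.

Lemma inner0l z : inner 0 z = 0.
Proof. by apply: (addrI (inner 0 z)); rewrite -innerDl !addr0. Qed.

Lemma innerZl a x z : inner (a *: x) z = a * inner x z.
Proof. by rewrite -[a *: x]addr0 innerPl inner0l addr0. Qed.

Lemma innerNl x z : inner (- x) z = - inner x z.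
Proof. by rewrite -scaleN1r innerZl mulN1r. Qed.

Lemma innerDr x y z : inner z (x + y) = inner z x + inner z y.
Proof. by rewrite innerC innerDl rmorphD /= -!innerC. Qed.

Lemma innerZr a x z : inner z (a *: x) = a^* * inner z x.
Proof. by rewrite innerC innerZl rmorphM /= -innerC. Qed.

Lemma inner0r z : inner z 0 = 0.
Proof. by rewrite innerC inner0l rmorph0. Qed.

Lemma innerNr x z : inner z (- x) = - inner z x.
Proof. by rewrite innerC innerNl rmorphN /= -innerC. Qed.

Lemma inner_injr x y : (forall z, inner z x = inner z y) -> x = y.
Proof.
move=> E; apply/eqP; rewrite -subr_eq0 -normr_eq0 -sqrf_eq0 -inner_norm.
by rewrite innerDr innerNr E subrr.
Qed.

Lemma CauchySchwarz_inner x y : `|inner x y| <= `|x| * `|y|.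
Proof.
have [->|y0] := eqVneq y 0; first by rewrite inner0r normr0 normr0 mulr0.
rewrite -(@ler_pXn2r _ 2) ?nnegrE ?mulr_ge0// exprMn.
have y2 : 0 < `|y| ^+ 2 by rewrite exprn_gt0 ?normr_gt0.
rewrite -(ler_pM2l y2).
have : 0 <= `|(`|y| ^+ 2) *: x - inner x y *: y| ^+ 2 by rewrite exprn_ge0.
have ry : (`|y| ^+ 2)^* = `|y| ^+ 2 by rewrite geC0_conj ?exprn_ge0.
rewrite -inner_norm innerDl !innerDr !innerNl !innerNr !innerZl !innerZr ry.
rewrite !inner_norm (innerC x y) normCK -subr_ge0.
by congr (0 <= _); ring.
Qed.

Lemma norm_ReE x : `|x| = (complex.Re `|x|)%:C%C.
Proof. by rewrite RRe_real// ger0_real. Qed.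

Lemma Re_norm_ge0 x : 0 <= complex.Re `|x|.
Proof. by rewrite -ler0c -norm_ReE. Qed.

Lemma ReD (a b : R[i]) : complex.Re (a + b) = complex.Re a + complex.Re b.
Proof. by case: a; case: b. Qed.

Lemma ReN (a : R[i]) : complex.Re (- a) = - complex.Re a.
Proof. by case: a. Qed.

Lemma ReRM (r : R) (a : R[i]) : complex.Re (r%:C%C * a) = r * complex.Re a.
Proof. by case: a => a b /=; rewrite mul0r subr0. Qed.

Lemma le_normRe (a : R[i]) (r : R) : `|a| <= r%:C%C -> `|complex.Re a| <= r.
Proof. by move=> /(le_trans (normc_ge_Re a)); rewrite lecR. Qed.

Lemma ReJ (a : R[i]) : complex.Re a^* = complex.Re a.
Proof. by case: a. Qed.

Lemma normsqD x y : complex.Re (inner (x + y) (x + y)) =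
  complex.Re (inner x x) + 2 * complex.Re (inner x y) + complex.Re (inner y y).
Proof.
by rewrite innerDl !innerDr !ReD [inner y x]innerC ReJ; ring.
Qed.

Lemma conj_realC (t : R) : (t%:C%C : R[i])^* = t%:C%C.
Proof. exact: conjc_real. Qed.

Lemma ReZsq (t : R) x : complex.Re (inner (t%:C%C *: x) (t%:C%C *: x)) =
  t ^+ 2 * complex.Re (inner x x).
Proof.
by rewrite innerZl innerZr conj_realC !ReRM; ring.
Qed.

Lemma Re_inner_norm x : complex.Re (inner x x) = complex.Re `|x| ^+ 2.
Proof. by rewrite inner_norm norm_ReE -rmorphXn. Qed.

Lemma ReiM (a : R[i]) : complex.Re ('i%C * a) = - complex.Im a.
Proof. by case: a => a b /=; rewrite mul0r mul1r sub0r. Qed.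

(* Riesz representation, by minimization of |z|^2 - 2 Re f(z) *)
Section Riesz.
Variables (f : H -> R[i]) (M : R).
Hypothesis fD : forall x y, f (x + y) = f x + f y.
Hypothesis fZ : forall a x, f (a *: x) = a * f x.
Hypothesis fM : forall x, `|f x| <= M%:C%C * `|x|.

Let J z : R := complex.Re (inner z z) - 2 * complex.Re (f z).
Let m : R := inf [set J z | z in setT].

Let JM z : - M ^+ 2 <= J z.
Proof.
rewrite /J Re_inner_norm.
have : `|complex.Re (f z)| <= M * complex.Re `|z|.
  by apply: le_normRe; rewrite rmorphM /= -norm_ReE.
rewrite ler_norml => /andP[_ h].
have := sqr_ge0 (M - complex.Re `|z|); nra.
Qed.

Let m_le z : m <= J z.
Proof.
apply: ge_inf; last by exists z.
by exists (- M ^+ 2) => _ [w _ <-]; exact: JM.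
Qed.

Let m_ex (d : R) : 0 < d -> exists z, J z < m + d.
Proof.
move=> d0.
have hi : has_inf [set J z | z in setT].
  split; first by exists (J 0), 0.
  by exists (- M ^+ 2) => _ [w _ <-]; exact: JM.
by have [_ [z _ <-] h] := inf_adherent d0 hi; exists z.
Qed.

Let F : set_system H :=
  filter_from [set d : R | 0 < d] (fun d => [set z | J z < m + d]).

Let F_proper : ProperFilter F.
Proof.
apply: filter_from_proper; last by move=> d /m_ex[z hz]; exists z.
apply: filter_from_filter; first by exists 1; rewrite /= ltr01.
move=> a b a0 b0; exists (Num.min a b); first by rewrite /= lt_min a0 b0.
move=> z /= hz; split; apply: (lt_le_trans hz); rewrite lerD2l ge_min lexx//.
by rewrite orbT.
Qed.

Let J_mid x y : J ((2^-1 : R)%:C%C *: (x + y)) =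
  (J x + J y) / 2 - complex.Re (inner (x - y) (x - y)) / 4.
Proof.
rewrite /J ReZsq fZ fD ReRM !normsqD innerNr innerNl !innerNr !opprK !ReN !ReD.
by field.
Qed.

Let F_cauchy : cauchy F.
Proof.
have FP := F_proper; apply: cauchy_exP => e e0.
have [e' e'E] : exists e' : R, e = e'%:C%C.
  by exists (complex.Re e); rewrite RRe_real// gtr0_real.
move: e0; rewrite e'E ltcR => e0.
have d0 : 0 < e' ^+ 2 / 4 by rewrite divr_gt0 ?exprn_gt0.
have [x hx] := m_ex d0.
exists x, (e' ^+ 2 / 4) => //= z hz.
rewrite -ball_normE /ball_ /= norm_ReE ltcR.
rewrite -(@ltr_pXn2r _ 2) ?nnegrE ?(ltW e0)// ?Re_norm_ge0//.
rewrite -Re_inner_norm.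
have := m_le ((2^-1 : R)%:C%C *: (x + z)); rewrite J_mid; move: hz => /= hz; lra.
Qed.

Let riesz_Re z x : (forall d : R, 0 < d -> exists2 w, J w < m + d &
    complex.Re `|z - w| <= d) ->
  complex.Re (f x) = complex.Re (inner z x).
Proof.
move=> hz.
set N := complex.Re (inner x x); set c := complex.Re (inner z x) - complex.Re (f x).
have N0 : 0 <= N by rewrite /N Re_inner_norm exprn_ge0// Re_norm_ge0.
pose nx := complex.Re `|x|.
have nx0 : 0 <= nx by exact: Re_norm_ge0.
have key (t d : R) : 0 < d -> - d <= 2 * t * c + 2 * `|t| * d * nx + t ^+ 2 * N.
  move=> d0; have [w Jw zw] := hz d d0.
  have := m_le (w + t%:C%C *: x).
  move: Jw; rewrite /J normsqD ReZsq fD fZ ReD ReRM innerZr conj_realC ReRM -/N.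
  have : `|complex.Re (inner w x) - complex.Re (inner z x)| <= d * nx.
    rewrite -ReN -ReD -innerNl -innerDl.
    apply: le_normRe; apply: (le_trans (CauchySchwarz_inner _ _)).
    rewrite distrC rmorphM /= -norm_ReE ler_wpM2r//.
    by rewrite norm_ReE lecR.
  set A := _ - _ => hA J1 J2.
  have : `|t * A| <= `|t| * (d * nx) by rewrite normrM ler_wpM2l.
  rewrite ler_norml /A /c => /andP[_]; nra.
have key2 t : 0 <= 2 * t * c + t ^+ 2 * N.
  rewrite leNgt; apply/negP => neg.
  set s := _ + _ in neg.
  pose k := 2 * `|t| * nx + 1.
  have k0 : 0 < k by rewrite /k ltr_wpDl// !mulr_ge0.
  have := key t (- s / (2 * k)).
  have d0 : 0 < - s / (2 * k) by rewrite divr_gt0 ?oppr_gt0// mulr_gt0.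
  move=> /(_ d0); set d := - s / (2 * k).
  have dk : d * k = - s / 2 by rewrite /d; field; rewrite gt_eqF.
  rewrite (_ : _ + _ = s + (d * k - d)); last by rewrite /s /k; ring.
  rewrite dk; lra.
have := key2 (- c / (N + 1)).
have N1 : 0 < N + 1 by lra.
have -> : 2 * (- c / (N + 1)) * c + (- c / (N + 1)) ^+ 2 * N =
   - (c ^+ 2 * ((N + 2) / (N + 1) ^+ 2)) by field; rewrite gt_eqF.
have p0 : 0 < (N + 2) / (N + 1) ^+ 2 by rewrite divr_gt0 ?exprn_gt0//; lra.
rewrite oppr_ge0 pmulr_lle0// => h.
have c0 : c ^+ 2 = 0 by apply/eqP; rewrite eq_le h sqr_ge0.
move/eqP: c0; rewrite sqrf_eq0 /c subr_eq0 => /eqP -> //.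
Qed.

Lemma riesz : exists z, forall x, f x = inner x z.
Proof.
have FP := F_proper; have /cauchy_cvg/cvg_ex[z Fz] := F_cauchy.
exists z => x.
have hz (d : R) : 0 < d -> exists2 w, J w < m + d & complex.Re `|z - w| <= d.
  move=> d0.
  have dC : 0 < d%:C%C :> R[i] by rewrite ltcR.
  have FB : F (ball z d%:C%C) by apply: Fz; exact: nbhsx_ballx.
  have FJ : F [set w | J w < m + d] by exists d.
  have [w [wB wJ]] := filter_ex (filterI FB FJ).
  exists w => //; move: wB; rewrite -ball_normE /ball_ /= norm_ReE ltcR.
  exact: ltW.
apply/eqP; rewrite eq_complex; apply/andP; split; apply/eqP.
  by rewrite (riesz_Re _ hz) innerC ReJ.
have := riesz_Re ('i%C *: x) hz.
rewrite fZ ReiM [inner z _]innerC innerZl ReJ ReiM => /oppr_inj //.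
Qed.

End Riesz.

End HilbertTheory.

HB.mixin Record isStarAlgebra (R : realType) A of GRing.Algebra R[i] A := {
  star : A -> A;
  starD : {morph star : a b / a + b};
  starZ : forall (c : R[i]) a, star (c *: a) = c^* *: star a;
  starM : forall a b, star (a * b) = star b * star a;
  starK : involutive star }.

#[short(type="starAlgType")]
HB.structure Definition StarAlgebra (R : realType) :=
  { A of isStarAlgebra R A & GRing.Algebra R[i] A }.

Section StarAlgebraTheory.
Variables (R : realType) (A : starAlgType R).

Lemma star1 : star (1 : A) = 1.
Proof. by rewrite -[LHS]mulr1 -[X in _ * X]starK -starM mulr1 starK. Qed.

Definition unitary (u : A) := star u * u = 1 /\ u * star u = 1.

End StarAlgebraTheory.

Definition star_preserving (R : realType) (A A' : starAlgType R)
    (f : A -> A') := forall a, f (star a) = star (f a).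

Record bop (R : realType) (H K : hilbertType R) := Bop {
  bop_fun :> H -> K;
  bop_linear : linear bop_fun;
  bop_bounded : exists M : R, forall x, `|bop_fun x| <= M%:C%C * `|x| }.

HB.instance Definition _ (R : realType) (H K : hilbertType R) (T : bop H K) :=
  GRing.isLinear.Build R[i] H K *:%R T (bop_linear T).

HB.instance Definition _ (R : realType) (H K : hilbertType R) :=
  gen_eqMixin (bop H K).
HB.instance Definition _ (R : realType) (H K : hilbertType R) :=
  gen_choiceMixin (bop H K).

Lemma bopP (R : realType) (H K : hilbertType R) (S T : bop H K) :
  (forall x, S x = T x) -> S = T.
Proof.
case: S => s ls bs; case: T => t lt bt /= /funext st; subst t.
by rewrite (Prop_irrelevance ls lt) (Prop_irrelevance bs bt).
Qed.

Section BopOperations.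
Variables (R : realType) (H K L : hilbertType R).
Implicit Types T : bop H K.

Lemma bop_bound (H' K' : hilbertType R) (T : bop H' K') : exists2 M : R, 0 <= M &
  forall x, `|T x| <= M%:C%C * `|x|.
Proof.
have [M TM] := bop_bounded T; exists `|M| => // x.
by apply: le_trans (TM x) _; rewrite ler_wpM2r// lecR ler_norm.
Qed.

Fact bop0_linear : linear (fun _ : H => 0 : K).
Proof. by move=> a x y; rewrite scaler0 addr0. Qed.
Fact bop0_bounded : exists M : R, forall x : H, `|0 : K| <= M%:C%C * `|x|.
Proof. by exists 0 => x; rewrite normr0 mul0r. Qed.
Definition bop0 := Bop bop0_linear bop0_bounded.

Fact bop_add_linear (S T : bop H K) : linear (fun x => S x + T x).
Proof. by move=> a x y; rewrite !linearP scalerDr addrACA. Qed.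
Fact bop_add_bounded (S T : bop H K) :
  exists M : R, forall x, `|S x + T x| <= M%:C%C * `|x|.
Proof.
have [M SM] := bop_bounded S; have [N TN] := bop_bounded T.
exists (M + N) => x; apply: le_trans (ler_normD _ _) _.
by rewrite rmorphD /= mulrDl lerD.
Qed.
Definition bop_add (S T : bop H K) := Bop (bop_add_linear S T) (bop_add_bounded S T).

Fact bop_scale_linear (c : R[i]) T : linear (fun x => c *: T x).
Proof. by move=> a x y; rewrite linearP scalerDr !scalerA mulrC. Qed.
Fact bop_scale_bounded (c : R[i]) T :
  exists M : R, forall x, `|c *: T x| <= M%:C%C * `|x|.
Proof.
have [M TM] := bop_bounded T; exists (complex.Re `|c| * M) => x.
have cE : `|c| = (complex.Re `|c|)%:C%C by rewrite RRe_real// ger0_real.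
by rewrite normrZ rmorphM -mulrA {1}cE ler_wpM2l// -cE.
Qed.
Definition bop_scale c T := Bop (bop_scale_linear c T) (bop_scale_bounded c T).

Fact bop_comp_linear (S : bop K L) T : linear (fun x => S (T x)).
Proof. by move=> a x y; rewrite !linearP. Qed.
Fact bop_comp_bounded (S : bop K L) T :
  exists M : R, forall x, `|S (T x)| <= M%:C%C * `|x|.
Proof.
have [M M0 SM] := bop_bound S; have [N TN] := bop_bounded T.
exists (M * N) => x; apply: le_trans (SM _) _.
by rewrite rmorphM /= -mulrA ler_wpM2l ?ler0c.
Qed.
Definition bop_comp (S : bop K L) T :=
  Bop (bop_comp_linear S T) (bop_comp_bounded S T).

Fact bop_id_linear : linear (fun x : H => x). Proof. by []. Qed.
Fact bop_id_bounded : exists M : R, forall x : H, `|x| <= M%:C%C * `|x|.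
Proof. by exists 1 => x; rewrite mul1r. Qed.
Definition bop_id := Bop bop_id_linear bop_id_bounded.

Lemma adjoint_ex T : exists S : bop K H,
  forall x y, inner (T x) y = inner x (S y).
Proof.
have [M M0 TM] := bop_bound T.
have ex y : exists z, forall x, inner (T x) y = inner x z.
  apply: (@riesz _ _ (fun x => inner (T x) y) (M * complex.Re `|y|)).
  - by move=> x x'; rewrite linearD innerDl.
  - by move=> a x; rewrite linearZ innerZl.
  - move=> x; apply: le_trans (CauchySchwarz_inner _ _) _.
    by rewrite rmorphM /= -norm_ReE mulrAC ler_wpM2r.
have [g gE] := choice ex.
have gl : linear g.
  move=> a y y'; apply: inner_injr => x.
  by rewrite -gE innerDr innerZr innerDr innerZr -!gE.
have gb : exists M : R, forall y, `|g y| <= M%:C%C * `|y|.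
  exists M => y; have [->|g0] := eqVneq (g y) 0.
    by rewrite normr0 mulr_ge0// ler0c.
  have gp : 0 < `|g y| by rewrite normr_gt0.
  rewrite -(ler_pM2l gp) -expr2 -inner_norm -gE.
  apply: le_trans (real_ler_norm _) _; first by rewrite gE inner_norm realX// ger0_real.
  apply: le_trans (CauchySchwarz_inner _ _) _.
  by rewrite [leRHS]mulrA [`|g y| * _]mulrC ler_wpM2r.
by exists (Bop gl gb) => x y; rewrite gE.
Qed.

Definition adj T : bop K H := projT1 (cid (adjoint_ex T)).

Lemma adjE T x y : inner (T x) y = inner x (adj T y).
Proof. by rewrite /adj; case: cid => S SE /=. Qed.

Lemma adj_unique T (S : bop K H) :
  (forall x y, inner (T x) y = inner x (S y)) -> adj T = S.
Proof.
by move=> SE; apply: bopP => y; apply: inner_injr => x; rewrite -adjE SE.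
Qed.

End BopOperations.

Section BopModule.
Variables (R : realType) (H K : hilbertType R).
Implicit Types (S T U : bop H K).

Fact bop_addA : associative (@bop_add R H K).
Proof. by move=> S T U; apply: bopP => x /=; rewrite addrA. Qed.
Fact bop_addC : commutative (@bop_add R H K).
Proof. by move=> S T; apply: bopP => x /=; rewrite addrC. Qed.
Fact bop_add0 : left_id (@bop0 R H K) (@bop_add R H K).
Proof. by move=> T; apply: bopP => x /=; rewrite add0r. Qed.
Fact bop_addN : left_inverse (@bop0 R H K) (bop_scale (-1)) (@bop_add R H K).
Proof. by move=> T; apply: bopP => x /=; rewrite scaleN1r addNr. Qed.
HB.instance Definition _ :=
  GRing.isZmodule.Build (bop H K) bop_addA bop_addC bop_add0 bop_addN.

Fact bop_scaleA a b T : bop_scale a (bop_scale b T) = bop_scale (a * b) T.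
Proof. by apply: bopP => x /=; rewrite scalerA. Qed.
Fact bop_scale1 : left_id 1 (@bop_scale R H K).
Proof. by move=> T; apply: bopP => x /=; rewrite scale1r. Qed.
Fact bop_scaleDr : right_distributive (@bop_scale R H K) +%R.
Proof. by move=> a S T; apply: bopP => x /=; rewrite scalerDr. Qed.
Fact bop_scaleDl T : {morph (@bop_scale R H K)^~ T : a b / a + b}.
Proof. by move=> a b; apply: bopP => x /=; rewrite scalerDl. Qed.
HB.instance Definition _ := GRing.Zmodule_isLmodule.Build R[i] (bop H K)
  bop_scaleA bop_scale1 bop_scaleDr bop_scaleDl.

End BopModule.

Section BopAlgebra.
Variables (R : realType) (H : hilbertType R).
Implicit Types (S T U : bop H H).

Fact bop_compA : associative (@bop_comp R H H H).
Proof. by move=> S T U; apply: bopP. Qed.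
Fact bop_comp1l : left_id (bop_id H) (@bop_comp R H H H).
Proof. by move=> T; apply: bopP. Qed.
Fact bop_comp1r : right_id (bop_id H) (@bop_comp R H H H).
Proof. by move=> T; apply: bopP. Qed.
Fact bop_compDl : left_distributive (@bop_comp R H H H) +%R.
Proof. by move=> S T U; apply: bopP. Qed.
Fact bop_compDr : right_distributive (@bop_comp R H H H) +%R.
Proof. by move=> S T U; apply: bopP => x /=; rewrite linearD. Qed.
Fact bop_id_neq0 : bop_id H != 0.
Proof.
have [x x0] := @hilbert_nontrivial _ H; apply/eqP => /(congr1 (fun T => bop_fun T x)).
by move=> /= /eqP; rewrite (negPf x0).
Qed.
HB.instance Definition _ := GRing.Zmodule_isNzRing.Build (bop H H)
  bop_compA bop_comp1l bop_comp1r bop_compDl bop_compDr bop_id_neq0.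

Fact bop_scaleAl (a : R[i]) S T : a *: (S * T) = (a *: S) * T.
Proof. exact: bopP. Qed.
HB.instance Definition _ :=
  GRing.Lmodule_isLalgebra.Build R[i] (bop H H) bop_scaleAl.
Fact bop_scaleAr (a : R[i]) S T : a *: (S * T) = S * (a *: T).
Proof. by apply: bopP => x /=; rewrite linearZ. Qed.
HB.instance Definition _ :=
  GRing.Lalgebra_isAlgebra.Build R[i] (bop H H) bop_scaleAr.

Fact adjD : {morph (@adj R H H) : S T / S + T}.
Proof.
by move=> S T; apply: adj_unique => x y /=; rewrite innerDl innerDr !adjE.
Qed.
Fact adjZ (a : R[i]) T : adj (a *: T) = a^* *: adj T.
Proof.
by apply: adj_unique => x y /=; rewrite innerZl innerZr adjE conjCK.
Qed.
Fact adjM S T : adj (S * T) = adj T * adj S.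
Proof. by apply: adj_unique => x y /=; rewrite !adjE. Qed.
Fact adjK : involutive (@adj R H H).
Proof.
by move=> T; apply: adj_unique => x y; rewrite innerC -adjE -innerC.
Qed.
HB.instance Definition _ :=
  isStarAlgebra.Build R (bop H H) adjD adjZ adjM adjK.

End BopAlgebra.

Definition opnorm (R : realType) (H K : hilbertType R) (T : bop H K) : R :=
  sup [set complex.Re `|T x| | x in [set x : H | `|x| <= 1]].

Record cstarSubalg (R : realType) (H : hilbertType R) := CstarSubalg {
  cstar_pred :> {pred bop H H};
  cstar_algebra : subalg_closed cstar_pred;
  cstar_star : forall T, T \in cstar_pred -> star T \in cstar_pred;
  cstar_closed : forall T, (forall e : R, 0 < e ->
    exists2 S, S \in cstar_pred & opnorm (T - S) < e) -> T \in cstar_pred }.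

HB.instance Definition _ (R : realType) (H : hilbertType R)
    (B : cstarSubalg H) :=
  GRing.isSubalgClosed.Build R[i] (bop H H) (cstar_pred B) (cstar_algebra B).

Record cstar_sort (R : realType) (H : hilbertType R) (B : cstarSubalg H) :=
  CstarSort { cstar_val : bop H H; cstar_valP : cstar_val \in B }.

Coercion cstar_sort : cstarSubalg >-> Sortclass.

Section CstarSubalgInstances.
Variables (R : realType) (H : hilbertType R) (B : cstarSubalg H).

HB.instance Definition _ := [isSub for @cstar_val R H B].
HB.instance Definition _ := [Choice of B by <:].
HB.instance Definition _ :=
  [SubChoice_isSubAlgebra of B by <:].

Definition cstar_op (b : cstar_sort B) : cstar_sort B :=
  CstarSort (cstar_star (cstar_valP b)).

Fact cstar_opD : {morph cstar_op : a b / a + b}.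
Proof. by move=> a b; apply: val_inj; rewrite /= starD. Qed.
Fact cstar_opZ (c : R[i]) a : cstar_op (c *: a) = c^* *: cstar_op a.
Proof. by apply: val_inj; rewrite /= starZ. Qed.
Fact cstar_opM a b : cstar_op (a * b) = cstar_op b * cstar_op a.
Proof. by apply: val_inj; rewrite /= starM. Qed.
Fact cstar_opK : involutive cstar_op.
Proof. by move=> a; apply: val_inj; rewrite /= starK. Qed.
HB.instance Definition _ :=
  isStarAlgebra.Build R (cstar_sort B) cstar_opD cstar_opZ cstar_opM cstar_opK.

End CstarSubalgInstances.

(* [fp_eq] is the least congruence on terms that makes the quotient a unital
   complex *-algebra, [FpIn] a unital *-homomorphism and [FpU] unitary; C[Z]
   is the *-algebra generated by one unitary. *)
Section FreeProduct.
Variables (R : realType) (B : starAlgType R).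

Inductive fp_term : Type :=
| FpIn of B
| FpU
| FpAdd of fp_term & fp_term
| FpScale of R[i] & fp_term
| FpMul of fp_term & fp_term
| FpStar of fp_term.

Inductive fp_eq : fp_term -> fp_term -> Prop :=
| fp_refl s : fp_eq s s
| fp_sym s t : fp_eq s t -> fp_eq t s
| fp_trans t s r : fp_eq s t -> fp_eq t r -> fp_eq s r
| fp_congD s s' t t' :
    fp_eq s s' -> fp_eq t t' -> fp_eq (FpAdd s t) (FpAdd s' t')
| fp_congZ c s s' : fp_eq s s' -> fp_eq (FpScale c s) (FpScale c s')
| fp_congM s s' t t' :
    fp_eq s s' -> fp_eq t t' -> fp_eq (FpMul s t) (FpMul s' t')
| fp_congS s s' : fp_eq s s' -> fp_eq (FpStar s) (FpStar s')
| fp_addA s t r : fp_eq (FpAdd s (FpAdd t r)) (FpAdd (FpAdd s t) r)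
| fp_addC s t : fp_eq (FpAdd s t) (FpAdd t s)
| fp_add0 s : fp_eq (FpAdd (FpIn 0) s) s
| fp_addN s : fp_eq (FpAdd (FpScale (-1) s) s) (FpIn 0)
| fp_scaleA a b s : fp_eq (FpScale a (FpScale b s)) (FpScale (a * b) s)
| fp_scale1 s : fp_eq (FpScale 1 s) s
| fp_scaleDr a s t :
    fp_eq (FpScale a (FpAdd s t)) (FpAdd (FpScale a s) (FpScale a t))
| fp_scaleDl a b s :
    fp_eq (FpScale (a + b) s) (FpAdd (FpScale a s) (FpScale b s))
| fp_mulA s t r : fp_eq (FpMul s (FpMul t r)) (FpMul (FpMul s t) r)
| fp_mul1l s : fp_eq (FpMul (FpIn 1) s) s
| fp_mul1r s : fp_eq (FpMul s (FpIn 1)) s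
| fp_mulDl s t r :
    fp_eq (FpMul (FpAdd s t) r) (FpAdd (FpMul s r) (FpMul t r))
| fp_mulDr s t r :
    fp_eq (FpMul s (FpAdd t r)) (FpAdd (FpMul s t) (FpMul s r))
| fp_scaleAl a s t : fp_eq (FpScale a (FpMul s t)) (FpMul (FpScale a s) t)
| fp_scaleAr a s t : fp_eq (FpScale a (FpMul s t)) (FpMul s (FpScale a t))
| fp_starD s t : fp_eq (FpStar (FpAdd s t)) (FpAdd (FpStar s) (FpStar t))
| fp_starZ a s : fp_eq (FpStar (FpScale a s)) (FpScale a^* (FpStar s))
| fp_starM s t : fp_eq (FpStar (FpMul s t)) (FpMul (FpStar t) (FpStar s))
| fp_starK s : fp_eq (FpStar (FpStar s)) s
| fp_inD a b : fp_eq (FpIn (a + b)) (FpAdd (FpIn a) (FpIn b))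
| fp_inZ c a : fp_eq (FpIn (c *: a)) (FpScale c (FpIn a))
| fp_inM a b : fp_eq (FpIn (a * b)) (FpMul (FpIn a) (FpIn b))
| fp_inS a : fp_eq (FpIn (star a)) (FpStar (FpIn a))
| fp_UVl : fp_eq (FpMul (FpStar FpU) FpU) (FpIn 1)
| fp_UVr : fp_eq (FpMul FpU (FpStar FpU)) (FpIn 1).

Fixpoint fp_eval (A : starAlgType R) (f : B -> A) (v : A) (s : fp_term) : A :=
  match s with
  | FpIn b => f b
  | FpU => v
  | FpAdd s t => fp_eval f v s + fp_eval f v t
  | FpScale c s => c *: fp_eval f v s
  | FpMul s t => fp_eval f v s * fp_eval f v t
  | FpStar s => star (fp_eval f v s)
  end.

Lemma fp_eval_eq (A : starAlgType R) (f : {lrmorphism B -> A}) (v : A) s t :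
  star_preserving f -> unitary v -> fp_eq s t -> fp_eval f v s = fp_eval f v t.
Proof.
move=> fS [vl vr]; elim=> {s t} /=.
all: try by move=> *; rewrite ?(addrA, mulrA, scalerA, rmorph0, rmorph1, add0r,
  scale1r, scalerDr, scalerDl, mul1r, mulr1, mulrDl, mulrDr, scalerAl, starD,
  starZ, starM, starK, star1, rmorphD, rmorphM, linearZ).
all: try by move=> *; congruence.
- by move=> s t; rewrite addrC.
- by move=> s; rewrite rmorph0 scaleN1r addNr.
- by move=> a s t; rewrite scalerAr.
Qed.

HB.instance Definition _ := gen_eqMixin fp_term.
HB.instance Definition _ := gen_choiceMixin fp_term.

Definition fp_rel : rel fp_term := fun s t => `[< fp_eq s t >].

Fact fp_rel_equiv : equiv_class_of fp_rel.
Proof.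
split.
- by move=> s; apply/asboolP; exact: fp_refl.
- by move=> s t; apply/asboolP/asboolP; exact: fp_sym.
- by move=> t s r /asboolP st /asboolP tr; apply/asboolP; exact: fp_trans st tr.
Qed.
Canonical fp_equiv := EquivRelPack fp_rel_equiv.

Definition freeprodZ := {eq_quot fp_equiv}.
HB.instance Definition _ := Choice.on freeprodZ.

Definition fp_pi (s : fp_term) : freeprodZ := \pi s.

Lemma fp_piP s t : fp_eq s t <-> fp_pi s = fp_pi t.
Proof.
split=> [st|/eqquotP /asboolP //]; apply/eqquotP; exact/asboolP.
Qed.

Lemma fp_reprK (x : freeprodZ) : fp_pi (repr x) = x.
Proof. exact: reprK. Qed.

Lemma fp_repr s : fp_eq (repr (fp_pi s)) s.
Proof. by apply/fp_piP; rewrite fp_reprK. Qed.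

Definition fp_zero := fp_pi (FpIn 0).
Definition fp_one := fp_pi (FpIn 1).
Definition fp_add (x y : freeprodZ) := fp_pi (FpAdd (repr x) (repr y)).
Definition fp_scale (c : R[i]) (x : freeprodZ) := fp_pi (FpScale c (repr x)).
Definition fp_mul (x y : freeprodZ) := fp_pi (FpMul (repr x) (repr y)).
Definition fp_star (x : freeprodZ) := fp_pi (FpStar (repr x)).

Lemma fp_addE s t : fp_add (fp_pi s) (fp_pi t) = fp_pi (FpAdd s t).
Proof. by apply/fp_piP/fp_congD; exact: fp_repr. Qed.
Lemma fp_scaleE c s : fp_scale c (fp_pi s) = fp_pi (FpScale c s).
Proof. by apply/fp_piP/fp_congZ; exact: fp_repr. Qed.
Lemma fp_mulE s t : fp_mul (fp_pi s) (fp_pi t) = fp_pi (FpMul s t).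
Proof. by apply/fp_piP/fp_congM; exact: fp_repr. Qed.
Lemma fp_starE s : fp_star (fp_pi s) = fp_pi (FpStar s).
Proof. by apply/fp_piP/fp_congS; exact: fp_repr. Qed.

Lemma fp_ind (P : freeprodZ -> Prop) : (forall s, P (fp_pi s)) -> forall x, P x.
Proof. by move=> h x; rewrite -(fp_reprK x). Qed.

Let fpE := (fp_addE, fp_scaleE, fp_mulE, fp_starE).

Fact fp_quot_addA : associative fp_add.
Proof.
by elim/fp_ind=> s; elim/fp_ind=> t; elim/fp_ind=> r;
  rewrite !fpE; apply/fp_piP; constructor.
Qed.
Fact fp_quot_addC : commutative fp_add.
Proof.
by elim/fp_ind=> s; elim/fp_ind=> t; rewrite !fpE; apply/fp_piP; exact: fp_addC.
Qed.
Fact fp_quot_add0 : left_id fp_zero fp_add.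
Proof. by elim/fp_ind=> s; rewrite !fpE; apply/fp_piP; exact: fp_add0. Qed.
Fact fp_quot_addN : left_inverse fp_zero (fp_scale (-1)) fp_add.
Proof. by elim/fp_ind=> s; rewrite !fpE; apply/fp_piP; exact: fp_addN. Qed.
HB.instance Definition _ := GRing.isZmodule.Build freeprodZ
  fp_quot_addA fp_quot_addC fp_quot_add0 fp_quot_addN.

Fact fp_quot_scaleA a b x : fp_scale a (fp_scale b x) = fp_scale (a * b) x.
Proof. by elim/fp_ind: x => s; rewrite !fpE; apply/fp_piP; exact: fp_scaleA. Qed.
Fact fp_quot_scale1 : left_id 1 fp_scale.
Proof. by elim/fp_ind=> s; rewrite !fpE; apply/fp_piP; exact: fp_scale1. Qed.
Fact fp_quot_scaleDr : right_distributive fp_scale +%R.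
Proof.
move=> a; elim/fp_ind=> s; elim/fp_ind=> t.
by rewrite /GRing.add /= !fpE; apply/fp_piP; exact: fp_scaleDr.
Qed.
Fact fp_quot_scaleDl x : {morph fp_scale^~ x : a b / a + b}.
Proof.
move=> a b; elim/fp_ind: x => s.
by rewrite [RHS]/GRing.add /= !fpE; apply/fp_piP; exact: fp_scaleDl.
Qed.
HB.instance Definition _ := GRing.Zmodule_isLmodule.Build R[i] freeprodZ
  fp_quot_scaleA fp_quot_scale1 fp_quot_scaleDr fp_quot_scaleDl.

Fact fp_quot_mulA : associative fp_mul.
Proof.
by elim/fp_ind=> s; elim/fp_ind=> t; elim/fp_ind=> r;
  rewrite !fpE; apply/fp_piP; exact: fp_mulA.
Qed.
Fact fp_quot_mul1l : left_id fp_one fp_mul.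
Proof. by elim/fp_ind=> s; rewrite !fpE; apply/fp_piP; exact: fp_mul1l. Qed.
Fact fp_quot_mul1r : right_id fp_one fp_mul.
Proof. by elim/fp_ind=> s; rewrite !fpE; apply/fp_piP; exact: fp_mul1r. Qed.
Fact fp_quot_mulDl : left_distributive fp_mul +%R.
Proof.
elim/fp_ind=> s; elim/fp_ind=> t; elim/fp_ind=> r.
by rewrite /GRing.add /= !fpE; apply/fp_piP; exact: fp_mulDl.
Qed.
Fact fp_quot_mulDr : right_distributive fp_mul +%R.
Proof.
elim/fp_ind=> s; elim/fp_ind=> t; elim/fp_ind=> r.
by rewrite /GRing.add /= !fpE; apply/fp_piP; exact: fp_mulDr.
Qed.
Fact fp_quot_nontriv : fp_one != 0.
Proof.
apply/eqP => /fp_piP /(@fp_eval_eq B (GRing.LRMorphism.clone _ _ _ _ idfun _) 1).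
move=> /= /(_ (fun=> erefl)) h; have := oner_neq0 B.
by rewrite h ?eqxx//; split; rewrite star1 mulr1.
Qed.
HB.instance Definition _ := GRing.Zmodule_isNzRing.Build freeprodZ
  fp_quot_mulA fp_quot_mul1l fp_quot_mul1r fp_quot_mulDl fp_quot_mulDr
  fp_quot_nontriv.

Fact fp_quot_scaleAl (a : R[i]) (x y : freeprodZ) : a *: (x * y) = (a *: x) * y.
Proof.
elim/fp_ind: x => s; elim/fp_ind: y => t.
by rewrite /GRing.mul /GRing.scale /= !fpE; apply/fp_piP; exact: fp_scaleAl.
Qed.
HB.instance Definition _ :=
  GRing.Lmodule_isLalgebra.Build R[i] freeprodZ fp_quot_scaleAl.
Fact fp_quot_scaleAr (a : R[i]) (x y : freeprodZ) : a *: (x * y) = x * (a *: y).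
Proof.
elim/fp_ind: x => s; elim/fp_ind: y => t.
by rewrite /GRing.mul /GRing.scale /= !fpE; apply/fp_piP; exact: fp_scaleAr.
Qed.
HB.instance Definition _ :=
  GRing.Lalgebra_isAlgebra.Build R[i] freeprodZ fp_quot_scaleAr.

Fact fp_quot_starD : {morph fp_star : x y / x + y}.
Proof.
elim/fp_ind=> s; elim/fp_ind=> t.
by rewrite /GRing.add /= !fpE; apply/fp_piP; exact: fp_starD.
Qed.
Fact fp_quot_starZ (c : R[i]) (x : freeprodZ) :
  fp_star (c *: x) = c^* *: fp_star x.
Proof.
elim/fp_ind: x => s.
by rewrite /GRing.scale /= !fpE; apply/fp_piP; exact: fp_starZ.
Qed.
Fact fp_quot_starM (x y : freeprodZ) : fp_star (x * y) = fp_star y * fp_star x.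
Proof.
elim/fp_ind: x => s; elim/fp_ind: y => t.
by rewrite /GRing.mul /= !fpE; apply/fp_piP; exact: fp_starM.
Qed.
Fact fp_quot_starK : involutive fp_star.
Proof. by elim/fp_ind=> s; rewrite !fpE; apply/fp_piP; exact: fp_starK. Qed.
HB.instance Definition _ := isStarAlgebra.Build R freeprodZ
  fp_quot_starD fp_quot_starZ fp_quot_starM fp_quot_starK.

Definition fp_in (b : B) : freeprodZ := fp_pi (FpIn b).
Definition fp_u : freeprodZ := fp_pi FpU.

Fact fp_in_linear : linear fp_in.
Proof.
move=> c a b.
rewrite -[RHS]/(fp_add (fp_scale c (fp_pi (FpIn a))) (fp_pi (FpIn b))) !fpE; apply/fp_piP.
apply: fp_trans (fp_inD _ _) _; apply: fp_congD; last exact: fp_refl.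
exact: fp_inZ.
Qed.
HB.instance Definition _ :=
  GRing.isLinear.Build R[i] B freeprodZ *:%R fp_in fp_in_linear.
Fact fp_in_multiplicative : monoid_morphism fp_in.
Proof.
split=> // a b.
by rewrite -[RHS]/(fp_mul (fp_pi (FpIn a)) (fp_pi (FpIn b))) fp_mulE; apply/fp_piP/fp_inM.
Qed.
HB.instance Definition _ :=
  GRing.isMonoidMorphism.Build B freeprodZ fp_in fp_in_multiplicative.
Lemma fp_in_star : star_preserving fp_in.
Proof. move=> b.
by rewrite -[RHS]/(fp_star (fp_pi (FpIn b))) fp_starE; apply/fp_piP/fp_inS. Qed.
Lemma fp_u_unitary : unitary fp_u.
Proof.
split.
  rewrite -[LHS]/(fp_mul (fp_star (fp_pi FpU)) (fp_pi FpU)) !fpE; apply/fp_piP/fp_UVl.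
rewrite -[LHS]/(fp_mul (fp_pi FpU) (fp_star (fp_pi FpU))) !fpE; apply/fp_piP/fp_UVr.
Qed.

Lemma freeprodZ_lift (A : starAlgType R) (f : {lrmorphism B -> A}) (v : A) :
  star_preserving f -> unitary v ->
  exists p : {lrmorphism freeprodZ -> A},
    [/\ star_preserving p, forall b, p (fp_in b) = f b & p fp_u = v].
Proof.
move=> fS vU; pose p (x : freeprodZ) : A := fp_eval f v (repr x).
have pE s : p (fp_pi s) = fp_eval f v s by apply: fp_eval_eq fS vU (fp_repr s).
have pl : linear p.
  move=> c; elim/fp_ind=> s; elim/fp_ind=> t.
  by rewrite -[X in p X]/(fp_add (fp_scale c (fp_pi s)) (fp_pi t)) !fpE !pE.
have pm : monoid_morphism p.
  split; first by rewrite -[X in p X]/(fp_pi (FpIn 1)) pE /= rmorph1.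
  elim/fp_ind=> s; elim/fp_ind=> t.
  by rewrite -[X in p X]/(fp_mul (fp_pi s) (fp_pi t)) !fpE !pE.
pose pL := GRing.isLinear.Build R[i] freeprodZ A *:%R p pl.
pose pM := GRing.isMonoidMorphism.Build freeprodZ A p pm.
pose q : {lrmorphism freeprodZ -> A} := HB.pack p pL pM.
exists q; split; [|by move=> b; exact: pE|exact: pE].
elim/fp_ind=> s.
by rewrite -[X in q X]/(fp_star (fp_pi s)) !fpE -[LHS]/(p _) -[q _]/(p _) !pE.
Qed.

Lemma freeprodZ_lift_unique (A : starAlgType R)
    (p q : {lrmorphism freeprodZ -> A}) :
  star_preserving p -> star_preserving q ->
  (forall b, p (fp_in b) = q (fp_in b)) -> p fp_u = q fp_u -> p =1 q.
Proof.
move=> pS qS pqB pqu; elim/fp_ind.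
elim=> [b||s IHs t IHt|c s IHs|s IHs t IHt|s IHs].
- exact: pqB.
- exact: pqu.
- rewrite -fp_addE.
  rewrite -[LHS]/(p (fp_pi s + fp_pi t)) -[RHS]/(q (fp_pi s + fp_pi t)) !rmorphD.
  by congr (_ + _).
- rewrite -fp_scaleE.
  rewrite -[LHS]/(p (c *: fp_pi s)) -[RHS]/(q (c *: fp_pi s)) !linearZ.
  by congr (_ *: _).
- rewrite -fp_mulE.
  rewrite -[LHS]/(p (fp_pi s * fp_pi t)) -[RHS]/(q (fp_pi s * fp_pi t)) !rmorphM.
  by congr (_ * _).
- rewrite -fp_starE.
  rewrite -[LHS]/(p (star (fp_pi s))) -[RHS]/(q (star (fp_pi s))) pS qS.
  by congr star.
Qed.

End FreeProduct.

(* the norm of the enveloping C*-algebra of A, namely the supremum of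
   |pi(a)| over the unital *-representations pi of A; on a free product it is
   the norm of the universal C*-algebraic free product *)
Definition univ_norm (R : realType) (A : starAlgType R) (a : A) : R :=
  sup [set r | exists (K : hilbertType R) (p : {lrmorphism A -> bop K K}),
    star_preserving p /\ r = opnorm (p a)].

Definition pos_family (R : realType) (H : hilbertType R) n
    (M : 'I_n -> 'I_n -> bop H H) :=
  forall h : 'I_n -> H, 0 <= \sum_i \sum_j inner (M i j (h i)) (h j).

Definition opstate (R : realType) (A : starAlgType R) (N : A -> R)
    (H : hilbertType R) : set (A -> bop H H) :=
  [set phi | [/\ linear phi,
    phi 1 = 1,
    forall n (a : 'I_n -> A),
      pos_family (fun i j => phi (star (a j) * a i)) &
    forall n (a : 'I_n -> A) b, pos_family (fun i j =>
      phi (star (a j) * ((N (star b * b))%:C%C%:A - star b * b) * a i))]].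

Definition AB (R : realType) (H : hilbertType R) (B : cstarSubalg H) :=
  freeprodZ B.

Definition condexp (R : realType) (H : hilbertType R) (B : cstarSubalg H) :
    set (AB B -> bop H H) :=
  [set phi | [/\ opstate (@univ_norm R (AB B)) phi,
    forall m, phi m \in B &
    forall (b1 b2 : B) m,
      phi (fp_in b1 * m * fp_in b2) = val b1 * phi m * val b2]].

Arguments condexp {R H} B _.

Section OperatorMatrices.
Variables (R : realType) (H : hilbertType R) (n : nat).
Implicit Types (T : 'M[bop H H]_n) (h k : 'I_n -> H).

Definition mxapp T h : 'I_n -> H := fun i => \sum_j T i j (h j).

Definition mxinner h k : R[i] := \sum_i inner (h i) (k i).

Definition mxnorm T : R :=
  sup [set Num.sqrt (complex.Re (mxinner (mxapp T h) (mxapp T h))) |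
    h in [set h | mxinner h h <= 1]].

Definition mxadj T : 'M[bop H H]_n := \matrix_(i, j) star (T j i).

Definition mxpsd T := forall h, 0 <= mxinner (mxapp T h) h.

Definition mxRe T : 'M[bop H H]_n :=
  map_mx (fun S => (2^-1 : R[i]) *: S) (T + mxadj T).

End OperatorMatrices.

(* Gamma (x) 1 for a rectangular scalar matrix Gamma *)
Definition mxscal (R : realType) (A : starAlgType R) m n
    (G : 'M[R[i]]_(m, n)) : 'M[A]_(m, n) := map_mx (fun c => c%:A) G.

Definition mxinv (A : nzRingType) n (T : 'M[A]_n) : 'M[A]_n :=
  xget 0 [set S | S *m T = 1%:M /\ T *m S = 1%:M].

Section FreeFunctions.
Variables (R : realType) (H : hilbertType R) (B : cstarSubalg H).

Record cball n := CBall {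
  cball_mx :> 'M[B]_n;
  cball_lt1 : mxnorm (map_mx val cball_mx) < 1 }.

Definition ncfun := forall n, cball n -> 'M[bop H H]_n.

HB.instance Definition _ :=
  Choice.copy ncfun (forall n, cball n -> 'M[bop H H]_n).

Definition free_function (f : ncfun) :=
  forall n m (G : 'M[R[i]]_(m, n)) (X : cball n) (Y : cball m),
    mxscal B G *m X = Y *m mxscal B G ->
    mxscal (bop H H) G *m f n X = f m Y *m mxscal (bop H H) G.

Definition RHP_valued (f : ncfun) := forall n (X : cball n), mxpsd (mxRe (f n X)).

(* [T |-> P_H T |_H] when V is the inclusion of H into K *)
Definition compress (K : hilbertType R) (V : bop H K) (T : bop K K) : bop H H :=
  bop_comp (adj V) (bop_comp T V).

Definition herglotz_mx (K : hilbertType R) (V : bop H K)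
    (alpha : B -> bop K K) (U : bop K K) n (X : 'M[B]_n) : 'M[bop H H]_n :=
  map_mx (compress V)
    ((1%:M + U%:M *m map_mx alpha X) *m mxinv (1%:M - U%:M *m map_mx alpha X)).

Definition rep_herglotz : set ncfun :=
  [set f | [/\ free_function f, RHP_valued f,
    forall n (X : cball n), cball_mx X = 0 -> f n X = 1%:M &
    exists (K : hilbertType R) (V : bop H K) (U : bop K K)
           (alpha : {lrmorphism B -> bop K K}),
      [/\ forall h, `|V h| = `|h|, unitary U, star_preserving alpha &
        forall n (X : cball n), f n X = herglotz_mx V alpha U X]]].

End FreeFunctions.

Arguments rep_herglotz {R H} B _.

Section GNS.
Variables (R : realType) (A : starAlgType R) (H : hilbertType R).

(* A Hilbert space H_phi completing the quotient of A (x) H by the null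
   vectors of the form (a1 (x) h1, a2 (x) h2) |-> <phi(a2^* a1) h1, h2>, where
   [gns_tensor a h] is the class of a (x) h; since these vectors span a dense
   subspace, the other fields are determined by their values on them. *)
Record gns (phi : A -> bop H H) := GNS {
  gns_space : hilbertType R;
  gns_tensor : A -> H -> gns_space;
  gns_tensor_linearl : forall h, linear (gns_tensor^~ h);
  gns_tensor_linearr : forall a, linear (gns_tensor a);
  gns_inner : forall a1 h1 a2 h2,
    inner (gns_tensor a1 h1) (gns_tensor a2 h2) =
    inner (phi (star a2 * a1) h1) h2;
  gns_dense : dense [set x | exists n (a : 'I_n -> A) (h : 'I_n -> H),
    x = \sum_i gns_tensor (a i) (h i)];
  gns_emb : bop H gns_space;
  gns_embE : forall h, gns_emb h = gns_tensor 1 h;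
  gns_rep : {lrmorphism A -> bop gns_space gns_space};
  gns_rep_star : star_preserving gns_rep;
  gns_repE : forall b a h, gns_rep b (gns_tensor a h) = gns_tensor (b * a) h }.

End GNS.

(* the function does not depend on the choice of the completion *)
Definition gfun (R : realType) (H : hilbertType R) (B : cstarSubalg H)
    (phi : AB B -> bop H H) : ncfun B :=
  xget (fun _ _ => 0) [set g | exists G : gns phi, g = fun n (X : cball B n) =>
    herglotz_mx (gns_emb G) (fun b => gns_rep G (fp_in b)) (gns_rep G (fp_u B)) X].

Arguments gfun {R H} B phi.

Definition wot (R : realType) (H : hilbertType R) :=
  initial_topology
    ((fun T hk => inner (T hk.1) hk.2) : bop H H -> {ptws H * H -> R[i]^o}).

Definition weakly_closed (R : realType) (H : hilbertType R) (B : cstarSubalg H) :=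
  closed ([set T | T \in B] : set (wot H)).

Definition wot_test (R : realType) (H : hilbertType R) (B : cstarSubalg H) :=
  {n & (cball B n * ('I_n -> H) * ('I_n -> H))%type}.

Definition wot_eval (R : realType) (H : hilbertType R) (B : cstarSubalg H)
    (f : ncfun B) : {ptws wot_test B -> R[i]^o} :=
  fun t => let: existT n (X, h, k) := t in mxinner (mxapp (f n X) h) k.

Definition pointwise_wot (R : realType) (H : hilbertType R) (B : cstarSubalg H) :=
  initial_topology (@wot_eval R H B).

Definition one_dimensional (F : fieldType) (V : lmodType F) :=
  exists2 v : V, v != 0 & forall w, exists c, w = c *: v.

(* Main.v *)
Require Import Defs.
From HB Require Import structures.
From mathcomp Require Import all_boot all_order all_algebra.
From mathcomp Require Import all_classical all_reals all_analysis.
From mathcomp Require Import complex ring lra.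

Set Implicit Arguments.
Unset Strict Implicit.
Unset Printing Implicit Defensive.

Import Order.TTheory GRing.Theory Num.Theory numFieldNormedType.Exports.

Local Open Scope classical_set_scope.
Local Open Scope ring_scope.

(** A *-representation p of the free product and an isometry V : H -> K give the
    operator-valued state V^* p V, and GNS shows that every operator-valued state
    has this form. *-homomorphisms of B are contractive on matrices, so with
    W = (u (x) 1) X the resolvent of g_phi(X) is a Neumann series; hence g_phi(X)
    is the limit of 2 sum_(k < N) phi(W^k) - 1, uniformly in phi.

    In particular g_phi depends only on phi(u b_1 ... u b_k). On
    l2(Z) (x) H (x) H let u shift Z and let b act on the last leg over some
    integers, 0 among them, and on the middle leg over the others. Compressing to
    e_0 (x) xi (x) H gives a conditional expectation onto B that kills all words
    u b_1 ... u b_k with k >= 1, so that g_phi = 1; but phi(u^* b u) is b or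
    <b xi, xi> 1 according to the leg on which b acts over 1.

    For compactness, a pointwise weak limit of conditional expectations along an
    ultrafilter exists because |phi(m)| is bounded independently of phi; it is again
    a conditional expectation if B is weakly closed, and by the uniform
    approximation its g is the limit of the g's. *)

(** Both H-legs of the tensor product have a task. Over 0 the algebra has to act on the last leg,
    which makes the compression a B-bimodule map; on the middle leg b leaves only the scalar <b xi,
    xi> behind, so the values stay in B. Two choices of the leg over 1 give two states with the same
    g, and their equality would force b = <b xi, xi> 1 for every b, hence dimension one. Compactness
    rests on an error bound in which X occurs only through its norm. It comes from contractivity on
    matrices, which is derived from the Neumann series and the norm closedness of B rather than from
    spectral theory. The approximants are written with phi alone, so the estimate holds for
    whichever GNS space the definition of [gfun] selects. The Hilbert spaces that have to be
    produced, the GNS space and the tensor product, are both completions of positive kernels. The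
    given ultrafilter lives on functions g and not on states; choosing a representing state for each
    g carries it over. *)

Section Modulus.
Variable R : realType.

(** Norms take values in R[i] here; their real parts make inequalities accessible to ordered-field
    arithmetic over R. *)
Definition nr (V : normedZmodType R[i]) (x : V) : R := complex.Re `|x|.

Lemma nrE (V : normedZmodType R[i]) (x : V) : `|x| = (nr x)%:C%C.
Proof. by rewrite RRe_real// ger0_real. Qed.

Lemma nr_le (V : normedZmodType R[i]) (x : V) (r : R) :
  (nr x <= r) = (`|x| <= r%:C%C).
Proof. by rewrite nrE lecR. Qed.

Lemma nr_ge0 (V : normedZmodType R[i]) (x : V) : 0 <= nr x.
Proof. by rewrite -ler0c -nrE. Qed.

Lemma nr0 (V : normedZmodType R[i]) : nr (0 : V) = 0.
Proof. by rewrite /nr normr0. Qed.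

Lemma nr_eq0 (V : normedZmodType R[i]) (x : V) : (nr x == 0) = (x == 0).
Proof. by rewrite -(normr_eq0 x) nrE eq_complex /= eqxx andbT. Qed.

Lemma nrN (V : normedZmodType R[i]) (x : V) : nr (- x) = nr x.
Proof. by rewrite /nr normrN. Qed.

Lemma nr_distC (V : normedZmodType R[i]) (x y : V) : nr (x - y) = nr (y - x).
Proof. by rewrite -nrN opprB. Qed.

Lemma ler_nrD (V : normedZmodType R[i]) (x y : V) : nr (x + y) <= nr x + nr y.
Proof. by rewrite nr_le rmorphD /= -!nrE ler_normD. Qed.

Lemma ler_nr_dist (V : normedZmodType R[i]) (y x z : V) :
  nr (x - z) <= nr (x - y) + nr (y - z).
Proof. by rewrite -[x - z](subrKA y) ler_nrD. Qed.

Lemma ler_nr_sum (V : normedZmodType R[i]) I (r : seq I) (P : pred I) (F : I -> V) :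
  nr (\sum_(i <- r | P i) F i) <= \sum_(i <- r | P i) nr (F i).
Proof.
elim/big_ind2: _ => [|x x' y y' hx hy|//]; first by rewrite nr0.
exact: le_trans (ler_nrD _ _) (lerD hx hy).
Qed.

Lemma nrZ (V : normedModType R[i]) (a : R[i]) (x : V) : nr (a *: x) = nr a * nr x.
Proof. by rewrite /nr normrZ (nrE a) (nrE x) -rmorphM. Qed.

Lemma nrM (a b : R[i]) : nr (a * b) = nr a * nr b.
Proof. by rewrite /nr normrM (nrE a) (nrE b) -rmorphM. Qed.

Lemma nrJ (a : R[i]) : nr a^* = nr a.
Proof. by rewrite /nr norm_conjC. Qed.

Lemma nr_real (r : R) : nr (r%:C%C : R[i]) = `|r|.
Proof. by rewrite /nr normc_def /= expr0n addr0 sqrtr_sqr. Qed.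

Lemma nr1 : nr (1 : R[i]) = 1.
Proof. by rewrite -[1](rmorph1 (real_complex R)) nr_real normr1. Qed.

Lemma ReB (a b : R[i]) : complex.Re (a - b) = complex.Re a - complex.Re b.
Proof. by rewrite ReD ReN. Qed.

Lemma le_Re_nr (a : R[i]) : `|complex.Re a| <= nr a.
Proof. by apply: le_normRe; rewrite -nrE. Qed.

Lemma le_Im_nr (a : R[i]) : `|complex.Im a| <= nr a.
Proof.
rewrite -[complex.Im a]opprK -ReiM normrN (le_trans (le_Re_nr _))// nrM.
by rewrite /nr normc_def /= expr0n expr1n add0r sqrtr1 mul1r.
Qed.

Lemma nr_le_ReIm (a : R[i]) : nr a <= `|complex.Re a| + `|complex.Im a|.
Proof.
case: a => a b /=; rewrite -[Complex a b]/((a +i* b)%C).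
have -> : (a +i* b)%C = a%:C%C + 'i%C * b%:C%C by rewrite [LHS]complexE.
rewrite (le_trans (ler_nrD _ _))// nr_real nrM nr_real.
by rewrite /nr normc_def /= expr0n expr1n add0r sqrtr1 mul1r.
Qed.

Lemma nr_mulJ (a : R[i]) : a * a^* = (nr a ^+ 2)%:C%C.
Proof. by rewrite -normCK nrE -rmorphXn. Qed.

Lemma ge0_ReE (a : R[i]) : 0 <= a -> a = (complex.Re a)%:C%C.
Proof. by move=> a0; rewrite RRe_real// ger0_real. Qed.

Lemma ge0_Re (a : R[i]) : 0 <= a -> 0 <= complex.Re a.
Proof. by move=> a0; rewrite -ler0c -ge0_ReE. Qed.

Lemma Re_sum I (r : seq I) (P : pred I) (F : I -> R[i]) :
  complex.Re (\sum_(i <- r | P i) F i) = \sum_(i <- r | P i) complex.Re (F i).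
Proof. by elim/big_rec2: _ => // i x y _ <-; rewrite ReD. Qed.

Lemma conj_sum I (r : seq I) (P : pred I) (F : I -> R[i]) :
  (\sum_(i <- r | P i) F i)^* = \sum_(i <- r | P i) (F i)^*.
Proof. exact: rmorph_sum. Qed.

(* The hypothesis is the positivity of a form at x + w y, with
   a = <x, x>, b = <x, y>, c = <y, y>: every Cauchy-Schwarz inequality below is
   an instance. *)
Lemma psd2 (a c : R) (b : R[i]) : 0 <= a -> 0 <= c ->
  (forall w : R[i], 0 <= a + 2 * complex.Re (w^* * b) + nr w ^+ 2 * c) ->
  nr b ^+ 2 <= a * c.
Proof.
move=> a0 c0 h; have hr (r : R) : 0 <= a - 2 * r * nr b ^+ 2 + r ^+ 2 * nr b ^+ 2 * c.
  have := h (- r%:C%C * b); rewrite rmorphM rmorphN /= conj_realC -mulrA.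
  rewrite [b^* * b]mulrC nr_mulJ mulNr ReN ReRM /= nrM nrN nr_real exprMn.
  rewrite real_normK ?num_real//; congr (_ <= _); ring.
have := sqr_ge0 (nr b); rewrite le_eqVlt => /orP[/eqP <-|b0]; first exact: mulr_ge0.
move: c0; rewrite le_eqVlt => /orP[/eqP c0|c0].
  (* For c = 0 the expression is affine in r, and this r turns it into -a - 2 < 0. For c > 0 the
     minimiser r = 1/c gives the claim. *)
  have := hr ((a + 1) / nr b ^+ 2); rewrite -c0 mulr0 addr0 -mulrA divfK ?gt_eqF//; lra.
have := hr c^-1; set B := nr b ^+ 2.
have -> : a - 2 * c^-1 * B + c^-1 ^+ 2 * B * c = (a * c - B) / c.
  by field; rewrite gt_eqF.
by rewrite pmulr_lge0 ?invr_gt0// subr_ge0.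
Qed.

Lemma sqr_le_mulr_sqrt (a b c : R) : 0 <= b -> 0 <= a -> 0 <= c -> b ^+ 2 <= a * c ->
  b <= Num.sqrt a * Num.sqrt c.
Proof. by move=> b0 a0 c0 h; rewrite -sqrtrM// -{1}(ger0_norm b0) -sqrtr_sqr ler_wsqrtr. Qed.

(** Turns an estimate |v|^2 = <v, v> <= M |v| into |v| <= M; adjoints and vectors obtained by
    duality are all bounded in this way. *)
Lemma le_sqr_cancel (x M : R) : 0 <= M -> x ^+ 2 <= M * x -> x <= M.
Proof.
move=> M0 h; have [//|xM] := leP x M; have x0 : 0 < x by apply: le_lt_trans M0 xM.
by move: h; rewrite expr2 ler_pM2r// leNgt xM.
Qed.

(** A fixed rate lets convergence be stated as an inequality with an explicit error [C * geo n],
    valid for every n. *)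
Definition geo n : R := 2^-1 ^+ n.

Lemma geo_gt0 n : 0 < geo n. Proof. by rewrite exprn_gt0// invr_gt0. Qed.

Lemma geo_ge0 n : 0 <= geo n. Proof. exact/ltW/geo_gt0. Qed.

Lemma geo_le1 n : geo n <= 1.
Proof. by rewrite exprn_ile1// ?invr_ge0// invf_le1// ler1n. Qed.

Lemma pow_small (r e : R) : 0 <= r < 1 -> 0 < e -> exists n, r ^+ n < e.
Proof.
move=> /andP[r0 r1] e0; have := @cvg_expr _ r; rewrite ger0_norm// => /(_ r1).
move=> /cvgrPdist_lt /(_ _ e0) [N _ /(_ N)] /=; rewrite leqnn sub0r normrN => /(_ isT).
by rewrite ger0_norm ?exprn_ge0//; exists N.
Qed.

Lemma ler_pow (r x y C : R) : 0 <= r < 1 ->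
  (forall n, x <= y + C * r ^+ n) -> x <= y.
Proof.
move=> r01 h; apply/ler_addgt0Pr => e e0.
have [n hn] := @pow_small r (e / (`|C| + 1)) r01 (divr_gt0 e0 (ltr_wpDl (normr_ge0 _) ltr01)).
apply: le_trans (h n) _; rewrite lerD2l.
have C0 : 0 < `|C| + 1 by rewrite ltr_wpDl.
have r0 : 0 <= r ^+ n by case/andP: r01 => ? _; rewrite exprn_ge0.
move: hn; rewrite ltr_pdivlMr// => hn.
by apply: le_trans (ltW hn); rewrite mulrC ler_wpM2l// (le_trans (ler_norm _))// lerDl.
Qed.

Lemma half01 : 0 <= (2^-1 : R) < 1.
Proof. by rewrite invr_ge0 ler0n invf_lt1// ltr1n. Qed.

Lemma ler_geo (x y C : R) : (forall n, x <= y + C * geo n) -> x <= y.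
Proof. exact: ler_pow half01. Qed.

Lemma nr_geo0 (x : R[i]) (C : R) : (forall n, nr x <= C * geo n) -> x = 0.
Proof.
move=> h; apply/eqP; rewrite -nr_eq0 eq_le nr_ge0 andbT.
by apply: (@ler_geo _ _ C) => n; rewrite add0r.
Qed.

Lemma nr_small0 (x : R[i]) : (forall e : R, 0 < e -> nr x <= e) -> x = 0.
Proof.
move=> h; apply/eqP; rewrite -nr_eq0 eq_le nr_ge0 andbT.
by apply/ler_addgt0Pr => e e0; rewrite add0r h.
Qed.

(** The intervals [u n - d n, u n + d n] meet pairwise, so the supremum of their left ends lies in
    all of them. *)
Lemma real_seq_lim (u : nat -> R) (d : nat -> R) :
  (forall n m, `|u n - u m| <= d n + d m) ->
  exists l, forall n, `|u n - l| <= d n.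
Proof.
move=> h; pose S := [set u n - d n | n in setT].
have ub m : ubound S (u m + d m).
  by move=> _ [n _ <-]; have := h n m; rewrite ler_norml => /andP[_]; lra.
exists (sup S) => n; rewrite ler_norml.
have h1 : u n - d n <= sup S by apply: ub_le_sup; [exists (u n + d n)|exists n].
have h2 : sup S <= u n + d n by apply: ge_sup (ub n); exists (u 0%N - d 0%N), 0%N.
by apply/andP; split; lra.
Qed.

Lemma cplx_seq_lim (u : nat -> R[i]) (d : nat -> R) :
  (forall n m, nr (u n - u m) <= d n + d m) ->
  exists l, forall n, nr (u n - l) <= 2 * d n.
Proof.
move=> h.
have [n m|a ha] := @real_seq_lim (fun n => complex.Re (u n)) d.
  by rewrite -ReB (le_trans (le_Re_nr _)).
have [n m|b hb] := @real_seq_lim (fun n => complex.Im (u n)) d.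
  apply: le_trans (h n m); apply: le_trans (le_Im_nr _).
  by case: (u n) => ? ?; case: (u m).
exists (a +i* b)%C => n; apply: (le_trans (nr_le_ReIm _)).
rewrite mulr_natl mulr2n; apply: lerD.
- by have := ha n; case: (u n).
- by have := hb n; case: (u n).
Qed.

Lemma ge0_lim (z : R[i]) (C : R) (v : nat -> R[i]) :
  (forall n, 0 <= v n) -> (forall n, nr (z - v n) <= C * geo n) -> 0 <= z.
Proof.
move=> v0 h.
have vI n : complex.Im (v n) = 0 by rewrite ger0_Im.
have zI : complex.Im z = 0.
  apply/eqP; rewrite -normr_eq0 eq_le normr_ge0 andbT.
  apply: (@ler_geo _ _ C) => n; rewrite add0r; apply: le_trans (h n).
  apply: le_trans (le_Im_nr _); move: (vI n); case: (v n) => a b /= ->.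
  by case: (z) => c d /=; rewrite subr0.
rewrite lecE zI eqxx /=; apply: (@ler_geo _ _ C) => n.
have := h n; have := le_Re_nr (z - v n); have := ge0_Re (v0 n).
rewrite ReB ler_norml => ? /andP[]; lra.
Qed.

End Modulus.

(** * Completion of a positive semidefinite kernel *)

(* Sequences of points stand for formal sums, so that the scalar action on points
   is all the linear structure that a pre-Hilbert space needs here. *)
Record kernel (R : realType) := Kernel {
  kcar :> Type;
  ksc : R[i] -> kcar -> kcar;
  kf : kcar -> kcar -> R[i];
  kfZ : forall c i j, kf (ksc c i) j = c * kf i j;
  kfC : forall i j, kf j i = (kf i j)^*;
  kf_psd : forall s : seq kcar, 0 <= \sum_(i <- s) \sum_(j <- s) kf i j;
  kf_neq0 : exists i, kf i i != 0 }.

Section KernelForm.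
Variables (R : realType) (K : kernel R).
Implicit Types (i j : K) (r s t : seq K) (c : R[i]).

Definition kform s t := \sum_(i <- s) \sum_(j <- t) kf i j.

Definition kscale c s : seq K := map (ksc c) s.

Definition ksub s t := s ++ kscale (-1) t.

Definition kq s : R := Num.sqrt (complex.Re (kform s s)).

Lemma kformC s t : kform t s = (kform s t)^*.
Proof.
rewrite /kform conj_sum exchange_big /=; apply: eq_bigr => i _.
by rewrite conj_sum; apply: eq_bigr => j _; rewrite kfC.
Qed.

Lemma kform_catl s s' t : kform (s ++ s') t = kform s t + kform s' t.
Proof. by rewrite /kform big_cat. Qed.

Lemma kform_catr s t t' : kform s (t ++ t') = kform s t + kform s t'.
Proof. by rewrite kformC kform_catl rmorphD /= -!kformC. Qed.

Lemma kform_scl c s t : kform (kscale c s) t = c * kform s t.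
Proof.
rewrite /kform big_map mulr_sumr; apply: eq_bigr => i _.
by rewrite mulr_sumr; apply: eq_bigr => j _; rewrite kfZ.
Qed.

Lemma kform_scr c s t : kform s (kscale c t) = c^* * kform s t.
Proof. by rewrite kformC kform_scl rmorphM /= -kformC. Qed.

Lemma kform_subl s s' t : kform (ksub s s') t = kform s t - kform s' t.
Proof. by rewrite kform_catl kform_scl mulN1r. Qed.

Lemma kform_ge0 s : 0 <= kform s s. Proof. exact: kf_psd. Qed.

Lemma kq_ge0 s : 0 <= kq s. Proof. exact: sqrtr_ge0. Qed.

Lemma kq_sqr s : kform s s = (kq s ^+ 2)%:C%C.
Proof. by rewrite sqr_sqrtr ?ge0_Re ?kform_ge0// -ge0_ReE// kform_ge0. Qed.

Lemma nr_kform s t : nr (kform s t) <= kq s * kq t.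
Proof.
apply: sqr_le_mulr_sqrt; rewrite ?nr_ge0 ?ge0_Re ?kform_ge0//.
apply: psd2; rewrite ?ge0_Re ?kform_ge0// => w.
have := ge0_Re (kform_ge0 (s ++ kscale w t)).
rewrite kform_catl !kform_catr !kform_scl !kform_scr (kformC s t) !ReD.
rewrite mulrA nr_mulJ ReRM.
suff -> : complex.Re (w * (kform s t)^*) = complex.Re (w^* * kform s t).
  by move=> h; lra.
by rewrite -[LHS]ReJ rmorphM /= conjCK.
Qed.

Lemma kq_scale c s : kq (kscale c s) = nr c * kq s.
Proof.
rewrite /kq kform_scl kform_scr mulrA nr_mulJ ReRM sqrtrM ?sqr_ge0//.
by rewrite sqrtr_sqr ger0_norm ?nr_ge0.
Qed.

(* A vector F of the completion is the function j |-> <F, j>; kev extends it to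
   formal sums, antilinearly. *)
Definition kev (F : K -> R[i]) r : R[i] := \sum_(j <- r) F j.

Lemma kev_cat F r r' : kev F (r ++ r') = kev F r + kev F r'.
Proof. exact: big_cat. Qed.

Lemma kev1 F j : kev F [:: j] = F j. Proof. exact: big_seq1. Qed.

Lemma kev_lin (F G : K -> R[i]) a r :
  kev (a *: F + G) r = a * kev F r + kev G r.
Proof. by rewrite /kev mulr_sumr -big_split. Qed.

(** The dual seminorm of F minus the functional of s is at most e. Before the completion has a norm,
    this expresses that F lies within e of the vector of s. *)
Definition kapx (F : K -> R[i]) (e : R) s :=
  forall r, nr (kev F r - kform s r) <= e * kq r.

Definition kiota s : K -> R[i] := fun j => kform s [:: j].

Lemma kev_iota s r : kev (kiota s) r = kform s r.
Proof.
rewrite /kev /kiota /kform exchange_big /=; apply: eq_bigr => j _.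
by apply: eq_bigr => i _; rewrite big_seq1.
Qed.

Lemma kapx_iota s : kapx (kiota s) 0 s.
Proof. by move=> r; rewrite kev_iota subrr nr0 mul0r. Qed.

Lemma kapx_le F e e' s : kapx F e s -> e <= e' -> kapx F e' s.
Proof. by move=> h ee r; apply: le_trans (h r) _; rewrite ler_wpM2r ?kq_ge0. Qed.

Lemma kapx_lin a F G e e' s s' : kapx F e s -> kapx G e' s' ->
  kapx (a *: F + G) (nr a * e + e') (kscale a s ++ s').
Proof.
move=> h h' r; rewrite kev_lin kform_catl kform_scl.
rewrite opprD addrACA -mulrBr; apply: le_trans (ler_nrD _ _) _.
by rewrite mulrDl lerD// nrM -mulrA ler_wpM2l// nr_ge0.
Qed.

(** Both approximations are tested on the formal difference r of s and s' itself, which bounds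
    kq(r)^2 by (e + e') kq(r). *)
Lemma kapx_dist F e e' s s' : 0 <= e -> 0 <= e' ->
  kapx F e s -> kapx F e' s' -> kq (ksub s s') <= e + e'.
Proof.
move=> e0 e0' h h'; apply: le_sqr_cancel; first exact: addr_ge0.
set r := ksub s s'; have -> : kq r ^+ 2 = nr (kform r r).
  by rewrite kq_sqr nr_real ger0_norm// sqr_ge0.
rewrite {1}/r kform_subl (le_trans (ler_nr_dist (kev F r) _ _))//.
by rewrite nr_distC mulrDl lerD.
Qed.

Lemma kapx_q_le F e M s : 0 <= e -> 0 <= M -> (forall r, nr (kev F r) <= M * kq r) ->
  kapx F e s -> kq s <= M + e.
Proof.
move=> e0 M0 FM h; apply: le_sqr_cancel; first exact: addr_ge0.
have -> : kq s ^+ 2 = nr (kform s s) by rewrite kq_sqr nr_real ger0_norm// sqr_ge0.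
rewrite -[kform s s](subrK (kev F s)) (le_trans (ler_nrD _ _))// nr_distC.
by rewrite addrC mulrDl lerD.
Qed.

(** The completion is realized as the closure of the formal sums among functions on the points. A
    formal sum in the kernel of the form is the zero function there, so no quotient has to be
    taken. *)
Definition kapprox : {pred (K -> R[i])} :=
  fun F => `[< forall e : R, 0 < e -> exists s, kapx F e s >].

Lemma kapproxP F : reflect (forall e : R, 0 < e -> exists s, kapx F e s) (F \in kapprox).
Proof. exact: asboolP. Qed.

Lemma kapprox_submod : submod_closed kapprox.
Proof.
split.
  apply/kapproxP => e e0; exists [::] => r; rewrite /kev big1// /kform big_nil.
  by rewrite subrr nr0 mulr_ge0 ?kq_ge0// ltW.
move=> a F G /kapproxP hF /kapproxP hG; apply/kapproxP => e e0.
have a1 : 0 < nr a + 1 by rewrite ltr_wpDl// nr_ge0.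
have [|s hs] := hF (e / 2 / (nr a + 1)); first by rewrite !divr_gt0.
have [|t ht] := hG (e / 2); first by rewrite divr_gt0.
exists (kscale a s ++ t); apply: kapx_le (kapx_lin a hs ht) _.
have : nr a * (e / 2 / (nr a + 1)) <= e / 2.
  by rewrite mulrCA ger_pMr ?divr_gt0// ler_pdivrMr// mul1r lerDl.
lra.
Qed.

HB.instance Definition _ :=
  GRing.isSubmodClosed.Build R[i] (K -> R[i]) kapprox kapprox_submod.

Lemma kapprox_iota s : kiota s \in kapprox.
Proof.
by apply/kapproxP => e e0; exists s; apply: kapx_le (kapx_iota s) _; exact: ltW.
Qed.

End KernelForm.

Arguments kapprox {R} K _.

Record khilb (R : realType) (K : kernel R) := KHilb {
  khilb_val : K -> R[i];
  khilb_valP : khilb_val \in kapprox K }.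

Section KernelSpace.
Variables (R : realType) (K : kernel R).

HB.instance Definition _ := [isSub for @khilb_val R K].
HB.instance Definition _ := [Choice of khilb K by <:].
HB.instance Definition _ := [SubChoice_isSubLmodule of khilb K by <:].

Notation L := (khilb K).
Implicit Types (F G : L) (r s t : seq K).

Definition ev F r := kev (val F) r.

Definition iota s : L := KHilb (kapprox_iota s).

Lemma ev_iota s r : ev (iota s) r = kform s r.
Proof. exact: kev_iota. Qed.

Lemma ev_cat F r r' : ev F (r ++ r') = ev F r + ev F r'.
Proof. exact: kev_cat. Qed.

Lemma ev_lin a F G r : ev (a *: F + G) r = a * ev F r + ev G r.
Proof. exact: kev_lin. Qed.

Lemma ev_sub F G r : ev (F - G) r = ev F r - ev G r.
Proof. by rewrite addrC -scaleN1r ev_lin mulN1r addrC. Qed.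

Lemma apx_ex F (e : R) : 0 < e -> exists s, kapx (val F) e s.
Proof. by move=> e0; have /kapproxP := khilb_valP F; exact. Qed.

(** Antilinearity is inherited from the approximants: each [kform s] is antilinear in its second
    argument. *)
Lemma evZ F c r : ev F (kscale c r) = c^* * ev F r.
Proof.
apply/eqP; rewrite -subr_eq0; apply/eqP.
apply: (@nr_geo0 _ _ (2 * (nr c * kq r))) => n.
have [s hs] := apx_ex F (geo_gt0 R n).
apply: le_trans (ler_nr_dist (kform s (kscale c r)) _ _) _.
have h1 : nr (ev F (kscale c r) - kform s (kscale c r)) <= _ := hs _.
have h2 : nr (ev F r - kform s r) <= _ := hs r.
rewrite kq_scale in h1; rewrite {2}kform_scr -mulrBr nrM nrJ (nr_distC (kform s r)).
by have := ler_wpM2l (nr_ge0 c) h2; lra.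
Qed.

Lemma ev_ksub F r r' : ev F (ksub r r') = ev F r - ev F r'.
Proof. by rewrite ev_cat evZ rmorphN rmorph1 mulN1r. Qed.

Lemma ev_bound F : exists2 M, 0 <= M & forall r, nr (ev F r) <= M * kq r.
Proof.
have [s hs] := apx_ex F ltr01; exists (kq s + 1); first by rewrite addr_ge0 ?kq_ge0.
move=> r; rewrite -[ev F r](subrK (kform s r)) (le_trans (ler_nrD _ _))// addrC.
by rewrite mulrDl; apply: lerD; [exact: nr_kform|exact: hs].
Qed.

Definition apxs G n := projT1 (cid (apx_ex G (geo_gt0 R n))).

Lemma apxsP G n : kapx (val G) (geo R n) (apxs G n).
Proof. by rewrite /apxs; case: cid. Qed.

(** F is bounded with respect to [kq], and the approximants of G are Cauchy for [kq] by [kapx_dist];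
    the limit serves as <F, G>. *)
Lemma hin_ex F G : exists l, exists C, forall n, nr (ev F (apxs G n) - l) <= C * geo R n.
Proof.
have [M M0 hM] := ev_bound F.
have [|l hl] := @cplx_seq_lim _ (fun n => ev F (apxs G n)) (fun n => M * geo R n).
  move=> n m; rewrite -ev_ksub (le_trans (hM _))// -mulrDr ler_wpM2l//.
  by apply: (@kapx_dist _ _ (val G)); rewrite ?geo_ge0//; exact: apxsP.
by exists l, (2 * M) => n; rewrite -mulrA.
Qed.

Definition hin F G : R[i] := projT1 (cid (hin_ex F G)).

Lemma hinP F G : exists C, forall n, nr (ev F (apxs G n) - hin F G) <= C * geo R n.
Proof. by rewrite /hin; case: cid. Qed.

(** Frees the inner product from the particular sequence [apxs G] used to define it. *)
Lemma hin_apx F G M e s : 0 <= e -> 0 <= M -> (forall r, nr (ev F r) <= M * kq r) ->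
  kapx (val G) e s -> nr (hin F G - ev F s) <= M * e.
Proof.
move=> e0 M0 hM hs; have [C hC] := hinP F G.
apply: (@ler_geo _ _ _ (C + M)) => n.
apply: le_trans (ler_nr_dist (ev F (apxs G n)) _ _) _.
rewrite nr_distC -ev_ksub.
have : nr (ev F (ksub (apxs G n) s)) <= M * (geo R n + e).
  apply: le_trans (hM _) _; rewrite ler_wpM2l//.
  by apply: (@kapx_dist _ _ (val G)); rewrite ?geo_ge0//; exact: apxsP.
have := hC n; lra.
Qed.

Lemma hin_iota F s : hin F (iota s) = ev F s.
Proof.
have [M M0 hM] := ev_bound F.
apply/eqP; rewrite -subr_eq0 -nr_eq0 eq_le nr_ge0 andbT.
have := @hin_apx F (iota s) M 0 s (lexx _) M0 hM (kapx_iota s).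
by rewrite mulr0.
Qed.

Lemma hinl a F F' G : hin (a *: F + F') G = a * hin F G + hin F' G.
Proof.
have [C hC] := hinP F G; have [C' hC'] := hinP F' G.
have [D hD] := hinP (a *: F + F') G.
apply/eqP; rewrite -subr_eq0; apply/eqP.
apply: (@nr_geo0 _ _ (D + (nr a * C + C'))) => n.
apply: le_trans (ler_nr_dist (ev (a *: F + F') (apxs G n)) _ _) _.
rewrite nr_distC mulrDl lerD// ev_lin opprD addrACA -mulrBr.
apply: le_trans (ler_nrD _ _) _; rewrite mulrDl lerD// nrM -mulrA ler_wpM2l//.
exact: nr_ge0.
Qed.

Lemma apxs_bound F : exists2 M, 0 <= M & forall n, kq (apxs F n) <= M.
Proof.
have [M M0 hM] := ev_bound F; exists (M + 1); first by rewrite addr_ge0.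
move=> n; apply: le_trans (kapx_q_le (geo_ge0 R n) M0 hM (apxsP F n)) _.
by rewrite lerD2l geo_le1.
Qed.

(** Both sides are compared with the form of the approximants of F and G, where symmetry is
    [kformC]. *)
Lemma hinC F G : hin G F = (hin F G)^*.
Proof.
have [C hC] := hinP F G; have [C' hC'] := hinP G F.
have [M M0 hM] := apxs_bound F; have [N N0 hN] := apxs_bound G.
apply/eqP; rewrite -subr_eq0; apply/eqP.
apply: (@nr_geo0 _ _ (C + N + (M + C'))) => n.
set s := apxs F n; set t := apxs G n.
have h1 := hC n; have h2 := hC' n.
have h3 : nr (ev F t - kform s t) <= N * geo R n.
  by apply: le_trans (apxsP F n t) _; rewrite mulrC ler_wpM2r ?geo_ge0 ?hN.
have h4 : nr (ev G s - kform t s) <= M * geo R n.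
  by apply: le_trans (apxsP G n s) _; rewrite mulrC ler_wpM2r ?geo_ge0 ?hM.
have h3' : nr ((ev F t)^* - kform t s) <= N * geo R n.
  by rewrite kformC -rmorphB nrJ.
have h1' : nr ((ev F t)^* - (hin F G)^*) <= C * geo R n by rewrite -rmorphB nrJ.
apply: le_trans (ler_nr_dist (ev G s) _ _) _.
have := ler_nr_dist (kform t s) (ev G s) (hin F G)^*.
have := ler_nr_dist (ev F t)^* (kform t s) (hin F G)^*.
rewrite (nr_distC (hin G F)) (nr_distC (kform t s) (ev F t)^*); lra.
Qed.

Lemma hin_ge0 F : 0 <= hin F F.
Proof.
have [C hC] := hinP F F; have [M M0 hM] := apxs_bound F.
apply: (@ge0_lim _ _ (C + M) (fun n => kform (apxs F n) (apxs F n))).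
  by move=> n; exact: kform_ge0.
move=> n; apply: le_trans (ler_nr_dist (ev F (apxs F n)) _ _) _.
rewrite nr_distC mulrDl lerD// (le_trans (apxsP F n _))//.
by rewrite mulrC ler_wpM2r ?geo_ge0.
Qed.

Definition hn F : R := Num.sqrt (complex.Re (hin F F)).

Lemma hn_ge0 F : 0 <= hn F. Proof. exact: sqrtr_ge0. Qed.

Lemma hn_sqr F : hin F F = (hn F ^+ 2)%:C%C.
Proof. by rewrite sqr_sqrtr ?ge0_Re ?hin_ge0// -ge0_ReE// hin_ge0. Qed.

Lemma hinDr F G G' : hin F (G + G') = hin F G + hin F G'.
Proof. by rewrite hinC -[G]scale1r hinl mul1r rmorphD /= scale1r -!hinC. Qed.

Lemma hinDl F F' G : hin (F + F') G = hin F G + hin F' G.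
Proof. by rewrite -[F]scale1r hinl mul1r scale1r. Qed.

Lemma hin0l G : hin 0 G = 0.
Proof. by apply: (addrI (hin 0 G)); rewrite -hinDl !addr0. Qed.

Lemma hinZl a F G : hin (a *: F) G = a * hin F G.
Proof. by rewrite -[a *: F]addr0 hinl hin0l addr0. Qed.

Lemma hinZr a F G : hin F (a *: G) = a^* * hin F G.
Proof. by rewrite hinC hinZl rmorphM /= -hinC. Qed.

Lemma nr_hin F G : nr (hin F G) <= hn F * hn G.
Proof.
apply: sqr_le_mulr_sqrt; rewrite ?nr_ge0 ?ge0_Re ?hin_ge0//.
apply: psd2; rewrite ?ge0_Re ?hin_ge0// => w.
have := ge0_Re (hin_ge0 (F + w *: G)).
rewrite hinDl !hinDr !hinZl !hinZr (hinC F G) !ReD mulrA nr_mulJ ReRM.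
suff -> : complex.Re (w * (hin F G)^*) = complex.Re (w^* * hin F G).
  by move=> h; lra.
by rewrite -[LHS]ReJ rmorphM /= conjCK.
Qed.

Lemma hnD F G : hn (F + G) <= hn F + hn G.
Proof.
rewrite -(@ler_pXn2r _ 2) ?nnegrE ?addr_ge0 ?hn_ge0//.
have -> : hn (F + G) ^+ 2 = complex.Re (hin (F + G) (F + G)) by rewrite hn_sqr.
rewrite hinDl !hinDr (hinC F G) !hn_sqr !ReD ReJ /=.
have := le_trans (le_Re_nr _) (nr_hin F G); rewrite ler_norml => /andP[_]; nra.
Qed.

Lemma hnZ a F : hn (a *: F) = nr a * hn F.
Proof.
rewrite /hn hinZl hinZr mulrA nr_mulJ ReRM sqrtrM ?sqr_ge0//.
by rewrite sqrtr_sqr ger0_norm ?nr_ge0.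
Qed.

Lemma hn_iota s : hn (iota s) = kq s.
Proof. by rewrite /hn hin_iota ev_iota. Qed.

Lemma nr_ev F r : nr (ev F r) <= hn F * kq r.
Proof. by rewrite -hin_iota -hn_iota nr_hin. Qed.

Lemma hn_eq0 F : hn F = 0 -> F = 0.
Proof.
move=> F0; apply: val_inj; apply/funext => j; rewrite [RHS]/(0 : R[i]).
apply/eqP; rewrite -nr_eq0 eq_le nr_ge0 andbT.
by have := nr_ev F [:: j]; rewrite F0 mul0r /ev kev1.
Qed.

(** Since <F, F> is the limit of F on its own approximants, the Hilbert norm is dominated by the
    dual norm; with [nr_ev] the two coincide. *)
Lemma hn_le F M : 0 <= M -> (forall r, nr (ev F r) <= M * kq r) -> hn F <= M.
Proof.
move=> M0 h; rewrite -(@ler_pXn2r _ 2) ?nnegrE ?hn_ge0//.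
have -> : hn F ^+ 2 = nr (hin F F) by rewrite hn_sqr nr_real ger0_norm// sqr_ge0.
apply: (@ler_geo _ _ _ (M + M)) => n.
have := hin_apx (geo_ge0 R n) M0 h (apxsP F n).
have := le_trans (h _) (ler_wpM2l M0 (kapx_q_le (geo_ge0 R n) M0 h (apxsP F n))).
have := ler_nrD (hin F F - ev F (apxs F n)) (ev F (apxs F n)); rewrite subrK.
lra.
Qed.

Definition hnorm F : R[i] := (hn F)%:C%C.

Fact hnormD F G : hnorm (F + G) <= hnorm F + hnorm G.
Proof. by rewrite /hnorm -rmorphD lecR hnD. Qed.
Fact hnormZ a F : hnorm (a *: F) = `|a| * hnorm F.
Proof. by rewrite /hnorm hnZ rmorphM /= nrE. Qed.
Fact hnorm0_eq0 F : hnorm F = 0 -> F = 0.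
Proof. by move=> /(congr1 (@complex.Re R)) /= /hn_eq0. Qed.

HB.instance Definition _ :=
  Lmodule_isNormed.Build R[i] L hnormD hnormZ hnorm0_eq0.

Lemma nr_hn F : nr F = hn F. Proof. by []. Qed.

Lemma hn_distC F G : hn (F - G) = hn (G - F).
Proof. by rewrite -opprB -scaleN1r hnZ nrN nr1 mul1r. Qed.

Lemma hn_dist G F F' : hn (F - F') <= hn (F - G) + hn (G - F').
Proof. by rewrite -[F - F'](subrKA G) hnD. Qed.

Lemma khilb_ball F G e : ball F e%:C%C G = (hn (F - G) < e) :> Prop.
Proof.
by rewrite -[ball _ _ _]/(is_true (hnorm (F - G) < e%:C%C)) /hnorm ltcR.
Qed.

(** Centres of balls of radius 2^-n belonging to the filter converge pointwise as functions. The
    Cauchy estimate upgrades this to convergence in the dual norm, so the pointwise limit is again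
    approximable. *)
Fact khilb_complete (Phi : set_system L) :
  ProperFilter Phi -> cauchy Phi -> cvg Phi.
Proof.
move=> PF /cauchyP Phi_cauchy.
have ex_x n : exists y : L, Phi (ball y (geo R n)%:C%C).
  by apply: Phi_cauchy; rewrite ltcR geo_gt0.
have [x hx] := choice ex_x.
have xd n m : hn (x n - x m) <= geo R n + geo R m.
  have [z [zn zm]] := filter_ex (filterI (hx n) (hx m)).
  move: zn zm; rewrite !khilb_ball => zn zm.
  have zm' : hn (z - x m) <= geo R m by rewrite hn_distC (ltW zm).
  exact: le_trans (hn_dist z (x n) (x m)) (lerD (ltW zn) zm').
have ex_G j : exists l, forall n, nr (val (x n) j - l) <= 2 * (kq [:: j] * geo R n).
  apply: cplx_seq_lim => n m; rewrite -mulrDr.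
  have := nr_ev (x n - x m) [:: j]; rewrite ev_sub /ev !kev1 => /le_trans; apply.
  by rewrite mulrC ler_wpM2l ?kq_ge0.
have [G hG] := choice ex_G.
have xG n r : nr (kev (val (x n)) r - kev G r) <= geo R n * kq r.
  (* The pointwise errors depend on r without control by [kq r], but carry a factor 2^-m and vanish
     as m grows; the part controlled by [kq r] remains. *)
  pose D := \sum_(j <- r) 2 * kq [:: j].
  apply: (@ler_geo _ _ _ (kq r + D)) => m.
  apply: le_trans (ler_nr_dist (kev (val (x m)) r) _ _) _.
  have h1 : nr (kev (val (x n)) r - kev (val (x m)) r) <= (geo R n + geo R m) * kq r.
    have := nr_ev (x n - x m) r; rewrite ev_sub => /le_trans; apply.
    by rewrite ler_wpM2r ?kq_ge0.
  have h2 : nr (kev (val (x m)) r - kev G r) <= D * geo R m.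
    rewrite /kev -sumrB (le_trans (ler_nr_sum _ _ _))// /D mulr_suml.
    by apply: ler_sum => j _; rewrite -mulrA.
  by move: h1 h2; lra.
have Gap : G \in kapprox K.
  apply/kapproxP => e e0.
  have [n hn] := @pow_small _ _ (e / 2) (half01 R) (divr_gt0 e0 (ltr0Sn R 1)).
  have [s hs] := apx_ex (x n) (divr_gt0 e0 (ltr0Sn R 1)).
  exists s => r; apply: le_trans (ler_nr_dist (kev (val (x n)) r) _ _) _.
  rewrite nr_distC.
  have := ler_wpM2r (kq_ge0 r) (ltW hn); have := xG n r; have := hs r.
  rewrite /geo; lra.
apply/cvg_ex; exists (KHilb Gap : L); apply/cvg_ballP => e e0.
have eE : e = (complex.Re e)%:C%C by rewrite -ge0_ReE// ltW.
have e'0 : 0 < complex.Re e by rewrite -ltcR -eE.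
have [n hn'] := @pow_small _ _ (complex.Re e / 2) (half01 R) (divr_gt0 e'0 (ltr0Sn R 1)).
apply: filterS (hx n) => z; rewrite eE !khilb_ball => zn.
apply: le_lt_trans (hn_dist (x n) _ _) _.
have : hn ((KHilb Gap : L) - x n) <= geo R n.
  rewrite hn_distC; apply: hn_le (geo_ge0 R n) _ => r.
  by rewrite ev_sub; exact: xG.
move: zn hn'; rewrite /geo; lra.
Qed.

HB.instance Definition _ := Uniform_isComplete.Build L khilb_complete.

Fact hin_norm F : hin F F = `|F| ^+ 2.
Proof. by rewrite hn_sqr nrE nr_hn rmorphXn. Qed.
Fact khilb_nontrivial : exists F : L, F != 0.
Proof.
have [j hj] := kf_neq0 K; exists (iota [:: j]); apply/eqP => h.
have := hin0l (iota [:: j]); rewrite -h hin_iota ev_iota /kform !big_seq1.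
by apply/eqP.
Qed.

HB.instance Definition _ := isHilbert.Build R L hinl hinC hin_norm khilb_nontrivial.

Lemma inner_iota F s : inner F (iota s) = ev F s.
Proof. exact: hin_iota. Qed.

Lemma apx_nr F e s : 0 <= e -> kapx (val F) e s -> nr (F - iota s) <= e.
Proof.
by move=> e0 h; rewrite nr_hn; apply: hn_le => // r; rewrite ev_sub ev_iota; exact: h.
Qed.

Lemma iota_dense : dense (range iota).
Proof.
move=> O [F OF] Oo; have /nbhs_ballP[e e0 he] := open_nbhs_nbhs (conj Oo OF).
have e1 : 0 < complex.Re e by rewrite -ltcR -ge0_ReE// ltW.
have [s hs] := apx_ex F (divr_gt0 e1 (ltr0Sn R 1)).
exists (iota s); split; last by exists s.
apply: he; rewrite -ball_normE /ball_ /= nrE (ge0_ReE (ltW e0)) ltcR.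
by apply: le_lt_trans (apx_nr (ltW (divr_gt0 e1 (ltr0Sn R 1))) hs) _; lra.
Qed.

End KernelSpace.

(** * Operators induced by maps of the points of a kernel *)

Section KernelOperators.
Variables (R : realType) (K : kernel R).
Notation L := (khilb K).
Implicit Types (F G : L) (r s t : seq K).

Lemma khilb_ext F G : (forall j, inner F (iota [:: j]) = inner G (iota [:: j])) -> F = G.
Proof.
move=> h; apply: val_inj; apply/funext => j.
by have := h j; rewrite !inner_iota /ev !kev1.
Qed.

Lemma iota_ext s t : (forall j, kform s [:: j] = kform t [:: j]) -> iota s = iota t.
Proof. by move=> h; apply: khilb_ext => j; rewrite !inner_iota !ev_iota. Qed.

Lemma iota_cat s t : iota (s ++ t) = iota s + iota t.
Proof.
by apply: khilb_ext => j; rewrite innerDl !inner_iota !ev_iota kform_catl.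
Qed.

Lemma iota_nil : iota [::] = 0 :> L.
Proof. by apply: khilb_ext => j; rewrite inner0l inner_iota ev_iota /kform big_nil. Qed.

Lemma iota_sum s : iota s = \sum_(j <- s) iota [:: j].
Proof.
elim: s => [|j s IH]; first by rewrite big_nil iota_nil.
by rewrite big_cons -IH -iota_cat.
Qed.

Lemma kform1 (i j : K) : kform [:: i] [:: j] = kf i j.
Proof. by rewrite /kform !big_seq1. Qed.

Lemma inner_iota1 (i j : K) : inner (iota [:: i]) (iota [:: j]) = kf i j.
Proof. by rewrite inner_iota ev_iota kform1. Qed.

(** Passing to adjoints replaces a density argument: <S^* F, j> = <F, S j> is determined by the
    values of S on points. *)
Lemma bop_iota_ext (S T : bop L L) :
  (forall j, S (iota [:: j]) = T (iota [:: j])) -> S = T.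
Proof.
move=> h; rewrite -[S]adjK -[T]adjK; congr adj.
by apply: bopP => F; apply: khilb_ext => j; rewrite ![inner (adj _ _) _]innerC -!adjE h.
Qed.

(** The relation <T F, j> = <F, tau' j> dictates that T is composition of functions with tau'; the
    bound on tau' over formal sums makes it bounded and preserves approximability. *)
Lemma kop_ex (tau tau' : K -> K) (C : R) :
  (forall i j, kf (tau i) j = kf i (tau' j)) -> 0 <= C ->
  (forall r, kq (map tau' r) <= C * kq r) ->
  exists T : bop L L, [/\ forall j, T (iota [:: j]) = iota [:: tau j] &
    forall j, adj T (iota [:: j]) = iota [:: tau' j]].
Proof.
move=> tauA C0 tauC.
have kevE (F : K -> R[i]) r : kev (F \o tau') r = kev F (map tau' r).
  by rewrite /kev big_map.
have formE s r : kform (map tau s) r = kform s (map tau' r).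
  rewrite /kform big_map; apply: eq_bigr => i _; rewrite big_map.
  by apply: eq_bigr.
have ap F : val F \o tau' \in kapprox K.
  apply/kapproxP => e e0.
  have C1 : 0 < C + 1 by rewrite ltr_wpDl.
  have [s hs] := apx_ex F (divr_gt0 e0 C1); exists (map tau s) => r.
  rewrite kevE formE (le_trans (hs _))//.
  apply: le_trans (ler_wpM2l (ltW (divr_gt0 e0 C1)) (tauC r)) _.
  rewrite mulrA ler_wpM2r ?kq_ge0// -mulrA ger_pMr// mulrC ler_pdivrMr//.
  by rewrite mul1r lerDl.
pose T F : L := KHilb (ap F).
have Tl : linear T by move=> a F G; apply: val_inj.
have Tb : exists M : R, forall F, `|T F| <= M%:C%C * `|F|.
  exists C => F; rewrite (nrE F) -rmorphM -nr_le nr_hn; apply: hn_le.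
    by rewrite mulr_ge0 ?hn_ge0.
  move=> r; rewrite /ev kevE (le_trans (nr_ev F _))//.
  rewrite [C * _]mulrC -mulrA; apply: ler_wpM2l; [exact: hn_ge0|exact: tauC].
exists (Bop Tl Tb); split=> j.
  by apply: khilb_ext => i; rewrite !inner_iota ev_iota /= /ev kev1 /= /kiota !kform1 tauA.
apply: inner_injr => F; rewrite -adjE !inner_iota /= /ev !kev1 //.
Qed.

(** The algebraic laws are required only of the form, because points cannot be added. They become
    identities of operators since points separate vectors. Left multiplication in GNS and the action
    of B on the tensor product are both obtained from this. *)
Lemma kernel_rep (B : starAlgType R) (tau : B -> K -> K) :
  (forall b i j, kf (tau b i) j = kf i (tau (star b) j)) ->
  (forall b, exists2 C : R, 0 <= C & forall r, kq (map (tau b) r) <= C * kq r) ->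
  (forall a b c i j, kf (tau (a *: b + c) i) j = a * kf (tau b i) j + kf (tau c i) j) ->
  (forall b c i j, kf (tau (b * c) i) j = kf (tau b (tau c i)) j) ->
  (forall i j, kf (tau 1 i) j = kf i j) ->
  exists alpha : {lrmorphism B -> bop L L},
    star_preserving alpha /\ forall b j, alpha b (iota [:: j]) = iota [:: tau b j].
Proof.
move=> tauA tauC tauL tauM tau1.
have ex b : exists T : bop L L, (forall j, T (iota [:: j]) = iota [:: tau b j]) /\
    forall j, adj T (iota [:: j]) = iota [:: tau (star b) j].
  have [C C0 hC] := tauC (star b).
  by have [T [h1 h2]] := kop_ex (tauA b) C0 hC; exists T.
have [f hf] := choice ex.
have iE i j : kf i =1 kf j -> iota [:: i] = iota [:: j] :> L.
  by move=> h; apply: iota_ext => k; rewrite !kform1.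
have fl : linear f.
  move=> a b c; apply: bop_iota_ext => j; rewrite /= !(hf _).1.
  apply: khilb_ext => i; rewrite innerDl innerZl !inner_iota1; exact: tauL.
have fm : monoid_morphism f.
  split.
    by apply: bop_iota_ext => j; rewrite (hf _).1; apply: iE => i; exact: tau1.
  move=> b c; apply: bop_iota_ext => j; rewrite /= !(hf _).1; apply: iE => i.
  exact: tauM.
pose fL := GRing.isLinear.Build R[i] B (bop L L) *:%R f fl.
pose fM := GRing.isMonoidMorphism.Build B (bop L L) f fm.
pose q : {lrmorphism B -> bop L L} := HB.pack f fL fM.
exists q; split=> [b|b j]; last exact: (hf b).1.
by apply: bop_iota_ext => j; rewrite [LHS](hf _).1 [RHS](hf b).2.
Qed.

End KernelOperators.

(** * The GNS representation of an operator-valued state *)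

Section GNSConstruction.
Variables (R : realType) (A : starAlgType R) (N : A -> R) (H : hilbertType R).
Variable phi : A -> bop H H.
Hypothesis phiS : opstate N phi.

Lemma opstateD x y : phi (x + y) = phi x + phi y.
Proof. by case: phiS => /(_ 1 x y); rewrite !scale1r. Qed.

Lemma opstateZ c x : phi (c *: x) = c *: phi x.
Proof.
have phi0 : phi 0 = 0 by apply: (addrI (phi 0)); rewrite -opstateD !addr0.
by case: phiS => /(_ c x 0); rewrite phi0 !addr0.
Qed.

Lemma opstateB x y : phi (x - y) = phi x - phi y.
Proof. by rewrite -scaleN1r opstateD opstateZ scaleN1r. Qed.

Definition gf (x y : A * H) : R[i] := inner (phi (star y.1 * x.1) x.2) y.2.

Lemma opstate_form_ge0 (s : seq (A * H)) :
  0 <= \sum_(x <- s) \sum_(y <- s) gf x y.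
Proof.
case: phiS => _ _ h _; have := h (size s) (fun i => (tnth (in_tuple s) i).1)
  (fun i => (tnth (in_tuple s) i).2); congr (_ <= _).
rewrite [RHS]big_tnth; apply: eq_bigr => i _.
by rewrite [RHS]big_tnth; apply: eq_bigr.
Qed.

Lemma opstate_formZl c x y : gf (x.1, c *: x.2) y = c * gf x y.
Proof. by rewrite /gf /= linearZ innerZl. Qed.

Lemma opstate_formZr c x y : gf x (y.1, c *: y.2) = c^* * gf x y.
Proof. by rewrite /gf /= innerZr. Qed.

(** Hermitian symmetry is extracted from positivity by polarization: gf x z + gf z x is real, both
    for z = y and for z = i y. *)
Lemma opstate_formC x y : gf y x = (gf x y)^*.
Proof.
have h z : 0 <= gf x x + gf x z + (gf z x + gf z z).
  by have := opstate_form_ge0 [:: x; z]; rewrite !big_cons !big_nil !addr0.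
have h1 z : 0 <= gf z z by have := opstate_form_ge0 [:: z]; rewrite !big_seq1.
have I z : complex.Im (gf x z + gf z x) = 0.
  have -> : gf x z + gf z x = (gf x x + gf x z + (gf z x + gf z z)) - gf x x - gf z z.
    by ring.
  have := ger0_Im (h z); have := ger0_Im (h1 x); have := ger0_Im (h1 z).
  case: (gf x x) => ? ?; case: (gf z z) => ? ?; case: (_ + _) => ? ? /= -> -> ->.
  by rewrite !subr0.
have := I y; have := I (y.1, 'i%C *: y.2).
rewrite opstate_formZl opstate_formZr.
case: (gf x y) => a b; case: (gf y x) => c d /=.
rewrite !(mul0r, mul1r, sub0r, subr0, addr0, add0r) => h2 h3.
by apply/eqP; rewrite eq_complex /=; apply/andP; split; apply/eqP; lra.
Qed.

Fact gf_neq0 : exists x, gf x x != 0.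
Proof.
have [h h0] := @hilbert_nontrivial _ H; exists (1, h).
rewrite /gf /= star1 mulr1; case: phiS => _ -> _ _.
by rewrite /= inner_norm sqrf_eq0 normr_eq0.
Qed.

Definition gkernel : kernel R :=
  @Kernel R _ (fun c x => (x.1, c *: x.2)) gf opstate_formZl opstate_formC
    opstate_form_ge0 gf_neq0.

(** The third condition on states, at b, is exactly M <s, s> - <b s, b s> >= 0 for M the value of
    [N] at b^* b. The absolute value keeps the constant meaningful for an arbitrary function [N]. *)
Lemma opstate_bounded (b : A) (s : seq gkernel) :
  kq (map (fun x : A * H => (b * x.1, x.2) : gkernel) s) <=
  Num.sqrt `|N (star b * b)| * kq s.
Proof.
set s' := map _ s; rewrite -(@ler_pXn2r _ 2) ?nnegrE ?mulr_ge0 ?sqrtr_ge0 ?kq_ge0//.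
rewrite exprMn (sqr_sqrtr (normr_ge0 (N _))).
have [_ _ _ /(_ (size s) (fun i => (tnth (in_tuple s) i).1) b
  (fun i => (tnth (in_tuple s) i).2))] := phiS.
set M := N _.
have -> : \sum_i \sum_j inner (phi (star (tnth (in_tuple s) j).1 *
   (M%:C%C%:A - star b * b) * (tnth (in_tuple s) i).1)
      (tnth (in_tuple s) i).2) (tnth (in_tuple s) j).2 =
   M%:C%C * kform s s - kform s' s'.
  rewrite /kform [\sum_(_ <- s') _]big_map mulr_sumr -sumrB [RHS]big_tnth.
  apply: eq_bigr => i _.
  rewrite [\sum_(_ <- s') _]big_map mulr_sumr -sumrB [RHS]big_tnth.
  apply: eq_bigr => j _; rewrite /= /gf /=.
  rewrite mulrBr mulrBl -scalerAr mulr1 -scalerAl.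
  rewrite opstateB opstateZ /= innerDl !innerZl mulN1r starM !mulrA.
  by [].
rewrite !kq_sqr -rmorphM -rmorphB ler0c subr_ge0 => /le_trans; apply.
by apply: ler_wpM2r; [exact: sqr_ge0|exact: ler_norm].
Qed.

Lemma gns_exists : inhabited (gns phi).
Proof.
pose tau (b : A) (x : gkernel) : gkernel := (b * x.1, x.2).
have [| | | | |pi [piS piE]] := @kernel_rep R gkernel A tau.
- by move=> b x y; rewrite /= /gf /= starM starK mulrA.
- move=> b; exists (Num.sqrt `|N (star b * b)|); first exact: sqrtr_ge0.
  exact: opstate_bounded.
- move=> a b c x y; rewrite /= /gf /= mulrDl -scalerAl mulrDr -scalerAr.
  by rewrite opstateD opstateZ /= innerDl innerZl.
- by move=> b c x y; rewrite /= /gf /= !mulrA.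
- by move=> x y; rewrite /= /gf /= mul1r.
pose t (a : A) (h : H) : khilb gkernel := iota [:: ((a, h) : gkernel)].
have tl h : linear (t^~ h).
  move=> c a b; apply: khilb_ext => y; rewrite innerDl innerZl !inner_iota1 /=.
  by rewrite /gf /= mulrDr -scalerAr opstateD opstateZ /= innerDl innerZl.
have tr a : linear (t a).
  move=> c h k; apply: khilb_ext => y; rewrite innerDl innerZl !inner_iota1 /=.
  by rewrite /gf /= linearP innerDl innerZl.
have ti a1 h1 a2 h2 : inner (t a1 h1) (t a2 h2) = inner (phi (star a2 * a1) h1) h2.
  by rewrite /t inner_iota1.
have td : dense [set x | exists n (a : 'I_n -> A) (h : 'I_n -> H),
    x = \sum_i t (a i) (h i)].
  move=> O O0 Oo; have [F [OF [s _ sF]]] := iota_dense O0 Oo.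
  rewrite -sF in OF; exists (iota s); split=> //=; exists (size s).
  exists (fun i => (tnth (in_tuple s) i).1), (fun i => (tnth (in_tuple s) i).2).
  rewrite iota_sum [LHS]big_tnth; apply: eq_bigr => i _; congr (iota [:: _]).
  exact: surjective_pairing.
have eb : exists M : R, forall h, `|t 1 h| <= M%:C%C * `|h|.
  exists 1 => h; rewrite mul1r -(@ler_pXn2r _ 2) ?nnegrE ?normr_ge0//.
  rewrite -!inner_norm ti star1 mulr1; case: phiS => _ -> _ _; exact: lexx.
by constructor; exact (@GNS R A H phi (khilb gkernel) t tl tr ti td (Bop (tr 1) eb)
  (fun h => erefl) pi piS (fun b a h => piE b _)).
Qed.

End GNSConstruction.

(** * Matrices of operators *)

Section OperatorBounds.
Variables (R : realType) (H K : hilbertType R).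
Implicit Types (T : bop H K) (x : H).

Lemma bop_sumE I (r : seq I) (P : pred I) (F : I -> bop H K) x :
  (\sum_(i <- r | P i) F i) x = \sum_(i <- r | P i) F i x.
Proof. by elim/big_rec2: _ => // i y T _ <-. Qed.

Lemma bop_boundR T : exists2 M : R, 0 <= M & forall x, nr (T x) <= M * nr x.
Proof.
by have [M M0 h] := bop_bound T; exists M => // x; rewrite nr_le rmorphM /= -nrE.
Qed.

Lemma opnorm_le T M : 0 <= M -> (forall x, nr (T x) <= M * nr x) -> opnorm T <= M.
Proof.
move=> M0 h; apply: ge_sup; first by exists (nr (T 0)), 0; rewrite //= normr0.
move=> _ [x /= x1 <-]; apply: le_trans (h x) _; rewrite -[leRHS]mulr1 ler_wpM2l//.
by rewrite nr_le.
Qed.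

Lemma nr_bop T x : nr (T x) <= opnorm T * nr x.
Proof.
have [->|x0] := eqVneq x 0; first by rewrite linear0 !nr0 mulr0.
have nx0 : 0 < nr x by rewrite lt_neqAle nr_ge0 andbT eq_sym nr_eq0.
rewrite -ler_pdivrMr// mulrC; apply: ub_le_sup.
  have [M M0 h] := bop_boundR T; exists M => _ [y /= y1 <-].
  by apply: le_trans (h y) _; rewrite -[leRHS]mulr1 ler_wpM2l// nr_le.
exists ((nr x)^-1%:C%C *: x) => /=.
  rewrite -[1](rmorph1 (real_complex R)) -nr_le nrZ nr_real gtr0_norm ?invr_gt0//.
  by rewrite mulVf// gt_eqF.
by rewrite linearZ -[LHS]/(nr _) nrZ nr_real gtr0_norm ?invr_gt0.
Qed.

Lemma opnorm_ge0 T : 0 <= opnorm T.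
Proof.
have [x x0] := @hilbert_nontrivial _ H.
have nx0 : 0 < nr x by rewrite lt_neqAle nr_ge0 andbT eq_sym nr_eq0.
by rewrite -(pmulr_lge0 _ nx0) (le_trans (nr_ge0 _) (nr_bop T x)).
Qed.

Lemma nr_inner (x y : H) : nr (inner x y) <= nr x * nr y.
Proof. by rewrite nr_le rmorphM /= -!nrE CauchySchwarz_inner. Qed.

Lemma inner_nr x : inner x x = (nr x ^+ 2)%:C%C.
Proof. by rewrite inner_norm nrE rmorphXn. Qed.

Lemma inner_suml I (r : seq I) (P : pred I) (F : I -> H) y :
  inner (\sum_(i <- r | P i) F i) y = \sum_(i <- r | P i) inner (F i) y.
Proof. by elim/big_rec2: _ => [|i z w _ <-]; rewrite ?inner0l ?innerDl. Qed.

Lemma inner_sumr I (r : seq I) (P : pred I) (F : I -> H) y :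
  inner y (\sum_(i <- r | P i) F i) = \sum_(i <- r | P i) inner y (F i).
Proof. by elim/big_rec2: _ => [|i z w _ <-]; rewrite ?inner0r ?innerDr. Qed.

Lemma hilbert_seq_lim (u : nat -> H) (C r : R) : 0 <= r < 1 ->
  (forall n m, nr (u n - u m) <= C * r ^+ n + C * r ^+ m) ->
  exists l, forall n, nr (u n - l) <= C * r ^+ n.
Proof.
move=> r01 h.
have small (e : R) : 0 < e -> exists N, forall n, (N <= n)%N -> C * r ^+ n < e.
  move=> e0; have C1 : 0 < `|C| + 1 by rewrite ltr_wpDl.
  have [N hN] := pow_small r01 (divr_gt0 e0 C1); exists N => n Nn.
  case/andP: (r01) => r0 r1.
  have rn : r ^+ n <= r ^+ N by rewrite ler_wiXn2l// ltW.
  move: hN; rewrite ltr_pdivlMr// => hN; apply: le_lt_trans hN.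
  apply: le_trans (ler_wpM2r (exprn_ge0 _ r0) (ler_norm C)) _.
  rewrite [leRHS]mulrDr mulr1 mulrC ler_wpDr ?exprn_ge0// ler_wpM2r//.
have uC : cauchy (u @ \oo).
  apply/cauchyP => e e0.
  have e1 : 0 < complex.Re e by rewrite -ltcR -ge0_ReE// ltW.
  have [N hN] := small _ (divr_gt0 e1 (ltr0Sn R 1)); exists (u N); exists N => // n /= Nn.
  rewrite -ball_normE /ball_ /= nrE (ge0_ReE (ltW e0)) ltcR.
  by have := h N n; have := hN _ (leqnn N); have := hN _ Nn; lra.
have /cauchy_cvg/cvg_ex[l ul] := uC.
exists l => n; apply/ler_addgt0Pr => e e0.
have [N hN] := small _ (divr_gt0 e0 (ltr0Sn R 1)).
have e2 : 0 < (e / 2)%:C%C :> R[i] by rewrite ltcR divr_gt0.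
move/cvgrPdist_lt: ul => /(_ _ e2) [N' _ hN'].
have h1 : nr (u (maxn N N') - l) < e / 2.
  have := hN' (maxn N N') (leq_maxr _ _); rewrite /= nrE ltcR nr_distC //.
have h2 := hN _ (leq_maxl N N'); have h3 := h n (maxn N N').
by have := ler_nr_dist (u (maxn N N')) (u n) l; lra.
Qed.

End OperatorBounds.

Lemma bop_seq_lim (R : realType) (H K : hilbertType R) (T : nat -> bop H K) (C r : R) :
  0 <= r < 1 -> 0 <= C ->
  (forall n m x, nr (T n x - T m x) <= (C * r ^+ n + C * r ^+ m) * nr x) ->
  exists S : bop H K, forall n x, nr (T n x - S x) <= C * r ^+ n * nr x.
Proof.
move=> r01 C0 h.
have ex x : exists l, forall n, nr (T n x - l) <= C * nr x * r ^+ n.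
  apply: hilbert_seq_lim => // n m; apply: le_trans (h n m x) _.
  by rewrite mulrDl ![C * _ * nr x]mulrAC.
have [S hS] := choice ex.
have Sl : linear S.
  move=> a x y; apply/eqP; rewrite -subr_eq0 -nr_eq0 eq_le nr_ge0 andbT.
  apply: (@ler_pow _ r _ _ (C * nr (a *: x + y) + (nr a * (C * nr x) + C * nr y)) r01) => n.
  rewrite add0r; apply: le_trans (ler_nr_dist (T n (a *: x + y)) _ _) _.
  rewrite mulrDl; apply: lerD; first by rewrite nr_distC; exact: hS.
  rewrite linearP opprD addrACA -scalerBr.
  apply: le_trans (ler_nrD _ _) _; rewrite mulrDl; apply: lerD; last exact: hS.
  apply: (@le_trans _ _ (nr a * nr (T n x - S x))); first by rewrite -nrZ.
  by rewrite -mulrA ler_wpM2l ?nr_ge0.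
have Sb : exists M : R, forall x, `|S x| <= M%:C%C * `|x|.
  have [M M0 hM] := bop_boundR (T 0); exists (M + C) => x.
  rewrite (nrE x) -rmorphM -nr_le -[S x](subrK (T 0 x)) (le_trans (ler_nrD _ _))//.
  by rewrite nr_distC mulrDl addrC lerD// (le_trans (hS x 0))// expr0 mulr1.
by exists (Bop Sl Sb) => n x; rewrite mulrAC hS.
Qed.

Section OperatorMatrixTheory.
Variables (R : realType) (H : hilbertType R) (n : nat).
Implicit Types (S T W : 'M[bop H H]_n) (h k : 'I_n -> H) (x : H).

Definition mn h : R := Num.sqrt (complex.Re (mxinner h h)).

Lemma mxinnerC h k : mxinner k h = (mxinner h k)^*.
Proof. by rewrite /mxinner conj_sum; apply: eq_bigr => i _; rewrite innerC. Qed.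

Lemma mxinnerDl h h' k : mxinner (h + h') k = mxinner h k + mxinner h' k.
Proof. by rewrite /mxinner -big_split; apply: eq_bigr => i _; rewrite innerDl. Qed.

Lemma mxinnerZl a h k : mxinner (a *: h) k = a * mxinner h k.
Proof. by rewrite /mxinner mulr_sumr; apply: eq_bigr => i _; rewrite innerZl. Qed.

Lemma mxinnerDr h k k' : mxinner h (k + k') = mxinner h k + mxinner h k'.
Proof. by rewrite /mxinner -big_split; apply: eq_bigr => i _; rewrite innerDr. Qed.

Lemma mxinnerZr a h k : mxinner h (a *: k) = a^* * mxinner h k.
Proof. by rewrite /mxinner mulr_sumr; apply: eq_bigr => i _; rewrite innerZr. Qed.

Lemma mxinnerBl h h' k : mxinner (h - h') k = mxinner h k - mxinner h' k.
Proof. by rewrite -scaleN1r mxinnerDl mxinnerZl mulN1r. Qed.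

Lemma mxinnerBr h k k' : mxinner h (k - k') = mxinner h k - mxinner h k'.
Proof. by rewrite -scaleN1r mxinnerDr mxinnerZr rmorphN rmorph1 mulN1r. Qed.

Lemma mxinner_ge0 h : 0 <= mxinner h h.
Proof. by apply: sumr_ge0 => i _; rewrite inner_norm exprn_ge0. Qed.

Lemma mn_ge0 h : 0 <= mn h. Proof. exact: sqrtr_ge0. Qed.

Lemma mn_sqr h : mxinner h h = (mn h ^+ 2)%:C%C.
Proof. by rewrite sqr_sqrtr ?ge0_Re ?mxinner_ge0// -ge0_ReE// mxinner_ge0. Qed.

Lemma Re_mxinner h : complex.Re (mxinner h h) = mn h ^+ 2.
Proof. by rewrite mn_sqr. Qed.

Lemma nr_mxinner h k : nr (mxinner h k) <= mn h * mn k.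
Proof.
apply: sqr_le_mulr_sqrt; rewrite ?nr_ge0 ?ge0_Re ?mxinner_ge0//.
apply: psd2; rewrite ?ge0_Re ?mxinner_ge0// => w.
have := ge0_Re (mxinner_ge0 (h + w *: k)).
rewrite mxinnerDl !mxinnerDr !mxinnerZl !mxinnerZr (mxinnerC h k) !ReD mulrA nr_mulJ ReRM.
suff -> : complex.Re (w * (mxinner h k)^*) = complex.Re (w^* * mxinner h k).
  by move=> h'; lra.
by rewrite -[LHS]ReJ rmorphM /= conjCK.
Qed.

Lemma mnD h k : mn (h + k) <= mn h + mn k.
Proof.
rewrite -(@ler_pXn2r _ 2) ?nnegrE ?addr_ge0 ?mn_ge0//.
rewrite -Re_mxinner mxinnerDl !mxinnerDr (mxinnerC h k) !mn_sqr !ReD ReJ /=.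
have := le_trans (le_Re_nr _) (nr_mxinner h k); rewrite ler_norml => /andP[_]; nra.
Qed.

Lemma mnZ a h : mn (a *: h) = nr a * mn h.
Proof.
rewrite /mn mxinnerZl mxinnerZr mulrA nr_mulJ ReRM sqrtrM ?sqr_ge0//.
by rewrite sqrtr_sqr ger0_norm ?nr_ge0.
Qed.

Lemma mnN h : mn (- h) = mn h.
Proof. by rewrite -scaleN1r mnZ nrN nr1 mul1r. Qed.

Lemma mn_distC h k : mn (h - k) = mn (k - h).
Proof. by rewrite -mnN opprB. Qed.

Lemma mn_dist k h h' : mn (h - h') <= mn (h - k) + mn (k - h').
Proof. by rewrite -[h - h'](subrKA k) mnD. Qed.

Lemma mn0 : mn 0 = 0. Proof. by rewrite -(scale0r 0) mnZ nr0 mul0r. Qed.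

Lemma mn_coord h i : nr (h i) <= mn h.
Proof.
rewrite -(@ler_pXn2r _ 2) ?nnegrE ?nr_ge0 ?mn_ge0// -Re_mxinner /mxinner Re_sum.
rewrite (bigD1 i)//= inner_nr lerDl sumr_ge0// => j _.
by rewrite inner_nr sqr_ge0.
Qed.

Lemma mn_eq0 h : mn h = 0 -> h = 0.
Proof.
move=> h0; apply/funext => i; apply/eqP; rewrite -nr_eq0 eq_le nr_ge0 andbT.
by rewrite -h0 mn_coord.
Qed.

Definition single (j : 'I_n) x : 'I_n -> H := fun i => if i == j then x else 0.

Lemma mxinner_single j x k : mxinner (single j x) k = inner x (k j).
Proof.
rewrite /mxinner (bigD1 j)//= {1}/single eqxx big1 ?addr0// => i ij.
by rewrite /single (negPf ij) inner0l.
Qed.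

Lemma mn_single j x : mn (single j x) = nr x.
Proof.
by rewrite /mn mxinner_single /single eqxx inner_nr /= sqrtr_sqr ger0_norm ?nr_ge0.
Qed.

Lemma sum_single h : h = \sum_j single j (h j).
Proof.
apply/funext => i; rewrite fct_sumE (bigD1 i)//= {1}/single eqxx big1 ?addr0// => j ij.
by rewrite /single eq_sym (negPf ij).
Qed.

Lemma mn_le_sum h : mn h <= \sum_i nr (h i).
Proof.
rewrite {1}(sum_single h); elim/big_ind2: _ => [|x y z w hx hz|i _].
- by rewrite mn0.
- exact: le_trans (mnD _ _) (lerD hx hz).
- by rewrite mn_single.
Qed.

Lemma mxapp_linear T a h k : mxapp T (a *: h + k) = a *: mxapp T h + mxapp T k.
Proof.
apply/funext => i; rewrite /mxapp; under eq_bigr do rewrite linearP.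
by rewrite big_split /= -scaler_sumr.
Qed.

Lemma mxappB T h k : mxapp T (h - k) = mxapp T h - mxapp T k.
Proof. by rewrite addrC -scaleN1r mxapp_linear scaleN1r addrC. Qed.

Lemma mxappZ T a h : mxapp T (a *: h) = a *: mxapp T h.
Proof.
have m0 : mxapp T 0 = 0.
  by apply/funext => i; rewrite /mxapp big1// => j _; rewrite linear0.
by rewrite -[a *: h]addr0 mxapp_linear m0 addr0.
Qed.

Lemma mxapp_addl S T h : mxapp (S + T) h = mxapp S h + mxapp T h.
Proof.
apply/funext => i; rewrite /mxapp [RHS](_ : _ = \sum_j S i j (h j) + \sum_j T i j (h j))//.
by rewrite -big_split; apply: eq_bigr => j _; rewrite mxE.
Qed.

Lemma mxapp_oppl T h : mxapp (- T) h = - mxapp T h.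
Proof.
apply/funext => i; rewrite /mxapp [RHS](_ : _ = - \sum_j T i j (h j))// -sumrN.
by apply: eq_bigr => j _; rewrite mxE /= scaleN1r.
Qed.

Lemma mxapp_subl S T h : mxapp (S - T) h = mxapp S h - mxapp T h.
Proof. by rewrite mxapp_addl mxapp_oppl. Qed.

Lemma mxapp_mul S T h : mxapp (S *m T) h = mxapp S (mxapp T h).
Proof.
apply/funext => i; rewrite /mxapp.
under eq_bigr => j _ do rewrite mxE bop_sumE.
by rewrite exchange_big; apply: eq_bigr => k _; rewrite linear_sum.
Qed.

Lemma mxapp1 h : mxapp 1%:M h = h.
Proof.
apply/funext => i; rewrite /mxapp (bigD1 i)//= mxE eqxx big1 ?addr0// => j ij.
by rewrite mxE eq_sym (negPf ij).
Qed.

Lemma mxapp_single T i j x : mxapp T (single j x) i = T i j x.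
Proof.
rewrite /mxapp (bigD1 j)//= /single eqxx big1 ?addr0// => k kj.
by rewrite (negPf kj) linear0.
Qed.

Lemma mxapp_ext S T : mxapp S =1 mxapp T -> S = T.
Proof.
move=> h; apply/matrixP => i j; apply: bopP => x.
by rewrite -!mxapp_single h.
Qed.

Lemma mxapp_adj T h k : mxinner (mxapp T h) k = mxinner h (mxapp (mxadj T) k).
Proof.
rewrite /mxinner /mxapp; under eq_bigr do rewrite inner_suml.
rewrite exchange_big; apply: eq_bigr => j _ /=; rewrite inner_sumr.
by apply: eq_bigr => i _; rewrite mxE adjE.
Qed.

Lemma mxadj_le T M : 0 <= M -> (forall h, mn (mxapp T h) <= M * mn h) ->
  forall h, mn (mxapp (mxadj T) h) <= M * mn h.
Proof.
move=> M0 TM h; set v := mxapp _ h; apply: le_sqr_cancel.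
  by rewrite mulr_ge0 ?mn_ge0.
have -> : mn v ^+ 2 = nr (mxinner v v) by rewrite mn_sqr nr_real ger0_norm// sqr_ge0.
rewrite {2}/v -mxapp_adj (le_trans (nr_mxinner _ _))// mulrAC.
by rewrite ler_wpM2r ?mn_ge0.
Qed.

(** The crude factor n^2 is harmless: it only enters the existence of some bound, or multiplies
    errors that tend to 0. *)
Lemma mx_entry_bound T M : 0 <= M -> (forall i j x, nr (T i j x) <= M * nr x) ->
  forall h, mn (mxapp T h) <= n%:R ^+ 2 * M * mn h.
Proof.
move=> M0 hM h; apply: le_trans (mn_le_sum _) _.
apply: (@le_trans _ _ (\sum_(i < n) \sum_(j < n) M * mn h)).
  apply: ler_sum => i _; apply: le_trans (ler_nr_sum _ _ _) _.
  apply: ler_sum => j _; apply: le_trans (hM _ _ _) _.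
  by rewrite ler_wpM2l ?mn_coord.
by rewrite !sumr_const !card_ord -mulrnA -[leLHS]mulr_natl natrM -expr2 mulrA.
Qed.

Lemma mx_bound T : exists2 M : R, 0 <= M & forall h, mn (mxapp T h) <= M * mn h.
Proof.
pose M := \sum_i \sum_j opnorm (T i j).
have M0 : 0 <= M by do 2 (apply: sumr_ge0 => ? _); exact: opnorm_ge0.
exists (n%:R ^+ 2 * M); first by rewrite mulr_ge0 ?sqr_ge0.
apply: mx_entry_bound => // i j x; apply: le_trans (nr_bop _ _) _.
rewrite ler_wpM2r ?nr_ge0// /M (bigD1 i)//= (bigD1 j)//= -addrA lerDl.
by rewrite addr_ge0// ?sumr_ge0// => *; rewrite ?sumr_ge0// => *; exact: opnorm_ge0.
Qed.

Lemma mxnorm_le T M : 0 <= M -> (forall h, mn (mxapp T h) <= M * mn h) ->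
  mxnorm T <= M.
Proof.
move=> M0 TM; apply: ge_sup.
  by exists (mn (mxapp T 0)), 0 => //=; rewrite mn_sqr mn0 expr0n /= ler01.
move=> _ [h /= h1 <-]; apply: le_trans (TM h) _; rewrite -[leRHS]mulr1 ler_wpM2l//.
rewrite -(@ler_pXn2r _ 2) ?nnegrE ?mn_ge0// expr1n -lecR -mn_sqr//.
Qed.

Lemma mxnorm_has_ubound T : has_ubound
  [set Num.sqrt (complex.Re (mxinner (mxapp T h) (mxapp T h))) |
    h in [set h | mxinner h h <= 1]].
Proof.
have [M M0 hM] := mx_bound T; exists M => _ [k /= k1 <-].
apply: le_trans (hM k) _; rewrite -[leRHS]mulr1 ler_wpM2l//.
by rewrite -(@ler_pXn2r _ 2) ?nnegrE ?mn_ge0// expr1n -lecR -mn_sqr.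
Qed.

Lemma mxnormP T h : mn (mxapp T h) <= mxnorm T * mn h.
Proof.
have [/mn_eq0 -> | h0] := eqVneq (mn h) 0.
  by have [M _ /(_ 0)] := mx_bound T; rewrite mn0 !mulr0.
have nh0 : 0 < mn h by rewrite lt_neqAle mn_ge0 andbT eq_sym.
rewrite -ler_pdivrMr// mulrC; apply: ub_le_sup (mxnorm_has_ubound T) _ _.
exists ((mn h)^-1%:C%C *: h) => /=.
  rewrite mn_sqr mnZ nr_real gtr0_norm ?invr_gt0// mulVf// expr1n; exact: lexx.
by rewrite -[LHS]/(mn _) mxappZ mnZ nr_real gtr0_norm ?invr_gt0.
Qed.

Lemma mxnorm_ge0 T : 0 <= mxnorm T.
Proof.
apply: le_trans (sqrtr_ge0 _) (ub_le_sup (mxnorm_has_ubound T) _).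
by exists 0 => //=; rewrite mn_sqr mn0 expr0n /= ler01.
Qed.

End OperatorMatrixTheory.

(** * Neumann series and contractivity of *-homomorphisms on matrices *)

(** Defined over any ring, so that the same partial sum lives in the free product, in B and among
    operators, and is transported by homomorphisms. *)
Definition mpsum (A : nzRingType) n (W : 'M[A]_n) N : 'M[A]_n := \sum_(k < N) W ^+ k.

Lemma mpsumS (A : nzRingType) n (W : 'M[A]_n) N : mpsum W N.+1 = mpsum W N + W ^+ N.
Proof. exact: big_ord_recr. Qed.

Lemma mpsum0 (A : nzRingType) n (W : 'M[A]_n) : mpsum W 0 = 0.
Proof. exact: big_ord0. Qed.

Lemma mxexprS (A : nzRingType) n (W : 'M[A]_n) N : W ^+ N.+1 = W *m W ^+ N.
Proof. exact: exprS. Qed.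

Lemma mul_mpsum (A : nzRingType) n (W : 'M[A]_n) N :
  (1%:M - W) *m mpsum W N = 1%:M - W ^+ N.
Proof.
elim: N => [|N IH]; first by rewrite mpsum0 mulmx0 subrr.
by rewrite mpsumS mulmxDr IH mulmxBl mul1mx -mxexprS addrA subrK.
Qed.

Lemma mpsum_mul (A : nzRingType) n (W : 'M[A]_n) N :
  mpsum W N *m (1%:M - W) = 1%:M - W ^+ N.
Proof.
elim: N => [|N IH]; first by rewrite mpsum0 mul0mx subrr.
rewrite mpsumS mulmxDl IH mulmxBr mulmx1 -[W ^+ N *m W]/(W ^+ N * W) -exprSr.
by rewrite addrA subrK.
Qed.

Lemma map_mx_expr (A A' : nzRingType) (f : {rmorphism A -> A'}) n (W : 'M[A]_n) N :
  map_mx f (W ^+ N) = map_mx f W ^+ N.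
Proof. by elim: N => [|N IH]; rewrite ?map_mx1// !mxexprS map_mxM IH. Qed.

Lemma map_mpsum (A A' : nzRingType) (f : {rmorphism A -> A'}) n (W : 'M[A]_n) N :
  map_mx f (mpsum W N) = mpsum (map_mx f W) N.
Proof.
elim: N => [|N IH]; first by rewrite !mpsum0 map_mx0.
by rewrite !mpsumS map_mxD IH map_mx_expr.
Qed.

Lemma mxinvE (A : nzRingType) n (S T : 'M[A]_n) :
  S *m T = 1%:M -> T *m S = 1%:M -> mxinv T = S.
Proof.
move=> ST TS; have [S'T _] : [set S' | S' *m T = 1%:M /\ T *m S' = 1%:M] (mxinv T).
  by apply: xgetPex; exists S.
by rewrite -[mxinv T]mulmx1 -TS mulmxA S'T mul1mx.
Qed.

Section Neumann.
Variables (R : realType) (H : hilbertType R) (n : nat) (W : 'M[bop H H]_n) (r : R).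
Hypothesis r01 : 0 <= r < 1.
Hypothesis Wr : forall h, mn (mxapp W h) <= r * mn h.

Let r0 : 0 <= r. Proof. by case/andP: r01. Qed.
Let r1 : 0 < 1 - r. Proof. by case/andP: r01 => _; rewrite subr_gt0. Qed.

Lemma mn_expr k h : mn (mxapp (W ^+ k) h) <= r ^+ k * mn h.
Proof.
elim: k => [|k IH]; first by rewrite -[W ^+ 0]/(1%:M) mxapp1 mul1r.
rewrite mxexprS mxapp_mul (le_trans (Wr _))// exprS -mulrA ler_wpM2l//.
Qed.

Lemma mn_mpsum_sub N m h :
  mn (mxapp (mpsum W (N + m)) h - mxapp (mpsum W N) h) <=
  (r ^+ N - r ^+ (N + m)) / (1 - r) * mn h.
Proof.
elim: m => [|m IH]; first by rewrite addn0 !subrr mn0 !mul0r.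
rewrite addnS mpsumS mxapp_addl addrAC; apply: le_trans (mnD _ _) _.
apply: le_trans (lerD IH (mn_expr _ _)) _; rewrite -mulrDl ler_wpM2r ?mn_ge0//.
rewrite le_eqVlt; apply/orP; left; apply/eqP.
by rewrite exprS; field; rewrite gt_eqF.
Qed.

Lemma mn_mpsum_dist N M h :
  mn (mxapp (mpsum W N) h - mxapp (mpsum W M) h) <=
  ((1 - r)^-1 * r ^+ N + (1 - r)^-1 * r ^+ M) * mn h.
Proof.
wlog NM : N M / (M <= N)%N.
  move=> wl; have [/wl//|/ltnW/wl] := leqP M N.
  by move=> hMN; rewrite mn_distC [X in X * _]addrC.
rewrite -(subnKC NM); apply: le_trans (mn_mpsum_sub _ _ _) _.
rewrite ler_wpM2r ?mn_ge0// mulrC -mulrDr ler_wpM2l ?invr_ge0 ?(ltW r1)//.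
have := exprn_ge0 (M + (N - M)) r0; lra.
Qed.

(** The limit is taken entry by entry, where [bop_seq_lim] applies. The entrywise rate is kept in
    the statement: it shows that the entries of the inverse stay in B, and it survives compression
    to H. *)
Lemma neumann : exists S : 'M[bop H H]_n, [/\ S *m (1%:M - W) = 1%:M,
  (1%:M - W) *m S = 1%:M &
  forall N i j x, nr (mpsum W N i j x - S i j x) <= (1 - r)^-1 * r ^+ N * nr x].
Proof.
pose C := (1 - r)^-1; have C0 : 0 <= C by rewrite invr_ge0 ltW.
have ex (ij : 'I_n * 'I_n) : exists S : bop H H, forall N x,
    nr (mpsum W N ij.1 ij.2 x - S x) <= C * r ^+ N * nr x.
  apply: bop_seq_lim => // N M x; case: ij => i j /=.
  rewrite -!mxapp_single -(mn_single j x); apply: le_trans (mn_mpsum_dist N M _).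
  exact: (mn_coord (_ - _) i).
have [s hs] := choice ex; pose S : 'M[bop H H]_n := \matrix_(i, j) s (i, j).
have hS N i j x : nr (mpsum W N i j x - S i j x) <= C * r ^+ N * nr x.
  by rewrite mxE; exact: (hs (i, j)).
have SN N h : mn (mxapp S h - mxapp (mpsum W N) h) <= n%:R ^+ 2 * C * r ^+ N * mn h.
  rewrite -mxapp_subl -mulrA -mulrA -mulrA; apply: le_trans (mx_entry_bound _ _ _) _.
  - by apply: mulr_ge0; [exact: C0|exact: (exprn_ge0 N r0)].
  - move=> i j x; rewrite !mxE /= scaleN1r nr_distC; move: (hS N i j x).
    by rewrite mxE.
  - by rewrite !mulrA.
have [M M0 hM] := mx_bound (1%:M - W).
have mn_lim0 (x : 'I_n -> H) D : (forall N, mn x <= D * r ^+ N) -> x = 0.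
  move=> h; apply: mn_eq0; apply/eqP; rewrite eq_le mn_ge0 andbT.
  by apply: (@ler_pow _ r _ _ D r01) => N; rewrite add0r.
exists S; split=> //; apply: mxapp_ext => h; apply/eqP; rewrite -subr_eq0; apply/eqP.
- apply: (mn_lim0 _ (n%:R ^+ 2 * C * (M * mn h) + mn h)) => N.
  rewrite mxapp_mul mxapp1.
  apply: le_trans (mn_dist (mxapp (mpsum W N) (mxapp (1%:M - W) h)) _ _) _.
  rewrite mulrDl; apply: lerD.
    apply: le_trans (SN N _) _; rewrite mulrAC ler_wpM2r ?(exprn_ge0 _ r0)//.
    by rewrite ler_wpM2l// mulr_ge0// sqr_ge0.
  rewrite -mxapp_mul mpsum_mul mxapp_subl mxapp1 addrC addKr mnN mulrC.
  exact: mn_expr.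
- apply: (mn_lim0 _ (M * (n%:R ^+ 2 * C * mn h) + mn h)) => N.
  rewrite mxapp_mul mxapp1.
  apply: le_trans (mn_dist (mxapp (1%:M - W) (mxapp (mpsum W N) h)) _ _) _.
  rewrite mulrDl; apply: lerD.
    rewrite -mxappB; apply: le_trans (hM _) _; rewrite -mulrA ler_wpM2l// mulrAC.
    exact: SN.
  rewrite -mxapp_mul mul_mpsum mxapp_subl mxapp1 addrC addKr mnN mulrC.
  exact: mn_expr.
Qed.

End Neumann.

Section StarHomContractive.
Variables (R : realType) (H K : hilbertType R) (B : cstarSubalg H).
Variable beta : {lrmorphism B -> bop K K}.
Hypothesis betaS : star_preserving beta.

Definition mxscale (A : lmodType R[i]) n (c : R[i]) (T : 'M[A]_n) : 'M[A]_n :=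
  map_mx (fun a => c *: a) T.

Lemma mxapp_scale (L : hilbertType R) n c (T : 'M[bop L L]_n) h :
  mxapp (mxscale c T) h = c *: mxapp T h.
Proof.
apply/funext => i; rewrite /mxapp [RHS](_ : _ = c *: \sum_j T i j (h j))//.
by rewrite scaler_sumr; apply: eq_bigr => j _; rewrite mxE.
Qed.

Lemma map_mxscale (A A' : lmodType R[i]) (f : {linear A -> A'}) n c (T : 'M[A]_n) :
  map_mx f (mxscale c T) = mxscale c (map_mx f T).
Proof. by apply/matrixP => i j; rewrite !mxE linearZ. Qed.

(** Norm closedness of B enters here: the partial sums have entries in B and converge in operator
    norm. An inverse over B, unlike one over all operators, can be mapped by a homomorphism of B. *)
Lemma neumann_cstar n (Z : 'M[B]_n) (r : R) : 0 <= r < 1 ->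
  (forall h, mn (mxapp (map_mx val Z) h) <= r * mn h) ->
  exists S : 'M[B]_n, S *m (1%:M - Z) = 1%:M.
Proof.
move=> r01 Zr; have [S [S1 _ hS]] := neumann r01 Zr.
have SB i j : S i j \in B.
  apply: cstar_closed => e e0.
  have r1 : 0 < (1 - r)^-1 by case/andP: r01 => _; rewrite invr_gt0 subr_gt0.
  have [N hN] := pow_small r01 (divr_gt0 e0 r1).
  exists (mpsum (map_mx val Z) N i j).
    rewrite -(map_mpsum (GRing.RMorphism.clone _ _ (val : B -> _) _)) mxE.
    exact: cstar_valP.
  have r0 : 0 <= r by case/andP: r01.
  apply: le_lt_trans (opnorm_le (M := (1 - r)^-1 * r ^+ N) _ _) _.
  - by rewrite mulr_ge0 ?exprn_ge0// ltW.
  - by move=> x; rewrite /= scaleN1r nr_distC.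
  - by rewrite mulrC -ltr_pdivlMr.
exists (\matrix_(i, j) CstarSort (SB i j)).
have inj (P Q : 'M[B]_n) : map_mx val P = map_mx val Q -> P = Q.
  move=> /matrixP e; apply/matrixP => i j; apply: val_inj.
  by have := e i j; rewrite !mxE.
apply: inj; rewrite (map_mxM (GRing.RMorphism.clone _ _ (val : B -> _) _)).
rewrite map_mxB !map_mx1; rewrite -[RHS]S1; congr (_ *m _).
by apply/matrixP => i j; rewrite !mxE.
Qed.

Definition mxstar n (X : 'M[B]_n) : 'M[B]_n := \matrix_(i, j) star (X j i).

(* If the norm of the image exceeded that of X, then 1 - X^*X/l would be
   invertible for l the squared norm of the image, although l is an approximate
   eigenvalue of the image of X^*X. *)
Lemma star_hom_contractive n (X : 'M[B]_n) h :
  mn (mxapp (map_mx beta X) h) <= mxnorm (map_mx val X) * mn h.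
Proof.
set T := map_mx beta X; set nu := mxnorm _.
apply: le_trans (mxnormP T h) _; rewrite ler_wpM2r ?mn_ge0//.
rewrite leNgt; apply/negP => nuT; set l := mxnorm T in nuT.
have nu0 : 0 <= nu := mxnorm_ge0 _.
have l0 : 0 < l := le_lt_trans nu0 nuT.
(* With this scaling c X^* X has norm at most (nu / l)^2 < 1 over B, so 1 - c X^* X is invertible
   there. *)
pose c : R[i] := ((l ^+ 2)^-1)%:C%C.
have nrc : nr c = (l ^+ 2)^-1 by rewrite nr_real ger0_norm// invr_ge0 sqr_ge0.
have r01 : 0 <= nu ^+ 2 / l ^+ 2 < 1.
  rewrite divr_ge0 ?sqr_ge0//= ltr_pdivrMr ?exprn_gt0// mul1r.
  by rewrite ltr_pXn2r ?nnegrE// ltW.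
pose Y := mxstar X *m X.
have valY : map_mx val Y = mxadj (map_mx val X) *m map_mx val X.
  rewrite /Y (map_mxM (GRing.RMorphism.clone _ _ (val : B -> _) _)); congr (_ *m _).
  by apply/matrixP => i j; rewrite !mxE.
have betaY : map_mx beta Y = mxadj T *m T.
  rewrite /Y map_mxM; congr (_ *m _).
  apply/matrixP => i j; rewrite !mxE; exact: betaS.
have [k|S S1] := neumann_cstar (Z := mxscale c Y) r01.
  rewrite (map_mxscale (GRing.Linear.clone _ _ _ _ (val : B -> _) _)) mxapp_scale.
  rewrite mnZ nrc valY mxapp_mul [_ / _]mulrC -mulrA.
  rewrite ler_wpM2l ?invr_ge0 ?sqr_ge0// expr2 -mulrA.
  apply: le_trans (mxadj_le nu0 (mxnormP _) _) _.
  by rewrite ler_wpM2l//; exact: mxnormP.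
have [M M0 hM] := mx_bound (map_mx beta S).
(* The image under [beta] of the inverse over B bounds 1 - c T^* T from below by 1/M. *)
have key (k : 'I_n -> K) : mn k <= M * mn (k - c *: mxapp (mxadj T *m T) k).
  have : mxapp (map_mx beta (S *m (1%:M - mxscale c Y))) k = k.
    by rewrite S1 map_mx1 mxapp1.
  have -> : map_mx beta (S *m (1%:M - mxscale c Y)) =
      map_mx beta S *m (1%:M - mxscale c (mxadj T *m T)).
    by rewrite map_mxM map_mxB map_mx1 map_mxscale betaY.
  move=> e; rewrite mxapp_mul mxapp_subl mxapp1 mxapp_scale in e.
  rewrite -{1}e; exact: hM.
(* Expanding the square gives |k|^2 - 2c |T k|^2 + c^2 |T^* T k|^2, and the last term is at most c
   |T k|^2 because T^* has bound l and c = 1 / l^2. *)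
have est (k : 'I_n -> K) : mn (k - c *: mxapp (mxadj T *m T) k) ^+ 2 <=
    mn k ^+ 2 - mn (mxapp T k) ^+ 2 / l ^+ 2.
  set v := mxapp (mxadj T *m T) k.
  have vT : mn v <= l * mn (mxapp T k).
    by rewrite /v mxapp_mul; exact: (mxadj_le (ltW l0) (mxnormP T)).
  have vk : mxinner v k = (mn (mxapp T k) ^+ 2)%:C%C.
    by rewrite /v mxapp_mul mxinnerC -mxapp_adj mn_sqr conj_realC.
  have kv : mxinner k v = (mn (mxapp T k) ^+ 2)%:C%C by rewrite mxinnerC vk conj_realC.
  rewrite -Re_mxinner mxinnerBl !mxinnerBr !mxinnerZl !mxinnerZr vk kv !mn_sqr.
  rewrite conj_realC -!rmorphM -!rmorphB /=.
  set a := mn (mxapp T k); have v2 : mn v ^+ 2 <= l ^+ 2 * a ^+ 2.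
    by rewrite -exprMn ler_pXn2r ?nnegrE ?mn_ge0 ?mulr_ge0 ?mn_ge0 ?(ltW l0).
  have d0 : 0 < (l ^+ 2)^-1 by rewrite invr_gt0 exprn_gt0.
  have : (l ^+ 2)^-1 * ((l ^+ 2)^-1 * mn v ^+ 2) <= (l ^+ 2)^-1 * a ^+ 2.
    rewrite ler_pM2l// mulrC ler_pdivrMr ?exprn_gt0// mulrC//.
  lra.
(* Combining the two estimates bounds |T k|^2 by l^2 (1 - 1/M1) |k|^2, which is incompatible with l
   being the norm of T. Adding 1 keeps M1 positive and 1 - 1/M1 nonnegative. *)
pose M1 := M ^+ 2 + 1.
have M10 : 0 < M1 by rewrite /M1 ltr_wpDl ?sqr_ge0.
have bnd (k : 'I_n -> K) : mn (mxapp T k) ^+ 2 <= l ^+ 2 * (1 - M1^-1) * mn k ^+ 2.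
  have h1 : mn k ^+ 2 <= M ^+ 2 * (mn k ^+ 2 - mn (mxapp T k) ^+ 2 / l ^+ 2).
    apply: le_trans (ler_wpM2l (sqr_ge0 M) (est k)); rewrite -exprMn.
    by rewrite ler_pXn2r ?nnegrE ?mn_ge0 ?mulr_ge0 ?mn_ge0//; exact: key.
  set a := mn (mxapp T k) ^+ 2 in h1 *; set b := mn k ^+ 2 in h1 *.
  have ab : 0 <= b - a / l ^+ 2.
    by apply: le_trans (est k); rewrite sqr_ge0.
  have h2 : b <= M1 * (b - a / l ^+ 2) by rewrite /M1 mulrDl mul1r; lra.
  have h3 : b / M1 <= b - a / l ^+ 2 by rewrite ler_pdivrMr// mulrC.
  have h4 : a / l ^+ 2 <= (1 - M1^-1) * b by lra.
  by rewrite -mulrA mulrC -ler_pdivrMr ?exprn_gt0.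
have q0 : 0 <= 1 - M1^-1.
  by rewrite subr_ge0 invf_le1// /M1 lerDr sqr_ge0.
have : l <= l * Num.sqrt (1 - M1^-1).
  apply: mxnorm_le; first by rewrite mulr_ge0 ?sqrtr_ge0// ltW.
  move=> k; rewrite -(@ler_pXn2r _ 2) ?nnegrE ?mn_ge0 ?mulr_ge0 ?mn_ge0 ?sqrtr_ge0 ?(ltW l0)//.
  by rewrite !exprMn (sqr_sqrtr q0).
rewrite -{1}[l]mulr1 ler_pM2l// leNgt => /negP; apply.
rewrite -[ltRHS]sqrtr1 ltr_sqrt// ltrBlDr ltrDl invr_gt0//.
Qed.

End StarHomContractive.

(** * Herglotz functions *)

Lemma inner_injl (R : realType) (H : hilbertType R) (x y : H) :
  (forall z, inner x z = inner y z) -> x = y.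
Proof. by move=> h; apply: inner_injr => z; rewrite innerC h -innerC. Qed.

Lemma adjEr (R : realType) (H K : hilbertType R) (T : bop H K) x y :
  inner (adj T y) x = inner y (T x).
Proof. by rewrite innerC -adjE -innerC. Qed.

Lemma unitary_nr (R : realType) (H : hilbertType R) (U : bop H H) x :
  unitary U -> nr (U x) = nr x.
Proof.
move=> [U1 _]; apply: (@pexpIrn _ 2) => //; rewrite ?nnegrE ?nr_ge0//.
apply: (@complexI R); rewrite -!inner_nr adjE.
by rewrite -[adj U (U x)]/((star U * U) x) U1.
Qed.

(** Polarization over the complex numbers, at z + w and z + i w. *)
Lemma inner_diag0 (R : realType) (H : hilbertType R) (T : bop H H) :
  (forall x, inner (T x) x = 0) -> T = 0.
Proof.
move=> h; apply: bopP => z; apply: inner_injl => w; rewrite inner0l.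
have := h (z + w); have := h (z + 'i%C *: w).
rewrite !linearD !linearZ !innerDl !innerDr !innerZl !innerZr !h !mulr0 !addr0 !add0r.
case: (inner (T z) w) => a b; case: (inner (T w) z) => c d.
move=> /eqP; rewrite eq_complex /= => /andP[/eqP h1 /eqP h2].
move=> /eqP; rewrite eq_complex /= => /andP[/eqP h3 /eqP h4].
by apply/eqP; rewrite eq_complex /=; apply/andP; split; apply/eqP; lra.
Qed.

Section Compression.
Variables (R : realType) (H K : hilbertType R) (V : bop H K).

Fact compress_linear : linear (compress V).
Proof. by move=> c S T; apply: bopP => x /=; rewrite linearP. Qed.
HB.instance Definition _ :=
  GRing.isLinear.Build R[i] (bop K K) (bop H H) *:%R (compress V) compress_linear.

Lemma inner_compress T x y : inner (compress V T x) y = inner (T (V x)) (V y).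
Proof. by rewrite /= adjEr. Qed.

Lemma mxinner_compress n (T : 'M[bop K K]_n) h k :
  mxinner (mxapp (map_mx (compress V) T) h) k =
  mxinner (mxapp T (fun i => V (h i))) (fun i => V (k i)).
Proof.
rewrite /mxinner; apply: eq_bigr => i _; rewrite /mxapp !inner_suml.
by apply: eq_bigr => j _; rewrite mxE inner_compress.
Qed.

Lemma mxscal_mulE (A : starAlgType R) m n p (G : 'M[R[i]]_(m, n)) (T : 'M[A]_(n, p)) i j :
  (mxscal A G *m T) i j = \sum_k G i k *: T k j.
Proof. by rewrite mxE; apply: eq_bigr => k _; rewrite mxE -scalerAl mul1r. Qed.

Lemma mul_mxscalE (A : starAlgType R) m n p (G : 'M[R[i]]_(n, p)) (T : 'M[A]_(m, n)) i j :
  (T *m mxscal A G) i j = \sum_k G k j *: T i k.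
Proof. by rewrite mxE; apply: eq_bigr => k _; rewrite mxE -scalerAr mulr1. Qed.

Lemma compress_mxscal m n p (G : 'M[R[i]]_(m, n)) (T : 'M[bop K K]_(n, p)) :
  map_mx (compress V) (mxscal _ G *m T) = mxscal _ G *m map_mx (compress V) T.
Proof.
apply/matrixP => i j; rewrite mxE !mxscal_mulE linear_sum; apply: eq_bigr => k _.
by rewrite linearZ mxE.
Qed.

Lemma compress_mul_mxscal m n p (G : 'M[R[i]]_(n, p)) (T : 'M[bop K K]_(m, n)) :
  map_mx (compress V) (T *m mxscal _ G) = map_mx (compress V) T *m mxscal _ G.
Proof.
apply/matrixP => i j; rewrite mxE !mul_mxscalE linear_sum; apply: eq_bigr => k _.
by rewrite linearZ mxE.
Qed.

Hypothesis Viso : forall h, `|V h| = `|h|.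

Lemma compress1 : compress V 1 = 1.
Proof.
apply/eqP; rewrite -subr_eq0; apply/eqP; apply: inner_diag0 => x.
rewrite /= scaleN1r innerDl innerNl adjEr !inner_norm Viso subrr //.
Qed.

End Compression.

Lemma mxpsd_mxRe (R : realType) (H : hilbertType R) n (T : 'M[bop H H]_n) :
  (forall h, 0 <= complex.Re (mxinner (mxapp T h) h)) -> mxpsd (mxRe T).
Proof.
move=> h0 h; rewrite -[mxRe T]/(mxscale 2^-1 (T + mxadj T)) mxapp_scale mxinnerZl.
rewrite mxapp_addl mxinnerDl.
have -> : mxinner (mxapp (mxadj T) h) h = (mxinner (mxapp T h) h)^*.
  by rewrite mxinnerC -mxapp_adj.
have -> z : z + z^* = (2 * complex.Re z)%:C%C :> R[i].
  by case: z => a b; apply/eqP; rewrite eq_complex /= subrr eqxx andbT mulr_natl mulr2n.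
by rewrite mulr_ge0 ?invr_ge0 ?ler0n// ler0c mulr_ge0.
Qed.

Section Herglotz.
Variables (R : realType) (H K : hilbertType R) (B : cstarSubalg H).
Variables (V : bop H K) (U : bop K K) (alpha : {lrmorphism B -> bop K K}).
Hypothesis Viso : forall h, `|V h| = `|h|.
Hypothesis Uunit : unitary U.
Hypothesis alphaS : star_preserving alpha.

Definition hmx n (X : 'M[B]_n) : 'M[bop K K]_n := U%:M *m map_mx alpha X.

Lemma mn_scalar_mx n h : mn (mxapp (U%:M : 'M[bop K K]_n) h) = mn h.
Proof.
rewrite /mn /mxinner; congr (Num.sqrt (complex.Re _)); apply: eq_bigr => i _.
rewrite !inner_nr /mxapp (bigD1 i)//= mxE eqxx mulr1n big1 ?addr0.
  by rewrite unitary_nr.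
by move=> j ij; rewrite mxE eq_sym (negPf ij).
Qed.

Lemma cball_norm01 n (X : cball B n) : 0 <= mxnorm (map_mx val X) < 1.
Proof. by rewrite mxnorm_ge0 cball_lt1. Qed.

Lemma hmx_le n (X : 'M[B]_n) h : mn (mxapp (hmx X) h) <= mxnorm (map_mx val X) * mn h.
Proof. by rewrite mxapp_mul mn_scalar_mx star_hom_contractive. Qed.

Lemma hmx_resolvent n (X : cball B n) : exists S : 'M[bop K K]_n,
  [/\ S *m (1%:M - hmx X) = 1%:M, (1%:M - hmx X) *m S = 1%:M,
   herglotz_mx V alpha U X = map_mx (compress V) ((1%:M + hmx X) *m S) &
   forall N i j x, nr (mpsum (hmx X) N i j x - S i j x) <=
     (1 - mxnorm (map_mx val X))^-1 * mxnorm (map_mx val X) ^+ N * nr x].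
Proof.
have [S [S1 S2 hS]] := neumann (cball_norm01 X) (hmx_le X).
by exists S; split=> //; rewrite /herglotz_mx -/(hmx X) (mxinvE S1 S2).
Qed.

(** Writing 1 + W = 2 - (1 - W) shows that the Cayley transform is twice the resolvent minus 1; this
    is the origin of the approximants of g. *)
Lemma cayley_resolvent n (W S : 'M[bop K K]_n) : (1%:M - W) *m S = 1%:M ->
  (1%:M + W) *m S = S + S - 1%:M.
Proof.
move=> h; rewrite -[in RHS]h mulmxDl mulmxBl mul1mx opprB addrACA -addrA.
by rewrite subrr addr0.
Qed.

(** A scalar matrix commutes with U (x) 1 and is preserved by the unital linear map alpha. Hence G
    intertwines the matrices W of X and Y, therefore their resolvents, and the compression commutes
    with scalar matrices. *)
Lemma herglotz_free n m (G : 'M[R[i]]_(m, n)) (X : cball B n) (Y : cball B m) :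
  mxscal B G *m X = Y *m mxscal B G ->
  mxscal (bop H H) G *m herglotz_mx V alpha U X =
  herglotz_mx V alpha U Y *m mxscal (bop H H) G.
Proof.
move=> XY; have [S [S1 S2 -> _]] := hmx_resolvent X.
have [T [T1 T2 -> _]] := hmx_resolvent Y.
pose g := mxscal (bop K K) G.
have ag : map_mx alpha (mxscal B G) = g.
  by apply/matrixP => i j; rewrite !mxE linearZ rmorph1.
have Ug : g *m U%:M = U%:M *m g.
  apply/matrixP => i j; rewrite mxscal_mulE mul_mxscalE (bigD1 j)//= mxE eqxx.
  rewrite big1 => [|k kj]; last by rewrite mxE (negPf kj) scaler0.
  rewrite (bigD1 i)//= mxE eqxx big1 // => k ki.
  by rewrite mxE eq_sym (negPf ki) scaler0.
have hg : g *m hmx X = hmx Y *m g.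
  rewrite /hmx mulmxA Ug -!mulmxA; congr (_ *m _).
  by rewrite -ag -!map_mxM XY.
have gT : g *m S = T *m g.
  rewrite -[LHS]mul1mx -T1 -mulmxA [_ *m (g *m S)]mulmxA mulmxBl mul1mx -hg.
  by rewrite -{1}[g]mulmx1 -mulmxBr -mulmxA S2 mulmx1.
rewrite -compress_mxscal -compress_mul_mxscal; congr map_mx.
by rewrite mulmxA mulmxDr mulmx1 hg -{1}[mxscal _ G]mul1mx -mulmxDl -!mulmxA gT.
Qed.

(** With v = (1 - W)^-1 k, the real part of <(1 + W) v, (1 - W) v> is |v|^2 - |W v|^2, nonnegative
    because W is a contraction. *)
Lemma herglotz_RHP n (X : cball B n) : mxpsd (mxRe (herglotz_mx V alpha U X)).
Proof.
have [S [S1 S2 -> _]] := hmx_resolvent X.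
apply: mxpsd_mxRe => h; rewrite mxinner_compress; set k := fun i => V (h i).
set W := hmx X in S1 S2 *; pose v := mxapp S k.
have kE : k = mxapp (1%:M - W) v by rewrite -mxapp_mul S2 mxapp1.
rewrite mxapp_mul -/v {1}kE mxapp_addl mxapp_subl mxapp1 mxinnerDl !mxinnerBr.
rewrite (mxinnerC v (mxapp W v)) !mn_sqr !ReD !ReN ReJ /=.
have Wv : mn (mxapp W v) <= mn v.
  apply: le_trans (hmx_le X v) _; case/andP: (cball_norm01 X) => _ r1.
  exact: ler_piMl (mn_ge0 v) (ltW r1).
by have := mn_ge0 (mxapp W v); have := mn_ge0 v; nra.
Qed.

Lemma herglotz0 n (X : cball B n) : cball_mx X = 0 -> herglotz_mx V alpha U X = 1%:M.
Proof.
move=> X0; have [S [S1 S2 -> _]] := hmx_resolvent X.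
move: S1 S2; have -> : hmx X = 0 by rewrite /hmx X0 map_mx0 mulmx0.
rewrite subr0 mulmx1 mul1mx => -> _; rewrite addr0 mul1mx.
by apply/matrixP => i j; rewrite !mxE; case: eqP => _; rewrite ?compress1// linear0.
Qed.

Lemma rep_herglotz_herglotz :
  rep_herglotz B (fun n (X : cball B n) => herglotz_mx V alpha U X).
Proof.
split.
- by move=> n m G X Y; exact: herglotz_free.
- by move=> n X; exact: herglotz_RHP.
- by move=> n X; exact: herglotz0.
- by exists K, V, U, alpha.
Qed.

(** The matrix W is a unitary times a contractive image of X, and compression by an isometry does
    not increase norms. So the right side sees neither K nor V, U or alpha; the factor 2 is that of
    the Cayley transform. *)
Lemma herglotz_apx n (X : cball B n) N i j x :
  nr (herglotz_mx V alpha U X i j x -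
    ((compress V (mpsum (hmx X) N i j) x) *+ 2 - (1%:M : 'M[bop H H]_n) i j x)) <=
  2 * (1 - mxnorm (map_mx val X))^-1 * mxnorm (map_mx val X) ^+ N * nr x.
Proof.
have [S [S1 S2 -> hS]] := hmx_resolvent X.
have V1 y : nr (adj V y) <= nr y.
  apply: le_sqr_cancel; first exact: nr_ge0.
  have -> : nr (adj V y) ^+ 2 = nr (inner (adj V y) (adj V y)).
    by rewrite inner_nr nr_real ger0_norm// sqr_ge0.
  by rewrite adjEr (le_trans (nr_inner _ _))// /(nr (V _)) Viso.
set M := mpsum _ _.
have -> : map_mx (compress V) ((1%:M + hmx X) *m S) i j x =
    compress V (S i j) x *+ 2 - (1%:M : 'M[bop H H]_n) i j x.
  rewrite (cayley_resolvent S2) !mxE linearB linearD -mulr2n.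
  case: eqP => _; rewrite ?mulr1n ?mulr0n ?compress1 ?linear0
     /= ?scaleN1r ?scaler0 ?subr0 ?addr0.
    by rewrite mulr2n; congr (_ - _); rewrite -[LHS]/(compress V 1 x) compress1.
  by [].
rewrite opprB addrA subrK -mulrnBl -[X in X - _]/(adj V (S i j (V x))).
rewrite -[X in _ - X]/(adj V (M i j (V x))) -linearB mulr2n.
apply: le_trans (ler_nrD _ _) _; rewrite -mulr2n -[leLHS]mulr_natl -!mulrA ler_wpM2l//.
apply: le_trans (V1 _) _; rewrite nr_distC mulrA.
by apply: le_trans (hS N i j (V x)) _; rewrite {1}/nr Viso.
Qed.

End Herglotz.

(** * The function g of an operator-valued state *)

Section GFun.
Variables (R : realType) (H : hilbertType R) (B : cstarSubalg H).
Variables (N : AB B -> R) (phi : AB B -> bop H H).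
Hypothesis phiS : opstate N phi.

Lemma gns_emb_iso (G : gns phi) h : `|gns_emb G h| = `|h|.
Proof.
apply: (@pexpIrn _ 2) => //; rewrite ?nnegrE ?normr_ge0// -!inner_norm gns_embE.
by rewrite gns_inner star1 mulr1; case: phiS => _ -> _ _.
Qed.

Lemma gns_compress (G : gns phi) a : compress (gns_emb G) (gns_rep G a) = phi a.
Proof.
apply: bopP => h; apply: inner_injl => k; rewrite inner_compress !gns_embE gns_repE.
by rewrite gns_inner star1 mulr1 mul1r.
Qed.

(** [gfun] is selected by [xget]; the existence of a GNS space rules out its default value 0. *)
Lemma gfunE : exists G : gns phi, gfun B phi = fun n (X : cball B n) =>
  herglotz_mx (gns_emb G) (gns_rep G \o @fp_in R B) (gns_rep G (fp_u B)) X.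
Proof.
have [G] := gns_exists phiS.
by have := @xgetPex _ (fun _ _ => 0) [set g | exists G : gns phi,
    g = fun n (X : cball B n) => herglotz_mx (gns_emb G)
      (fun b => gns_rep G (fp_in b)) (gns_rep G (fp_u B)) X]; apply; eexists; exists G.
Qed.

Lemma gns_rep_fp_in_star (G : gns phi) : star_preserving (gns_rep G \o @fp_in R B).
Proof. by move=> b; rewrite /= fp_in_star gns_rep_star. Qed.

Lemma gns_rep_unitary (G : gns phi) : unitary (gns_rep G (fp_u B)).
Proof.
have [h1 h2] := fp_u_unitary B.
by split; rewrite -gns_rep_star -rmorphM ?h1 ?h2 rmorph1.
Qed.

Lemma gfun_rep_herglotz : rep_herglotz B (gfun B phi).
Proof.
have [G ->] := gfunE; apply: rep_herglotz_herglotz.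
- exact: gns_emb_iso.
- exact: gns_rep_unitary.
- exact: gns_rep_fp_in_star.
Qed.

(** The entries of its k-th power are sums of words u b_1 ... u b_k, and the GNS representation maps
    it to the matrix W of [hmx]. *)
Definition wordmx n (X : 'M[B]_n) : 'M[AB B]_n := (fp_u B)%:M *m map_mx (@fp_in R B) X.

(** The compression of pi_phi to H is phi, so the approximant no longer mentions the GNS space.
    Noninjectivity and compactness both reach g through this estimate. *)
Lemma gfun_apx n (X : cball B n) k i j x :
  nr (gfun B phi n X i j x -
    (phi (mpsum (wordmx X) k i j) x *+ 2 - (1%:M : 'M[bop H H]_n) i j x)) <=
  2 * (1 - mxnorm (map_mx val X))^-1 * mxnorm (map_mx val X) ^+ k * nr x.
Proof.
have [G ->] := gfunE.
have := @herglotz_apx _ _ _ _ (gns_emb G) (gns_rep G (fp_u B)) (gns_rep G \o @fp_in R B)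
  (@gns_emb_iso G) (gns_rep_unitary G) (@gns_rep_fp_in_star G) n X k i j x.
have -> : hmx (gns_rep G (fp_u B)) (gns_rep G \o @fp_in R B) X =
    map_mx (gns_rep G) (wordmx X).
  rewrite map_mxM map_scalar_mx; congr (_ *m _).
  by apply/matrixP => ? ?; rewrite !mxE.
have -> : compress (gns_emb G) (mpsum (map_mx (gns_rep G) (wordmx X)) k i j) =
    phi (mpsum (wordmx X) k i j) by rewrite -map_mpsum mxE; exact: gns_compress.
by [].
Qed.

End GFun.

(** * Finiteness of the universal norm, and states obtained from representations *)

Section UniversalNorm.
Variables (R : realType) (H : hilbertType R) (B : cstarSubalg H).

Lemma nr_adj_le (K L : hilbertType R) (T : bop K L) M : 0 <= M ->
  (forall x, nr (T x) <= M * nr x) -> forall y, nr (adj T y) <= M * nr y.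
Proof.
move=> M0 h y; apply: le_sqr_cancel; first by rewrite mulr_ge0 ?nr_ge0.
have -> : nr (adj T y) ^+ 2 = nr (inner (adj T y) (adj T y)).
  by rewrite inner_nr nr_real ger0_norm// sqr_ge0.
rewrite adjEr (le_trans (nr_inner _ _))// mulrC mulrAC ler_wpM2r ?nr_ge0//.
Qed.

(** Makes the supremum defining [univ_norm] a genuine one. By induction on terms: elements of B are
    bounded by contractivity on 1 x 1 matrices, u is an isometry, and each operation combines bounds
    that do not depend on the representation. *)
Lemma rep_bounded (a : AB B) : exists2 C : R, 0 <= C &
  forall (K : hilbertType R) (p : {lrmorphism AB B -> bop K K}), star_preserving p ->
    forall x, nr (p a x) <= C * nr x.
Proof.
elim/fp_ind: a.
elim=> [b||s [C C0 hC] t [D D0 hD]|c s [C C0 hC]|s [C C0 hC] t [D D0 hD]|s [C C0 hC]].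
- exists (mxnorm (map_mx val (b%:M : 'M[B]_1))); first exact: mxnorm_ge0.
  move=> K p pS x.
  have betaS : star_preserving (p \o @fp_in R B).
    by move=> c; rewrite /= fp_in_star pS.
  have := star_hom_contractive betaS (b%:M : 'M[B]_1) (single ord0 x).
  rewrite mn_single => /(le_trans (mn_coord _ ord0)).
  by rewrite mxapp_single !mxE eqxx mulr1n.
- exists 1 => // K p pS x; rewrite mul1r -[fp_pi _]/(fp_u B) unitary_nr//.
  have [h1 h2] := fp_u_unitary B.
  by split; rewrite -pS -rmorphM ?h1 ?h2 rmorph1.
- exists (C + D) => [|K p pS x]; first exact: addr_ge0.
  rewrite -fp_addE -[fp_add _ _]/((fp_pi s : AB B) + fp_pi t) rmorphD mulrDl.
  by apply: le_trans (ler_nrD _ _) _; rewrite lerD ?hC ?hD.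
- exists (nr c * C) => [|K p pS x]; first by rewrite mulr_ge0 ?nr_ge0.
  rewrite -fp_scaleE -[fp_scale _ _]/(c *: (fp_pi s : AB B)) linearZ.
  rewrite -[X in nr X]/(c *: p (fp_pi s) x) nrZ -mulrA ler_wpM2l ?nr_ge0//.
  exact: hC.
- exists (C * D) => [|K p pS x]; first exact: mulr_ge0.
  rewrite -fp_mulE -[fp_mul _ _]/((fp_pi s : AB B) * fp_pi t) rmorphM.
  rewrite -[X in nr X]/(p (fp_pi s) (p (fp_pi t) x)).
  by apply: le_trans (hC _ _ pS _) _; rewrite -mulrA ler_wpM2l// hD.
- exists C => // K p pS x.
  rewrite -fp_starE -[fp_star _]/(star (fp_pi s : AB B)) pS.
  by apply: nr_adj_le => // y; exact: hC.
Qed.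

Lemma opnorm_le_univ_norm (K : hilbertType R) (p : {lrmorphism AB B -> bop K K}) a :
  star_preserving p -> opnorm (p a) <= univ_norm a.
Proof.
move=> pS; apply: ub_le_sup; last by exists K, p.
have [C C0 hC] := rep_bounded a; exists C => _ [L [q [qS ->]]].
by apply: opnorm_le => // x; exact: hC.
Qed.

(** All the positivity conditions are of the form <p(c) v, v> with v the sum of the p(a_i) V h_i.
    For c = 1 this is |v|^2; for the third condition it says that |p(b) v|^2 is at most the
    universal norm of b^* b times |v|^2. *)
Lemma opstate_compress (K : hilbertType R) (p : {lrmorphism AB B -> bop K K})
    (V : bop H K) : star_preserving p -> (forall h, `|V h| = `|h|) ->
  opstate (@univ_norm R (AB B)) (fun a => compress V (p a)).
Proof.
move=> pS Viso.
have sumE n (a : 'I_n -> AB B) (h : 'I_n -> H) (c : AB B) :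
    \sum_i \sum_j inner (compress V (p (star (a j) * c * a i)) (h i)) (h j) =
    inner (p c (\sum_i p (a i) (V (h i)))) (\sum_i p (a i) (V (h i))).
  rewrite linear_sum inner_suml; apply: eq_bigr => i _; rewrite inner_sumr.
  apply: eq_bigr => j _; rewrite inner_compress.
  have -> : p (star (a j) * c * a i) = adj (p (a j)) * p c * p (a i).
    by rewrite -[adj _]pS -!rmorphM.
  by rewrite -[LHS]/(inner (adj (p (a j)) (p c (p (a i) (V (h i))))) _) adjEr.
split.
- by move=> c a b; rewrite !linearP.
- by rewrite rmorph1 compress1.
- move=> n a h; under eq_bigr do under eq_bigr do rewrite -[star _]mulr1.
  by rewrite sumE rmorph1 inner_norm exprn_ge0.
- move=> n a b h; rewrite sumE; set v := \sum_i _; set M := univ_norm _.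
  have -> : p (M%:C%C%:A - star b * b) = M%:C%C *: 1 - adj (p b) * p b.
    by rewrite -[adj _]pS -rmorphM -(rmorph1 p) -linearZ -linearB.
  rewrite -[X in inner X _]/(M%:C%C *: v + (-1) *: adj (p b) (p b v)).
  rewrite scaleN1r innerDl innerNl innerZl adjEr !inner_nr -rmorphM -rmorphB ler0c subr_ge0.
  have : nr (p b v) ^+ 2 = nr (inner (p (star b * b) v) v).
    have -> : p (star b * b) = adj (p b) * p b by rewrite -[adj _]pS -rmorphM.
    rewrite -[X in inner X _]/(adj (p b) (p b v)) adjEr inner_nr nr_real.
    by rewrite ger0_norm// sqr_ge0.
  move=> ->; apply: le_trans (nr_inner _ _) _; rewrite expr2 mulrA ler_wpM2r ?nr_ge0//.
  apply: le_trans (nr_bop _ _) _; rewrite ler_wpM2r ?nr_ge0//.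
  exact: opnorm_le_univ_norm.
Qed.

End UniversalNorm.

(** * Noninjectivity *)

(** The factor makes the form block diagonal along the fibres of g, so positivity may be checked on
    one fibre at a time. *)
Lemma delta_psd (R : realType) (T I : eqType) (g : T -> I) (F : T -> T -> R[i]) (s : seq T) :
  (forall n (t : seq T), {in t, forall i, g i = n} ->
    0 <= \sum_(i <- t) \sum_(j <- t) F i j) ->
  0 <= \sum_(i <- s) \sum_(j <- s) (g i == g j)%:R * F i j.
Proof.
move=> F0; pose t n := [seq i <- s | g i == n].
have -> : \sum_(i <- s) \sum_(j <- s) (g i == g j)%:R * F i j =
    \sum_(n <- undup (map g s)) \sum_(i <- t n) \sum_(j <- t n) F i j.
  under [RHS]eq_bigr do rewrite /t big_filter.
  rewrite [RHS](exchange_big_dep predT)//=; apply: eq_big_seq => i si.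
  under [RHS]eq_bigl do rewrite eq_sym.
  rewrite -[RHS]big_filter (@filter_pred1_uniq _ _ (g i)) ?undup_uniq ?mem_undup ?map_f//.
  rewrite big_seq1.
  rewrite /t big_filter [RHS]big_mkcond; apply: eq_bigr => j _.
  by rewrite eq_sym; case: eqP => _; rewrite ?mul1r ?mul0r.
apply: sumr_ge0 => n _; apply: (F0 n) => i.
by rewrite mem_filter => /andP[/eqP].
Qed.

(** * Positivity of Schur products with Gram matrices *)

Section SchurProduct.
Variables (R : realType) (H : hilbertType R).

(** Gram-Schmidt, where a vector with zero residual contributes no new element. Requiring the
    expansion on [es] as well carries the use of orthonormality through the induction. *)
Lemma orthonormal_expansion (s : seq H) : exists es : seq H,
  forall x, x \in s ++ es -> x = \sum_(e <- es) inner x e *: e.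
Proof.
elim: s => [|z s [es IH]]; first by exists [::].
pose y := z - \sum_(e <- es) inner z e *: e.
have y_orth x : x \in s ++ es -> inner y x = 0.
  move=> xs; rewrite innerDl innerNl inner_suml; apply/eqP; rewrite subr_eq0; apply/eqP.
  rewrite {1}(IH x xs) inner_sumr; apply: eq_bigr => e _.
  by rewrite innerZr innerZl mulrC -innerC.
have zE : z = y + \sum_(e <- es) inner z e *: e by rewrite subrK.
have [y0|yn0] := eqVneq y 0.
  exists es => x; rewrite cat_cons in_cons => /orP[/eqP ->|/IH//].
  by rewrite {1}zE y0 add0r.
have ny0 : nr y != 0 by rewrite nr_eq0.
pose a : R[i] := ((nr y)^-1)%:C%C; pose e0 := a *: y.
have aa : a * a * inner y y = 1.
  rewrite inner_nr -!rmorphM /= (_ : _ * _ = 1) //; field; exact: ny0.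
have e0_orth x : x \in s ++ es -> inner x e0 = 0.
  by move=> xs; rewrite innerZr innerC y_orth// rmorph0 mulr0.
have zy : inner z y = inner y y.
  rewrite {1}zE innerDl inner_suml big_seq big1 ?addr0// => e es_e.
  by rewrite innerZl [inner e y]innerC y_orth ?mem_cat ?es_e ?orbT// rmorph0 mulr0.
exists (e0 :: es) => x.
have -> : (x \in (z :: s) ++ e0 :: es) = [|| x == z, x == e0 | x \in s ++ es].
  by rewrite !(mem_cat, in_cons); do !case: (_ == _) => //=; do !case: (_ \in _).
rewrite big_cons => /or3P[/eqP ->|/eqP ->|xs].
- by rewrite {2}/e0 innerZr conj_realC zy scalerA mulrAC aa scale1r.
- rewrite big_seq big1 => [|e es_e].
    by rewrite addr0 innerZl innerZr conj_realC mulrA aa scale1r.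
  by rewrite innerZl y_orth ?mem_cat ?es_e ?orbT// mulr0 scale0r.
- by rewrite e0_orth// scale0r add0r -IH.
Qed.

(** The Schur product theorem: expanding the x i in an orthonormal system writes their Gram matrix
    as a sum of rank-one matrices, and the hypothesis applies to each. *)
Lemma schur_inner (T : eqType) (s : seq T) (x : T -> H) (b : T -> T -> R[i]) :
  (forall c : T -> R[i], 0 <= \sum_(i <- s) \sum_(j <- s) c i * (c j)^* * b i j) ->
  0 <= \sum_(i <- s) \sum_(j <- s) inner (x i) (x j) * b i j.
Proof.
move=> b0; have [es hes] := orthonormal_expansion (map x s).
have -> : \sum_(i <- s) \sum_(j <- s) inner (x i) (x j) * b i j =
  \sum_(e <- es) \sum_(i <- s) \sum_(j <- s) inner (x i) e * (inner (x j) e)^* * b i j.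
  rewrite [RHS]exchange_big; apply: eq_big_seq => i si.
  rewrite [RHS]exchange_big; apply: eq_big_seq => j sj; rewrite -mulr_suml.
  rewrite {1}(hes (x i)) ?mem_cat ?map_f// inner_suml.
  by congr (_ * _); apply: eq_bigr => e _; rewrite innerZl [inner e _]innerC.
by apply: sumr_ge0 => e _; exact: b0.
Qed.

Lemma gram_psd (T : Type) (s : seq T) (x : T -> H) (c : T -> R[i]) :
  0 <= \sum_(i <- s) \sum_(j <- s) c i * (c j)^* * inner (x i) (x j).
Proof.
have -> : \sum_(i <- s) \sum_(j <- s) c i * (c j)^* * inner (x i) (x j) =
    inner (\sum_(i <- s) c i *: x i) (\sum_(i <- s) c i *: x i).
  rewrite inner_suml; apply: eq_bigr => i _; rewrite inner_sumr.
  by apply: eq_bigr => j _; rewrite innerZl innerZr mulrA.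
by rewrite inner_norm exprn_ge0.
Qed.

(** The sum is |A|^2 |v|^2 - |A v|^2 for v the combination of the x i. Paired with [schur_inner], it
    bounds an operator acting on one leg of a tensor product. *)
Lemma gram_bop_psd (A : bop H H) (T : Type) (s : seq T) (x : T -> H) (c : T -> R[i]) :
  0 <= \sum_(i <- s) \sum_(j <- s) c i * (c j)^* *
    ((opnorm A ^+ 2)%:C%C * inner (x i) (x j) - inner (A (x i)) (A (x j))).
Proof.
set v := \sum_(i <- s) c i *: x i.
have -> : \sum_(i <- s) \sum_(j <- s) c i * (c j)^* *
    ((opnorm A ^+ 2)%:C%C * inner (x i) (x j) - inner (A (x i)) (A (x j))) =
    (opnorm A ^+ 2)%:C%C * inner v v - inner (A v) (A v).
  rewrite /v linear_sum !inner_suml mulr_sumr -sumrB; apply: eq_bigr => i _.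
  rewrite !inner_sumr mulr_sumr -sumrB; apply: eq_bigr => j _.
  by rewrite !linearZ !innerZl !innerZr; ring.
rewrite !inner_nr -rmorphM -rmorphB ler0c subr_ge0 -exprMn.
by rewrite ler_pXn2r ?nnegrE ?nr_ge0 ?mulr_ge0 ?nr_ge0 ?opnorm_ge0// nr_bop.
Qed.

End SchurProduct.

(** * The representation on l2(Z) (x) H (x) H *)

Section TensorRepresentation.
Variables (R : realType) (H : hilbertType R) (B : cstarSubalg H) (xi : H).
Hypothesis xi1 : nr xi = 1.

Notation J := (int * H * H)%type.

(** A point (n, x, h) stands for e_n (x) x (x) h; scalars act through the last leg. *)
Definition tf (i j : J) : R[i] :=
  (i.1.1 == j.1.1)%:R * (inner i.1.2 j.1.2 * inner i.2 j.2).

Fact tfZ c (i j : J) : tf (i.1, c *: i.2) j = c * tf i j.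
Proof. by rewrite /tf /= innerZl; ring. Qed.

Fact tfC (i j : J) : tf j i = (tf i j)^*.
Proof. by rewrite /tf eq_sym !rmorphM /= conjC_nat -!innerC. Qed.

Fact tf_psd (s : seq J) : 0 <= \sum_(i <- s) \sum_(j <- s) tf i j.
Proof.
apply: delta_psd => n t _.
apply: (@schur_inner _ _ _ t (fun i : J => i.1.2) (fun i j => inner i.2 j.2)) => c.
exact: gram_psd.
Qed.

Fact tf_neq0 : exists i, tf i i != 0.
Proof.
by exists (0, xi, xi); rewrite /tf eqxx mul1r /= inner_nr xi1 expr1n mulr1 oner_neq0.
Qed.

Definition tkernel : kernel R := Kernel tfZ tfC tf_psd tf_neq0.

Let L := khilb tkernel.

Definition te (n : int) (x h : H) : L := iota [:: ((n, x, h) : tkernel)].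

Lemma te_inner n x h m y k :
  inner (te n x h) (te m y k) = (n == m)%:R * (inner x y * inner h k).
Proof. by rewrite inner_iota1. Qed.

Lemma te_shift : exists2 U : bop L L, unitary U &
  (forall n x h, U (te n x h) = te (n + 1) x h) /\
  (forall n x h, star U (te n x h) = te (n - 1) x h).
Proof.
pose tau d (i : tkernel) : tkernel := (i.1.1 + d, i.1.2, i.2).
have tA d (i j : tkernel) : kf (tau d i) j = kf i (tau (- d) j).
  by rewrite /= /tf /= -(subr_eq _ _ (- d)) opprK.
have [|r|U [h1 h2]] := @kop_ex R tkernel (tau 1) (tau (-1)) 1 (tA 1).
- exact: ler01.
- rewrite mul1r le_eqVlt; apply/orP; left; apply/eqP; congr (Num.sqrt (complex.Re _)).
  rewrite /kform big_map; apply: eq_bigr => i _; rewrite big_map; apply: eq_bigr => j _.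
  by rewrite /= /tf /= (inj_eq (addIr _)).
exists U; last first.
  by split=> n x h; [exact: (h1 (n, x, h))|exact: (h2 (n, x, h))].
split; apply: bop_iota_ext => i /=; rewrite ?h1 ?h2 ?h1 ?h2; congr (iota [:: _]);
  by case: i => -[n x] h; rewrite /tau /= ?addrK ?subrK.
Qed.

Definition tact (cnd : pred int) (b : B) (i : J) : J :=
  if cnd i.1.1 then (i.1, val b i.2) else (i.1.1, val b i.1.2, i.2).

(** The substantial point is boundedness. The difference |b|^2 <s, s> - <b s, b s> is block diagonal
    in the integer, and on each block b touches one leg, so the difference is the Schur product of
    the Gram matrix of the other leg with the kernel of [gram_bop_psd]. *)
Lemma te_rep (cnd : pred int) : exists alpha : {lrmorphism B -> bop L L},
  star_preserving alpha /\ forall b n x h, alpha b (te n x h) =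
    if cnd n then te n x (val b h) else te n (val b x) h.
Proof.
have [| | | | |alpha [aS aE]] := @kernel_rep R tkernel B (tact cnd).
- move=> b [[n x] h] [[m y] k]; rewrite /= /tf /tact /=.
  case: ifP => cn; case: ifP => cm /=; have [e|_] := eqVneq n m; rewrite ?mul0r//.
  + by rewrite -adjE.
  + by rewrite e cm in cn.
  + by rewrite e cm in cn.
  + by rewrite -adjE.
- move=> b; exists (opnorm (val b)) => [|r]; first exact: opnorm_ge0.
  rewrite -(@ler_pXn2r _ 2) ?nnegrE ?mulr_ge0 ?kq_ge0 ?opnorm_ge0// exprMn.
  rewrite -lecR -kq_sqr [leRHS]rmorphM /= -kq_sqr -subr_ge0.
  have -> : (opnorm (val b) ^+ 2)%:C%C * kform r r -
      kform (map (tact cnd b : tkernel -> tkernel) r)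
        (map (tact cnd b : tkernel -> tkernel) r) =
    \sum_(i <- r) \sum_(j <- r) (i.1.1 == j.1.1)%:R *
      ((opnorm (val b) ^+ 2)%:C%C * (inner i.1.2 j.1.2 * inner i.2 j.2) -
       inner (tact cnd b i).1.2 (tact cnd b j).1.2 *
       inner (tact cnd b i).2 (tact cnd b j).2).
    rewrite /kform big_map mulr_sumr -sumrB; apply: eq_bigr => i _.
    rewrite big_map mulr_sumr -sumrB; apply: eq_bigr => j _ /=; rewrite /tf.
    have tn k : (tact cnd b k).1.1 = k.1.1 by rewrite /tact; case: ifP.
    by rewrite !tn; ring.
  apply: delta_psd => n t tn.
  case cn : (cnd n).
    have -> : \sum_(i <- t) \sum_(j <- t)
      ((opnorm (val b) ^+ 2)%:C%C * (inner i.1.2 j.1.2 * inner i.2 j.2) -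
       inner (tact cnd b i).1.2 (tact cnd b j).1.2 *
       inner (tact cnd b i).2 (tact cnd b j).2) =
      \sum_(i <- t) \sum_(j <- t) inner i.1.2 j.1.2 *
        ((opnorm (val b) ^+ 2)%:C%C * inner i.2 j.2 - inner (val b i.2) (val b j.2)).
      apply: eq_big_seq => i ti; apply: eq_big_seq => j tj.
      by rewrite /tact !tn// cn /=; ring.
    apply: (@schur_inner _ _ _ t (fun i : J => i.1.2)) => c; exact: gram_bop_psd.
  have -> : \sum_(i <- t) \sum_(j <- t)
      ((opnorm (val b) ^+ 2)%:C%C * (inner i.1.2 j.1.2 * inner i.2 j.2) -
       inner (tact cnd b i).1.2 (tact cnd b j).1.2 *
       inner (tact cnd b i).2 (tact cnd b j).2) =
    \sum_(i <- t) \sum_(j <- t) inner i.2 j.2 *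
      ((opnorm (val b) ^+ 2)%:C%C * inner i.1.2 j.1.2 - inner (val b i.1.2) (val b j.1.2)).
    apply: eq_big_seq => i ti; apply: eq_big_seq => j tj.
    by rewrite /tact !tn// cn /=; ring.
  apply: (@schur_inner _ _ _ t (fun i : J => i.2)) => c; exact: gram_bop_psd.
- move=> a b c [[n x] h] [[m y] k]; rewrite /= /tf /tact /=.
  by case: ifP => cn /=; rewrite innerDl innerZl; ring.
- move=> b c [[n x] h] [[m y] k]; rewrite /= /tf /tact /=.
  by case cn : (cnd n); rewrite /= cn.
- move=> [[n x] h] [[m y] k]; rewrite /= /tf /tact /=; by case: ifP.
exists alpha; split=> // b n x h; rewrite /te aE /tact /=.
by case: ifP.
Qed.

End TensorRepresentation.

(** * Conditional expectations compressed from l2(Z) (x) H (x) H *)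

Section WordOperators.
Variables (R : realType) (H : hilbertType R) (B : cstarSubalg H) (xi : H).
Hypothesis xi1 : nr xi = 1.
Notation L := (khilb (tkernel xi1)).
Notation te := (te xi1).
Implicit Types (P Q : int -> int -> Prop) (S T : bop L L) (l : seq (int * bop H H * bop H H)).

(* On the n-th summand of l2(Z) (x) H (x) H, T is a finite sum of operators
   e_m (x) C (x) b with b in B and P n m. *)
Definition elementary P T := forall n : int, exists l,
  {in l, forall z, P n z.1.1 /\ z.2 \in B} /\
  forall x h, T (te n x h) = \sum_(z <- l) te z.1.1 (z.1.2 x) (z.2 h).

Lemma elementary0 P : elementary P 0.
Proof. by move=> n; exists [::]; split=> // x h; rewrite big_nil. Qed.

Lemma elementaryD P S T : elementary P S -> elementary P T -> elementary P (S + T).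
Proof.
move=> hS hT n; have [l [lP lE]] := hS n; have [m [mP mE]] := hT n.
exists (l ++ m); split=> [z|x h]; first by rewrite mem_cat => /orP[/lP|/mP].
by rewrite big_cat -lE -mE.
Qed.

Lemma elementaryZ P c T : elementary P T -> elementary P (c *: T).
Proof.
move=> hT n; have [l [lP lE]] := hT n.
exists [seq (z.1, c *: z.2) | z <- l]; split=> [_ /mapP[z /lP[h1 h2] ->]|x h].
  by split=> //=; rewrite rpredZ.
rewrite big_map -[LHS]/(c *: T (te n x h)) lE scaler_sumr; apply: eq_bigr => z _.
by apply: khilb_ext => -[[m y] k]; rewrite innerZl !te_inner innerZl; ring.
Qed.

Lemma elementaryM P Q T S : elementary P T -> elementary Q S ->
  elementary (fun n m => exists2 p, Q n p & P p m) (T * S).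
Proof.
move=> hT hS n; have [l [lQ lE]] := hS n.
have [f hf] := choice hT.
exists (flatten [seq [seq (y.1.1, y.1.2 * z.1.2, y.2 * z.2) | y <- f z.1.1] | z <- l]).
split=> [w /flatten_mapP[z zl /mapP[y yf ->]] /=|x h].
  have [h1 h2] := lQ z zl; have [/(_ y yf)[h3 h4] _] := hf z.1.1.
  by split; [exists z.1.1|rewrite rpredM].
rewrite big_flatten big_map -[LHS]/(T (S (te n x h))) lE linear_sum.
apply: eq_bigr => z _; rewrite -[LHS]/(T (te _ _ _)) (hf z.1.1).2 big_map.
by apply: eq_bigr.
Qed.

Lemma elementary_sub P Q T : (forall n m, P n m -> Q n m) -> elementary P T ->
  elementary Q T.
Proof.
move=> PQ hT n; have [l [lP lE]] := hT n; exists l; split=> // z /lP[h1 h2].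
by split=> //; exact: PQ.
Qed.

Lemma elementary1 : elementary (fun n m => m = n) 1.
Proof.
move=> n; exists [:: (n, 1, 1)]; split=> [z|x h].
  by rewrite in_cons orbF => /eqP -> /=; rewrite rpred1.
by rewrite big_seq1.
Qed.

Fact te_emb_linear : linear (te 0 xi).
Proof.
move=> c h k; apply: khilb_ext => -[[m y] v]; rewrite innerDl innerZl !te_inner.
by rewrite innerDl innerZl; ring.
Qed.

Lemma te_embE h : `|te 0 xi h| = `|h|.
Proof.
apply: (@pexpIrn _ 2) => //; rewrite ?nnegrE ?normr_ge0// -!inner_norm te_inner.
by rewrite eqxx (inner_nr xi) xi1 expr1n !mul1r.
Qed.

Fact te_emb_bounded : exists M : R, forall h, `|te 0 xi h| <= M%:C%C * `|h|.
Proof. by exists 1 => h; rewrite mul1r te_embE. Qed.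

Definition te_emb : bop H L := Bop te_emb_linear te_emb_bounded.

(** Compressing e_m (x) C (x) b to e_0 (x) xi (x) H leaves <C xi, xi> b if m = 0 and nothing
    otherwise. This yields values in B, and vanishing as soon as the integer reached is not 0. *)
Lemma compress_elementary P T : elementary P T -> exists l,
  {in l, forall z, P 0 z.1.1 /\ z.2 \in B} /\
  compress te_emb T = \sum_(z <- l) ((z.1.1 == 0)%:R * inner (z.1.2 xi) xi) *: z.2.
Proof.
move=> /(_ 0)[l [lP lE]]; exists l; split=> //.
apply: bopP => h; apply: inner_injl => k; rewrite inner_compress bop_sumE.
rewrite -[te_emb h]/(te 0 xi h) -[te_emb k]/(te 0 xi k) lE !inner_suml.
by apply: eq_bigr => z _; rewrite te_inner innerZl mulrA.
Qed.

Variable cnd : pred int.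
Variables (U : bop L L) (alpha : {lrmorphism B -> bop L L}).
Variable p : {lrmorphism AB B -> bop L L}.
Hypothesis cnd0 : cnd 0.
Hypothesis UE : forall n x h, U (te n x h) = te (n + 1) x h.
Hypothesis sUE : forall n x h, star U (te n x h) = te (n - 1) x h.
Hypothesis alphaE : forall b n x h, alpha b (te n x h) =
  if cnd n then te n x (val b h) else te n (val b x) h.
Hypothesis pS : star_preserving p.
Hypothesis pB : forall b, p (fp_in b) = alpha b.
Hypothesis pU : p (fp_u B) = U.

Lemma elementary_alpha b : elementary (fun n m => m = n) (alpha b).
Proof.
move=> n; case cn : (cnd n).
- exists [:: (n, 1, val b)]; split=> [z|x h].
    by rewrite in_cons orbF => /eqP -> /=; split=> //; exact: cstar_valP.
  by rewrite big_seq1 alphaE cn.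
- exists [:: (n, val b, 1)]; split=> [z|x h].
    by rewrite in_cons orbF => /eqP -> /=; rewrite rpred1.
  by rewrite big_seq1 alphaE cn.
Qed.

Lemma elementary_U : elementary (fun n m => m = n + 1) U.
Proof.
move=> n; exists [:: (n + 1, 1, 1)]; split=> [z|x h].
  by rewrite in_cons orbF => /eqP -> /=; rewrite rpred1.
by rewrite big_seq1 UE.
Qed.

Lemma elementary_starU : elementary (fun n m => m = n - 1) (star U).
Proof.
move=> n; exists [:: (n - 1, 1, 1)]; split=> [z|x h].
  by rewrite in_cons orbF => /eqP -> /=; rewrite rpred1.
by rewrite big_seq1 sUE.
Qed.

(** The adjoint is carried along in the induction, since stability of [elementary] under adjoints is
    not visible from its definition. *)
Lemma elementary_word (m : AB B) : elementary (fun _ _ => True) (p m).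
Proof.
have sub P T : elementary P T -> elementary (fun _ _ => True) T by exact: elementary_sub.
suff h s : elementary (fun _ _ => True) (p (fp_pi s)) /\
    elementary (fun _ _ => True) (p (star (fp_pi s : AB B))).
  by elim/fp_ind: m => s; case: (h s).
elim: s => [b||s [s1 s2] t [t1 t2]|c s [s1 s2]|s [s1 s2] t [t1 t2]|s [s1 s2]].
- rewrite -[fp_pi _]/(fp_in b) -fp_in_star !pB.
  by split; apply: sub (elementary_alpha _).
- rewrite -[fp_pi _]/(fp_u B) pS pU.
  by split; [apply: sub elementary_U|apply: sub elementary_starU].
- rewrite -fp_addE -[fp_add _ _]/((fp_pi s : AB B) + fp_pi t) starD !rmorphD.
  by split; apply: elementaryD.
- rewrite -fp_scaleE -[fp_scale _ _]/(c *: (fp_pi s : AB B)) starZ !linearZ.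
  by split; apply: elementaryZ.
- rewrite -fp_mulE -[fp_mul _ _]/((fp_pi s : AB B) * fp_pi t) starM !rmorphM.
  by split; [exact: sub (elementaryM s1 t1)|exact: sub (elementaryM t2 s2)].
- rewrite -fp_starE -[fp_star _]/(star (fp_pi s : AB B)) starK.
  by split.
Qed.

Lemma elementary_sum P I (r : seq I) (F : I -> bop L L) :
  (forall i, elementary P (F i)) -> elementary P (\sum_(i <- r) F i).
Proof.
move=> hF; elim: r => [|i r IH]; first by rewrite big_nil; exact: elementary0.
by rewrite big_cons; apply: elementaryD.
Qed.

(** B preserves the integer and u raises it by one, so k factors u b raise it by exactly k. *)
Lemma elementary_wordmx n (X : 'M[B]_n) k i j :
  elementary (fun a b => b = a + k%:Z) (p ((wordmx X ^+ k) i j)).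
Proof.
elim: k i j => [|k IH] i j.
  apply: (@elementary_sub (fun a b => b = a)) => [a b ->|]; first by rewrite addr0.
  rewrite mxE; case: eqP => _; last by rewrite mulr0n rmorph0; exact: elementary0.
  by rewrite mulr1n rmorph1; exact: elementary1.
rewrite mxexprS mxE rmorph_sum; apply: elementary_sum => l.
rewrite rmorphM.
apply: (@elementary_sub (fun a b => exists2 c, c = a + k%:Z & b = c + 1)).
  by move=> a b [c -> ->]; rewrite intS [1 + _]addrC addrA.
apply: (@elementaryM (fun a b => b = a + 1) (fun a b => b = a + k%:Z) _ _ _ (IH l j)).
have pw : p (wordmx X i l) = U * alpha (X i l).
  by rewrite -pU -pB -rmorphM /wordmx mul_scalar_mx !mxE.
rewrite -[Z in elementary _ Z]/(p (wordmx X i l)) pw.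
apply: (@elementary_sub (fun a b => exists2 c, c = a & b = c + 1)).
  by move=> a b [c -> ->].
exact: elementaryM elementary_U (elementary_alpha _).
Qed.

Definition tphi (m : AB B) : bop H H := compress te_emb (p m).

Lemma tphiD a b : tphi (a + b) = tphi a + tphi b.
Proof. by rewrite /tphi rmorphD linearD. Qed.

Lemma tphi_condexp : condexp B tphi.
Proof.
split.
- exact: (@opstate_compress R H B L p te_emb pS te_embE).
- move=> m; rewrite /tphi; have [l [lB ->]] := compress_elementary (elementary_word m).
  by rewrite big_seq rpred_sum// => z /lB[_ zB]; rewrite rpredZ.
- move=> b1 b2 m; apply: bopP => h; apply: inner_injl => k.
  (* Here [cnd 0] is used: over 0 the algebra acts on the last leg, so alpha b V = V b, which yields
     the bimodule property. *)
  have aV b v : alpha b (te_emb v) = te_emb (val b v) by rewrite /= alphaE cnd0.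
  rewrite inner_compress.
  have -> : p (fp_in b1 * m * fp_in b2) = alpha b1 * p m * alpha b2.
    by rewrite -!pB -!rmorphM.
  rewrite -[X in inner X _]/(alpha b1 (p m (alpha b2 (te_emb h)))) aV (adjE (alpha b1)).
  have -> : adj (alpha b1) (te_emb k) = te_emb (val (star b1) k).
    by rewrite -[adj _]/(star (alpha b1)) -pB -pS -fp_in_star pB aV.
  rewrite -inner_compress -[compress _ _ _]/(tphi m (val b2 h)).
  by rewrite -[val (star b1)]/(adj (val b1)) -adjE.
Qed.

Lemma tphi_wordmx n (X : 'M[B]_n) k i j : tphi ((wordmx X ^+ k.+1) i j) = 0.
Proof.
rewrite /tphi; have [l [lP ->]] := compress_elementary (@elementary_wordmx n X k.+1 i j).
rewrite big_seq big1// => z /lP[-> _].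
by rewrite add0r -[_ == _]/(k.+1 == 0)%N /= mul0r scale0r.
Qed.

Lemma tphi_mpsum n (X : 'M[B]_n) k i j :
  tphi (mpsum (wordmx X) k.+1 i j) = (1%:M : 'M[bop H H]_n) i j.
Proof.
elim: k => [|k IH].
  rewrite mpsumS mpsum0 add0r !mxE; case: eqP => _.
    by rewrite !mulr1n /tphi rmorph1 (@compress1 _ _ _ te_emb te_embE).
  by rewrite !mulr0n /tphi rmorph0 linear0.
rewrite mpsumS mxE tphiD IH.
by rewrite tphi_wordmx addr0.
Qed.

Lemma gfun_tphi : gfun B tphi = fun n X => 1%:M.
Proof.
have [tS _ _] := tphi_condexp.
apply: functional_extensionality_dep => n; apply/funext => X; apply/matrixP => i j.
apply: bopP => x; apply/eqP; rewrite -subr_eq0 -nr_eq0 eq_le nr_ge0 andbT.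
(* Every nonempty partial sum is mapped to 1, so the approximants equal 2 - 1 = 1 at every order.
   The extra factor r in [C] absorbs the shift from k to k + 1 in the exponent. *)
set r := mxnorm (map_mx val X); set C := 2 * (1 - r)^-1 * r * nr x.
apply: (@ler_pow _ r _ _ C) => [|k]; first exact: cball_norm01.
have := gfun_apx tS X k.+1 i j x.
rewrite tphi_mpsum mulr2n addrK -/r exprS add0r /C.
by move=> /le_trans; apply; rewrite le_eqVlt; apply/orP; left; apply/eqP; ring.
Qed.

Lemma tphi_conj b : tphi (star (fp_u B) * fp_in b * fp_u B) =
  if cnd 1 then val b else inner (val b xi) xi *: 1.
Proof.
apply: bopP => h; apply: inner_injl => k; rewrite inner_compress.
have -> : p (star (fp_u B) * fp_in b * fp_u B) = star U * alpha b * U.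
  by rewrite -pB -pU -pS -!rmorphM.
rewrite -[X in inner X _]/(star U (alpha b (U (te 0 xi h)))) UE add0r alphaE.
case: ifP => _; rewrite sUE subrr te_inner eqxx mul1r.
  by rewrite inner_nr xi1 expr1n mul1r.
by rewrite innerZl.
Qed.

End WordOperators.

Lemma tphi_exists (R : realType) (H : hilbertType R) (B : cstarSubalg H) (xi : H)
    (cnd : pred int) : nr xi = 1 -> cnd 0 -> exists phi : AB B -> bop H H,
  [/\ condexp B phi, gfun B phi = fun n X => 1%:M &
   forall b, phi (star (fp_u B) * fp_in b * fp_u B) =
     if cnd 1 then val b else inner (val b xi) xi *: 1].
Proof.
move=> xi1 c0; have [U Uu [UE sUE]] := te_shift xi1.
have [alpha [aS aE]] := te_rep B xi1 cnd.
have [p [pS pB pU]] := freeprodZ_lift aS Uu.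
exists (tphi p); split.
- exact: (tphi_condexp c0 UE sUE aE pS pB pU).
- exact: (gfun_tphi c0 UE sUE aE pS pB pU).
- exact: (tphi_conj UE sUE aE pS pB pU).
Qed.

Lemma gfun_not_injective (R : realType) (H : hilbertType R) (B : cstarSubalg H) :
  ~ one_dimensional (B : lmodType R[i]) -> ~ set_inj (condexp B) (gfun B).
Proof.
move=> dimB inj; apply: dimB.
have [y y0] := @hilbert_nontrivial _ H.
have ny : 0 < nr y by rewrite lt_neqAle nr_ge0 andbT eq_sym nr_eq0.
pose xi := (nr y)^-1%:C%C *: y.
have xi1 : nr xi = 1 by rewrite nrZ nr_real gtr0_norm ?invr_gt0// mulVf// gt_eqF.
(* [predT] puts the last leg over 1, whereas [pred1 0] puts the middle leg there; the value at u^* b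
   u tells the two states apart. *)
have [phi [phiC phiG phiE]] := @tphi_exists R H B xi predT xi1 isT.
have [psi [psiC psiG psiE]] := @tphi_exists R H B xi (pred1 0) xi1 (eqxx _).
have pp : phi = psi by apply: inj; rewrite ?inE// phiG psiG.
exists 1; first exact: oner_neq0.
move=> b; exists (inner (val b xi) xi); apply: val_inj.
by have := psiE b; rewrite -pp phiE /=; exact.
Qed.

(** * Compactness *)

Section UltraLimits.
Variables (R : realType) (T : Type) (F : set_system T).

Definition tends (c : T -> R[i]) (L : R[i]) :=
  forall e : R, 0 < e -> F [set g | nr (c g - L) < e].

(** The limit is the supremum of the x below [c] on a set of the ultrafilter. By the ultrafilter
    dichotomy either sup + e/2 <= c or its negation holds on such a set, and the first alternative
    contradicts the supremum. *)
Lemma ultra_real_lim (c : T -> R) (M : R) : UltraFilter F ->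
  F [set g | `|c g| <= M] -> exists l, forall e : R, 0 < e -> F [set g | `|c g - l| < e].
Proof.
move=> UF FM; pose S := [set x : R | F [set g | x <= c g]].
have SM : ubound S M.
  move=> x Sx; have [g [/= h1 h2]] := filter_ex (filterI Sx FM).
  by apply: le_trans h1 (le_trans (ler_norm _) h2).
have S0 : S (- M).
  by apply: filterS FM => g /=; rewrite ler_norml => /andP[].
have hs : has_sup S by split; [exists (- M)|exists M].
exists (sup S) => e e0.
have [x Sx xs] := sup_adherent (divr_gt0 e0 (ltr0Sn R 1)) hs.
have [Fu|Fu] := in_ultra_setVsetC [set g | sup S + e / 2 <= c g] UF.
  by have := ub_le_sup (ex_intro _ M SM) Fu; lra.
apply: filterS (filterI Sx Fu) => g /= [h1] /negP; rewrite -ltNge => h2.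
by rewrite ltr_norml; apply/andP; split; lra.
Qed.

Lemma ultra_lim (c : T -> R[i]) (M : R) : UltraFilter F ->
  F [set g | nr (c g) <= M] -> exists L, tends c L.
Proof.
move=> UF FM.
have [|a ha] := @ultra_real_lim (fun g => complex.Re (c g)) M UF.
  by apply: filterS FM => g /=; apply: le_trans; exact: le_Re_nr.
have [|b hb] := @ultra_real_lim (fun g => complex.Im (c g)) M UF.
  by apply: filterS FM => g /=; apply: le_trans; exact: le_Im_nr.
exists (a +i* b)%C => e e0; have e2 : 0 < e / 2 by rewrite divr_gt0.
apply: filterS (filterI (ha _ e2) (hb _ e2)) => g /= [h1 h2].
apply: le_lt_trans (nr_le_ReIm _) _.
by case: (c g) h1 h2 => u v /= h1 h2; lra.
Qed.

Context {FF : ProperFilter F}.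

Lemma tends_near c d L : F [set g | c g = d g] -> tends c L -> tends d L.
Proof.
by move=> cd cL e e0; apply: filterS (filterI cd (cL e e0)) => g /= [<-].
Qed.

Lemma tends_unique c L M : tends c L -> tends c M -> L = M.
Proof.
move=> cL cM; apply/eqP; rewrite -subr_eq0; apply/eqP.
apply: nr_small0 => e e0; have e2 : 0 < e / 2 by rewrite divr_gt0.
have [g /= [h1 h2]] := filter_ex (filterI (cL _ e2) (cM _ e2)).
by have := ler_nr_dist (c g) L M; rewrite (nr_distC L (c g)); lra.
Qed.

Lemma tends_cst L : tends (fun=> L) L.
Proof. by move=> e e0; apply: filterE => g /=; rewrite subrr nr0. Qed.

Lemma tendsD c d L M : tends c L -> tends d M -> tends (fun g => c g + d g) (L + M).
Proof.
move=> cL dM e e0; have e2 : 0 < e / 2 by rewrite divr_gt0.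
apply: filterS (filterI (cL _ e2) (dM _ e2)) => g /= [h1 h2].
by rewrite opprD addrACA; have := ler_nrD (c g - L) (d g - M); lra.
Qed.

Lemma tendsZ a c L : tends c L -> tends (fun g => a * c g) (a * L).
Proof.
move=> cL e e0; have a1 : 0 < nr a + 1 by rewrite ltr_wpDl ?nr_ge0.
apply: filterS (cL _ (divr_gt0 e0 a1)) => g /= h.
rewrite -mulrBr nrM; have : nr a * nr (c g - L) <= nr a * (e / (nr a + 1)).
  by rewrite ler_wpM2l ?nr_ge0// ltW.
move=> /le_lt_trans; apply; rewrite mulrCA gtr_pMr// ltr_pdivrMr// mul1r ltrDl.
exact: ltr01.
Qed.

Lemma tendsB c d L M : tends c L -> tends d M -> tends (fun g => c g - d g) (L - M).
Proof.
move=> cL dM; have := tendsD cL (tendsZ (-1) dM).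
by under eq_fun do rewrite mulN1r; rewrite mulN1r.
Qed.

Lemma tends_sum I (r : seq I) (c : I -> T -> R[i]) (L : I -> R[i]) :
  (forall i, tends (c i) (L i)) -> tends (fun g => \sum_(i <- r) c i g) (\sum_(i <- r) L i).
Proof.
move=> cL; elim: r => [|i r IH].
  by rewrite big_nil; under eq_fun do rewrite big_nil; exact: tends_cst.
by rewrite big_cons; under eq_fun do rewrite big_cons; exact: tendsD.
Qed.

Lemma tends_ge0 c L : F [set g | 0 <= c g] -> tends c L -> 0 <= L.
Proof.
move=> c0 cL.
have ex n : exists v : R[i], 0 <= v /\ nr (L - v) <= 1 * geo R n.
  have [g /= [h1 h2]] := filter_ex (filterI c0 (cL _ (geo_gt0 R n))).
  by exists (c g); split=> //; rewrite mul1r nr_distC ltW.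
have [v hv] := choice ex.
by apply: (@ge0_lim R L 1 v) => n; have [] := hv n.
Qed.

Lemma tends_le c L M : F [set g | nr (c g) <= M] -> tends c L -> nr L <= M.
Proof.
move=> cM cL; apply/ler_addgt0Pr => e e0.
have [g /= [h1 h2]] := filter_ex (filterI cM (cL e e0)).
by rewrite -[L](subrK (c g)) (le_trans (ler_nrD _ _))// nr_distC; lra.
Qed.

Lemma tends_cvg c L : tends c L -> c @ F --> (L : R[i]^o).
Proof.
move=> cL; apply/(@cvgrPdist_lt _ R[i]^o) => e e0.
have e1 : 0 < complex.Re e by rewrite -ltcR -ge0_ReE// ltW.
apply: filterS (cL _ e1) => g /=.
rewrite nr_distC => h; rewrite (ge0_ReE (ltW e0)).
by rewrite -[`|_|]/(`|L - c g|) nrE ltcR.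
Qed.

End UltraLimits.

(** * Convergence in initial and pointwise topologies *)

Lemma initial_cvg (S : choiceType) (T : topologicalType) (f : S -> T)
    (F : set_system S) (s : S) : Filter F ->
  f @ F --> f s -> F --> (s : initial_topology f).
Proof.
move=> FF h A; rewrite nbhsE => -[_ [[C Cop <-] Cfs] CA].
by apply: filterS CA _; apply: h; exact: open_nbhs_nbhs.
Qed.

Lemma ptws_cvg (U : Type) (V : topologicalType) (G : set_system {ptws U -> V})
    (f : {ptws U -> V}) : Filter G ->
  (forall t, (fun g : U -> V => g t) @ G --> f t) -> G --> f.
Proof.
move=> GF h; apply/cvg_sup => t.
exact: (@initial_cvg _ _ (fun g : U -> V => g t) G f GF (h t)).
Qed.

Section OpstateBound.
Variables (R : realType) (A : starAlgType R) (N : A -> R) (H : hilbertType R).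

(** Cauchy-Schwarz for the GNS form between m (x) h and 1 (x) k. The constant depends on m but not
    on the state, which supplies the boundedness for ultrafilter limits. *)
Lemma opstate_bound (phi : A -> bop H H) m h k : opstate N phi ->
  nr (inner (phi m h) k) <= Num.sqrt `|N (star m * m)| * nr h * nr k.
Proof.
move=> phiS; have [_ phi1 _ _] := phiS.
pose x : gkernel phiS := (1, h); pose y : gkernel phiS := (1, k).
have e (a : A) (v : H) : kq [:: ((1 : A), v) : gkernel phiS] = nr v.
  rewrite /kq /kform !big_seq1 /= /gf /= star1 mulr1 phi1 /= inner_nr /= sqrtr_sqr.
  by rewrite ger0_norm ?nr_ge0.
have := @opstate_bounded _ _ _ _ _ phiS m [:: x]; rewrite /= (e 1) => h1.
have := nr_kform [:: ((m * 1, h) : gkernel phiS)] [:: y].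
rewrite (e 1) {1}/kform !big_seq1 /= /gf /= star1 mul1r mulr1 => /le_trans; apply.
rewrite mulr1 in h1.
by rewrite ler_wpM2r ?nr_ge0.
Qed.

End OpstateBound.

Section Compactness.
Variables (R : realType) (H : hilbertType R) (B : cstarSubalg H).
Variables (F : set_system (pointwise_wot B)).
Hypothesis UF : UltraFilter F.
(** A representing state for each function in the set, so that limits of states can be taken along
    an ultrafilter of functions. *)
Variable sel : ncfun B -> (AB B -> bop H H).
Hypothesis selP : F [set g | condexp B (sel g) /\ gfun B (sel g) = g].

Let FP : ProperFilter F. Proof. by case: UF. Qed.
Let FF : Filter F. Proof. exact: filter_filter. Qed.

Let C (m : AB B) : R := Num.sqrt `|univ_norm (star m * m)|.

Let sel_bound m h k : F [set g | nr (inner (sel g m h) k) <= C m * nr h * nr k].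
Proof. by apply: filterS selP => g /= [[gS _ _] _]; exact: opstate_bound. Qed.

(** For fixed m and h the limiting coefficients are antilinear and bounded in k. Their conjugates
    are linear, and the vector that Riesz representation assigns to them is the value of the limit
    at h. *)
Lemma weak_limit_exists : exists phi0 : AB B -> bop H H,
  forall m h k, tends F (fun g => inner (sel g m h) k) (inner (phi0 m h) k).
Proof.
have exL (mhk : AB B * H * H) : exists L,
    tends F (fun g => inner (sel g mhk.1.1 mhk.1.2) mhk.2) L.
  exact: ultra_lim UF (sel_bound _ _ _).
have [L hL] := choice exL.
have Lle m h k : nr (L (m, h, k)) <= C m * nr h * nr k.
  exact: tends_le (sel_bound _ _ _) (hL (m, h, k)).
have exz (mh : AB B * H) : exists z, forall k, (L (mh, k))^* = inner k z.
  apply: (@riesz _ _ (fun k => (L (mh, k))^*) (C mh.1 * nr mh.2)).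
  - move=> x y; rewrite -rmorphD; congr (_^*).
    apply: (tends_unique (hL (mh, x + y))).
    under eq_fun do rewrite innerDr.
    exact: tendsD (hL (mh, x)) (hL (mh, y)).
  - move=> a x; rewrite -[a]conjCK -rmorphM; congr (_^*).
    apply: (tends_unique (hL (mh, _))); rewrite conjCK.
    under eq_fun do rewrite innerZr.
    exact: tendsZ (hL (mh, x)).
  - move=> x; rewrite (nrE x) -rmorphM -nr_le nrJ; case: mh => m h; exact: Lle.
have [z hz] := choice exz.
have zt m h k : tends F (fun g => inner (sel g m h) k) (inner (z (m, h)) k).
  rewrite innerC -hz conjCK; exact: hL (m, h, k).
have zl m : linear (fun h => z (m, h)).
  move=> a h h'; apply: inner_injl => k; apply: (tends_unique (zt _ _ _)).
  under eq_fun do rewrite linearP innerDl innerZl.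
  by rewrite innerDl innerZl; exact: tendsD (tendsZ a (zt m h k)) (zt m h' k).
have zb m : exists M : R, forall h, `|z (m, h)| <= M%:C%C * `|h|.
  exists (C m) => h; rewrite (nrE h) -rmorphM -nr_le.
  apply: le_sqr_cancel; first by rewrite mulr_ge0 ?sqrtr_ge0 ?nr_ge0.
  have -> : nr (z (m, h)) ^+ 2 = nr (inner (z (m, h)) (z (m, h))).
    by rewrite inner_nr nr_real ger0_norm// sqr_ge0.
  by rewrite -hz nrJ; exact: Lle.
by exists (fun m => Bop (zl m) (zb m)).
Qed.

(** Apart from membership of the values in B, each condition is an equality or inequality between
    finitely many matrix coefficients and passes to the limit. Membership in B is where weak
    closedness is used. *)
Lemma weak_limit_condexp (phi0 : AB B -> bop H H) : weakly_closed B ->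
  (forall m h k, tends F (fun g => inner (sel g m h) k) (inner (phi0 m h) k)) ->
  condexp B phi0.
Proof.
move=> Bclosed lim.
have posl n (a : 'I_n -> 'I_n -> AB B) :
    (forall g, condexp B (sel g) -> pos_family (fun i j => sel g (a i j))) ->
    pos_family (fun i j => phi0 (a i j)).
  move=> hg h.
  apply: (@tends_ge0 _ _ F _ (fun g => \sum_i \sum_j inner (sel g (a i j) (h i)) (h j))).
    by apply: filterS selP => g /= [gC _]; exact: hg.
  by do 2 apply: tends_sum => ?; exact: lim.
have nearE m h k m' h' k' (c : R[i]) : (forall g, condexp B (sel g) ->
    inner (sel g m h) k = c * inner (sel g m' h') k') ->
    inner (phi0 m h) k = c * inner (phi0 m' h') k'.
  move=> e; apply: (tends_unique (lim m h k)).
  apply: tends_near (tendsZ c (lim m' h' k')).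
  by apply: filterS selP => g /= [gC _]; rewrite e.
split; first split.
- move=> c x y; apply: bopP => h; apply: inner_injl => k.
  rewrite /= innerDl innerZl; apply: (tends_unique (lim _ h k)).
  apply: tends_near (tendsD (tendsZ c (lim x h k)) (lim y h k)).
  apply: filterS selP => g /= [[[gl _ _ _] _ _] _].
  by rewrite gl /= innerDl innerZl.
- apply: bopP => h; apply: inner_injl => k.
  apply: (tends_unique (lim _ h k)); apply: tends_near (tends_cst _).
  by apply: filterS selP => g /= [[[_ -> _ _] _ _] _].
- by move=> n a; apply: posl => g [[_ _ + _] _ _]; exact.
- by move=> n a b; apply: posl => g [[_ _ _ +] _ _]; exact.
- move=> m; apply: Bclosed => U nU.
  have cv : (fun g => sel g m : wot H) @ F --> (phi0 m : wot H).
    apply: initial_cvg; apply: ptws_cvg => -[h k].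
    exact: tends_cvg (lim m h k).
  have FU : F [set g | U (sel g m)] := cv U nU.
  have [g /= [[[_ gB _] _] gU]] := filter_ex (filterI selP FU).
  by exists (sel g m); split=> //=; exact: gB.
- move=> b1 b2 m; apply: bopP => h; apply: inner_injl => k.
  rewrite -[inner (bop_fun (_ * _) h) k]/(inner (val b1 (phi0 m (val b2 h))) k).
  (* Moving b1 to the other side leaves one matrix coefficient of the state on each side of the
     identity. *)
  rewrite (adjE (val b1)) -[RHS]mul1r; apply: nearE => g [_ _ gM].
  by rewrite mul1r gM -adjE.
Qed.

(** An e/3 argument. An order N depending only on X, the vectors and e makes the approximants
    accurate for all states at once, and these, being affine in a single value of the state,
    converge weakly. *)
Lemma weak_limit_gfun (phi0 : AB B -> bop H H) :
  (forall m h k, tends F (fun g => inner (sel g m h) k) (inner (phi0 m h) k)) ->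
  condexp B phi0 -> F --> (gfun B phi0 : pointwise_wot B).
Proof.
move=> lim [phi0S _ _]; apply: (@initial_cvg _ _ _ _ _ FF).
apply: ptws_cvg => -[n [[X h] k]].
suff t : tends F (fun g => mxinner (mxapp (g n X) h) k)
    (mxinner (mxapp (gfun B phi0 n X) h) k) by exact: tends_cvg t.
apply: tends_sum => i; under eq_fun do rewrite inner_suml.
rewrite inner_suml; apply: tends_sum => j; move: (h j) (k i) => {h k} x y e e0.
set r := mxnorm (map_mx val X); have r01 : 0 <= r < 1 := cball_norm01 X.
set D := 2 * (1 - r)^-1 * nr x * nr y.
have D0 : 0 <= D.
  by case/andP: r01 => _ r1; rewrite !mulr_ge0 ?nr_ge0 ?invr_ge0 ?ler0n// subr_ge0 ltW.
have D1 : 0 < D + 1 by rewrite ltr_wpDl.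
have e3 : 0 < e / 3 by rewrite divr_gt0.
have [N hN] := pow_small r01 (divr_gt0 e3 D1).
pose w := mpsum (wordmx X) N i j.
pose ap (phi : AB B -> bop H H) := phi w x *+ 2 - (1%:M : 'M[bop H H]_n) i j x.
have apx (phi : AB B -> bop H H) : opstate (@univ_norm R (AB B)) phi ->
    nr (inner (gfun B phi n X i j x) y - inner (ap phi) y) < e / 3.
  move=> phiS; rewrite -innerNl -innerDl; apply: le_lt_trans (nr_inner _ _) _.
  have := ler_wpM2r (nr_ge0 y) (gfun_apx phiS X N i j x).
  rewrite -/r -/w => /le_lt_trans; apply.
  have -> : 2 * (1 - r)^-1 * r ^+ N * nr x * nr y = D * r ^+ N by rewrite /D; ring.
  have rN : 0 <= r ^+ N by case/andP: r01 => ? _; rewrite exprn_ge0.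
  move: hN; rewrite ltr_pdivlMr// => hN; apply: le_lt_trans hN.
  by rewrite mulrC ler_wpM2l// lerDl.
have apt : tends F (fun g => inner (ap (sel g)) y) (inner (ap phi0) y).
  rewrite /ap; under eq_fun do rewrite innerDl innerNl mulr2n innerDl.
  rewrite innerDl innerNl mulr2n innerDl.
  by apply: tendsB (tends_cst _); apply: tendsD; exact: lim.
apply: filterS (filterI selP (apt _ e3)) => g /= [[[gS _ _] gE] h2].
have h1 := apx _ gS; have h3 := apx _ phi0S; rewrite gE in h1.
have := ler_nr_dist (inner (ap (sel g)) y) (inner (g n X i j x) y)
  (inner (gfun B phi0 n X i j x) y).
have := ler_nr_dist (inner (ap phi0) y) (inner (ap (sel g)) y)
  (inner (gfun B phi0 n X i j x) y).
rewrite (nr_distC (inner (ap phi0) y) (inner (gfun B phi0 n X i j x) y)) in h3 *.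
lra.
Qed.

End Compactness.

Lemma gfun_condexp_compact (R : realType) (H : hilbertType R) (B : cstarSubalg H) :
  weakly_closed B -> compact (gfun B @` condexp B : set (pointwise_wot B)).
Proof.
move=> Bclosed; rewrite compact_ultra => F UF FA.
(* Outside the image the chosen map is the dummy 0; since the image belongs to the ultrafilter,
   these values do not affect the limit. *)
have ex (g : ncfun B) : exists phi : AB B -> bop H H,
    (gfun B @` condexp B) g -> condexp B phi /\ gfun B phi = g.
  have [[phi phiC phiE]|ng] := pselect ((gfun B @` condexp B) g).
    by exists phi.
  by exists (fun=> 0).
have [sel hsel] := choice ex.
have selP : F [set g | condexp B (sel g) /\ gfun B (sel g) = g].
  by apply: filterS FA => g; exact: hsel.
have [phi0 lim] := weak_limit_exists UF selP.
have phi0C := weak_limit_condexp UF selP Bclosed lim.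
exists (gfun B phi0); split; first by exists phi0.
by have := weak_limit_gfun UF selP lim phi0C; exact.
Qed.

Theorem proposition2p4 (R : realType) (H : hilbertType R) (B : cstarSubalg H) :
  [/\ set_fun (condexp B) (rep_herglotz B) (gfun B),
      ~ one_dimensional (B : lmodType R[i]) ->
        ~ set_inj (condexp B) (gfun B) &
      weakly_closed B ->
        compact (gfun B @` condexp B : set (pointwise_wot B))].
Proof.
split; [|exact: gfun_not_injective|exact: gfun_condexp_compact].
by move=> phi [phiS _ _]; exact: gfun_rep_herglotz phiS.
Qed.
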